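(* Let $\Bbbk$ be a field, let $d\ge 1$ be an integer, let $S=\Bbbk[x,y]$ with the standard grading, and let $B=\bigoplus_{n\ge 0}S_{nd}$, graded by $B_n=S_{nd}$, be the homogeneous coordinate ring of the rational normal curve of degree $d$. Let $\mathbb{B}(B)$ be the cone of Betti tables over $B$. Then the extremal rays of the subcone of $\mathbb{B}(B)$ generated by the Betti tables of finite length graded $B$-modules are precisely the rays spanned by the Betti tables of finite length $B$-modules with pure resolutions of type $(d_0,d_1,d_2;\ell)$, where $d_0<d_1<d_2$ are integers and $\ell=0$ or $\ell=d-1$.
   Context: All modules are finitely generated and graded. For a $B$-module $M$, the graded Betti numbers are $\beta^B_{i,j}(M)=\dim_\Bbbk \operatorname{Tor}^B_i(\Bbbk,M)_j$, and the Betti table of $M$ is $\beta^B(M)=(\beta^B_{i,j}(M))_{i\ge 0,\,j\in\mathbb{Z}}$, an element of the $\mathbb{Q}$-vector space $\prod_{i\ge 0}\bigoplus_{j\in\mathbb{Z}}\mathbb{Q}$. The cone of Betti tables $\mathbb{B}(B)$ is the cone (closed under finite nonnegative rational linear combinations) generated by the rays $\mathbb{Q}_{\ge 0}\cdot\beta^B(M)$, with $M$ ranging over all finitely generated graded $B$-modules. For $0\le \ell\le d-1$ let $M^{(\ell)}=\bigoplus_{n\ge 0}S_{nd+\ell}$, a graded $B$-module with $n$-th graded piece $S_{nd+\ell}$ (so $M^{(0)}=B$). Twists are defined by $N(a)_n=N_{a+n}$. Let $\mathfrak m$ be the homogeneous maximal ideal of $B$. A finite length $B$-module $M$ has a pure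 resolution of type (degree sequence) $(d_0,d_1,d_2;\ell)$ if there is an exact sequence of graded $B$-modules with degree-zero maps $$0\to E_2\to F_1\to F_0\to M\to 0$$ which is minimal (the image of $F_1$ lies in $\mathfrak m F_0$ and the image of $E_2$ lies in $\mathfrak m F_1$), where $F_0$ and $F_1$ are free, $F_i$ is generated in the single degree $d_i$ for $i=0,1$, and $E_2= M^{(\ell)}(-d_2)^{\oplus r}$ for some integer $r$. In speaking of the ray spanned by the Betti table of such an $M$, we take $M\neq 0$. *)

(* Defs.v *)
From HB Require Import structures.
From mathcomp Require Import all_boot all_order all_algebra.
From mathcomp Require Import mpoly.

Set Implicit Arguments.
Unset Strict Implicit.
Unset Printing Implicit Defensive.

Import Order.TTheory GRing.Theory Num.Theory.
Local Open Scope ring_scope.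

(* Polynomials in S = k[x,y] all of whose monomials have degree n * d + l for
   some n >= 0, that is, the subset \bigoplus_(n >= 0) S_(n d + l) of S. *)
Definition vdeg_pred (k : fieldType) (d l : nat) : {pred {mpoly k[2]}} :=
  fun p => all (fun m : 'X_{1..2} => (l <= mdeg m) && (d %| mdeg m - l))%N
               (msupp p).
Arguments vdeg_pred : clear implicits, simpl never.

Section Veronese.
Variables (k : fieldType) (d : nat).

Lemma vdegP l (p : {mpoly k[2]}) :
  reflect (forall m, m \in msupp p -> (l <= mdeg m)%N && (d %| mdeg m - l)%N)
          (p \in vdeg_pred k d l).
Proof. exact: allP. Qed.

Fact vdeg_zmod l : zmod_closed (vdeg_pred k d l).
Proof.
split; first by apply/vdegP => m; rewrite msupp0.
move=> p q /vdegP hp /vdegP hq; apply/vdegP => m /msuppB_le.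
by rewrite mem_cat => /orP[/hp|/hq].
Qed.

HB.instance Definition _ l :=
  GRing.isZmodClosed.Build {mpoly k[2]} (vdeg_pred k d l) (vdeg_zmod l).

Fact vdegM l (p q : {mpoly k[2]}) :
  p \in vdeg_pred k d 0 -> q \in vdeg_pred k d l -> p * q \in vdeg_pred k d l.
Proof.
move=> /vdegP hp /vdegP hq; apply/vdegP => m /msuppM_le /allpairsP.
case=> -[m1 m2] /= [/hp hm1 /hq /andP[lm2 dm2] ->].
move: hm1; rewrite leq0n subn0 /= => dm1.
rewrite mdegD (leq_trans lm2 (leq_addl _ _)) /= -addnBA //.
exact: dvdn_add.
Qed.

(* The coordinate ring B of the rational normal curve of degree d. *)
Record vring := VRing { vrval :> {mpoly k[2]}; _ : vrval \in vdeg_pred k d 0 }.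

HB.instance Definition _ := [isSub for vrval].
HB.instance Definition _ := [Choice of vring by <:].

Fact vdeg_subring : subring_closed (vdeg_pred k d 0).
Proof.
split=> [|p q hp hq|p q hp hq]; last exact: vdegM.
  by apply/vdegP => m; rewrite msupp1 inE => /eqP->; rewrite mdeg0 subn0 dvdn0.
exact: (vdeg_zmod 0).2.
Qed.

HB.instance Definition _ :=
  GRing.SubChoice_isSubComNzRing.Build {mpoly k[2]} (vdeg_pred k d 0) vring
    vdeg_subring.

(* The B-module M^(l) = \bigoplus_(n >= 0) S_(n d + l). *)
Record vmod (l : nat) :=
  VMod { vmval :> {mpoly k[2]}; _ : vmval \in vdeg_pred k d l }.

HB.instance Definition _ l := [isSub for @vmval l].
HB.instance Definition _ l := [Choice of vmod l by <:].
HB.instance Definition _ l := [SubChoice_isSubZmodule of vmod l by <:].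

Definition vmod_scale l (b : vring) (x : vmod l) : vmod l :=
  VMod (vdegM (valP b) (valP x)).

Fact vmod_scaleA l (a b : vring) (x : vmod l) :
  vmod_scale a (vmod_scale b x) = vmod_scale (a * b) x.
Proof. by apply: val_inj; rewrite /= mulrA. Qed.
Fact vmod_scale1 l : left_id 1 (@vmod_scale l).
Proof. by move=> x; apply: val_inj; rewrite /= mul1r. Qed.
Fact vmod_scaleDr l : right_distributive (@vmod_scale l) +%R.
Proof. by move=> a x y; apply: val_inj; rewrite /= mulrDr. Qed.
Fact vmod_scaleDl l (x : vmod l) :
  {morph (@vmod_scale l)^~ x : a b / a + b}.
Proof. by move=> a b; apply: val_inj; rewrite /= mulrDl. Qed.

HB.instance Definition _ l :=
  GRing.Zmodule_isLmodule.Build vring (vmod l)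
    (@vmod_scaleA l) (@vmod_scale1 l) (@vmod_scaleDr l) (@vmod_scaleDl l).

(* p lies in degree j of \bigoplus_(n >= 0) S_(n d + l); this forces p = 0 when
   j < 0. *)
Definition vhomog (l : nat) (j : int) (p : {mpoly k[2]}) : bool :=
  match j with
  | Posz n => p \is (n * d + l).-homog
  | Negz _ => p == 0
  end.

Lemma vhomog0 l j : vhomog l j 0.
Proof. by case: j => n /=; rewrite ?dhomog0. Qed.

Lemma vhomogB l j p q : vhomog l j p -> vhomog l j q -> vhomog l j (p - q).
Proof.
case: j => n /=; last by move=> /eqP-> /eqP->; rewrite subr0.
by move=> hp hq; rewrite rpredB.
Qed.

Lemma vhomogM l i j p q :
  vhomog 0 i p -> vhomog l j q -> vhomog l (i + j) (p * q).
Proof.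
case: i => i /=; last by move=> /eqP-> _; rewrite mul0r vhomog0.
case: j => j /=; last by move=> _ /eqP->; rewrite mulr0 vhomog0.
by move=> hp hq; rewrite mulnDl -addnA -[(i * d)%N]addn0; apply: dhomogM.
Qed.

Lemma vhomog_vdeg l n p : vhomog l (Posz n) p -> p \in vdeg_pred k d l.
Proof.
move=> /dhomogP hp; apply/vdegP => m /hp ->.
by rewrite leq_addl addnK dvdn_mull.
Qed.

Lemma vhomog_proj l j n p : (0 < d)%N -> vhomog l j p ->
  pihomog mdeg (n * d + l)%N p = if j == n%:Z then p else 0.
Proof.
move=> d_gt0; case: j => m /= hp; last by rewrite (eqP hp) raddf0.
case: eqP => [[<-]|mn]; first exact: pihomog_dE.
apply: (pihomog_ne0 _ hp); rewrite eqn_add2r eqn_pmul2r //.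
by apply/eqP => mn'; apply: mn; rewrite mn'.
Qed.

(* Shared by the gradings of B and of M^(l), which are both embedded in S. *)
Section Embedded.
Variables (l : nat) (N : zmodType) (v : {additive N -> {mpoly k[2]}}).
Variable lift : {mpoly k[2]} -> N.
Hypotheses (d_gt0 : (0 < d)%N) (v_inj : injective v).
Hypothesis v_vdeg : forall x, v x \in vdeg_pred k d l.
Hypothesis liftK : forall p, p \in vdeg_pred k d l -> v (lift p) = p.

Lemma embedded_span x : exists s : seq (int * N),
  (forall t, t \in s -> vhomog l t.1 (v t.2)) /\ x = \sum_(t <- s) t.2.
Proof.
pose term (m : 'X_{1..2}) : {mpoly k[2]} := (v x)@_m *: 'X_[m].
have hterm m : m \in msupp (v x) ->
    vhomog l (Posz ((mdeg m - l) %/ d)%N) (term m).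
  move=> /(vdegP _ _ (v_vdeg x)) /andP[lm dm] /=.
  by rewrite divnK // subnK // rpredZ // dhomogX.
exists [seq (Posz ((mdeg m - l) %/ d)%N, lift (term m)) | m <- msupp (v x)].
split=> [t /mapP[m /hterm hm ->]|].
  by rewrite liftK //; apply: vhomog_vdeg hm.
apply: v_inj; rewrite raddf_sum big_map [LHS]mpolyE.
apply: eq_big_seq => m /hterm hm /=.
by rewrite liftK //; apply: vhomog_vdeg hm.
Qed.

Lemma embedded_direct (s : seq int) (c : int -> N) : uniq s ->
  (forall j, vhomog l j (v (c j))) -> \sum_(j <- s) c j = 0 ->
  forall j, j \in s -> c j = 0.
Proof.
move=> s_uniq hc sum0 j js; apply: v_inj; rewrite raddf0.
case: j js => n ns; last exact/eqP/(hc (Negz n)).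
have /(congr1 (pihomog mdeg (n * d + l)%N \o v)) := sum0.
rewrite /= !raddf0 !raddf_sum (bigD1_seq _ ns) //= big1 => [|j jn].
  by rewrite (vhomog_proj _ d_gt0 (hc _)) eqxx addr0.
by rewrite (vhomog_proj _ d_gt0 (hc _)) (negPf jn).
Qed.
End Embedded.

(* A graded B-module: a B-module M together with the subgroups M_j (j : int) of
   homogeneous elements of degree j, such that B_i M_j \subset M_(i + j) and M
   is the direct sum of the M_j.  As k = B_0, the M_j are k-subspaces. *)
Record gmod := GMod {
  gcar :> lmodType vring;
  ghomog : int -> gcar -> Prop;
  ghomog0 : forall j, ghomog j 0;
  ghomogB : forall j x y, ghomog j x -> ghomog j y -> ghomog j (x - y);
  ghomogZ : forall i j (b : vring) x,
    vhomog 0 i (val b) -> ghomog j x -> ghomog (i + j) (b *: x);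
  ghomog_span : forall x, exists s : seq (int * gcar),
    (forall t, t \in s -> ghomog t.1 t.2) /\ x = \sum_(t <- s) t.2;
  ghomog_direct : forall (s : seq int) (c : int -> gcar), uniq s ->
    (forall j, ghomog j (c j)) -> \sum_(j <- s) c j = 0 ->
    forall j, j \in s -> c j = 0
}.

Section Constructions.
Hypothesis d_gt0 : (0 < d)%N.

Definition gring : gmod.
Proof.
apply: (@GMod (vring^o) (fun j x => vhomog 0 j (val (x : vring)))).
- by move=> j; apply: vhomog0.
- by move=> j x y; apply: vhomogB.
- by move=> i j b x; apply: vhomogM.
- by apply: (@embedded_span 0 vring val (insubd 0)) => //;
    [apply: val_inj | apply: valP | move=> p hp; exact: insubdK].
- by apply: (@embedded_direct 0 vring val) => //; apply: val_inj.
Defined.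

Definition gver (l : nat) : gmod.
Proof.
apply: (@GMod (vmod l) (fun j x => vhomog l j (val x))).
- by move=> j; apply: vhomog0.
- by move=> j x y; apply: vhomogB.
- by move=> i j b x; apply: vhomogM.
- by apply: (@embedded_span l (vmod l) val (insubd 0)) => //;
    [apply: val_inj | apply: valP | move=> p hp; exact: insubdK].
- by apply: (@embedded_direct l (vmod l) val) => //; apply: val_inj.
Defined.

(* \bigoplus_p N(a p), where N(e)_j = N_(e + j). *)
Definition gsum (N : gmod) (n : nat) (a : 'I_n -> int) : gmod.
Proof.
apply: (@GMod {ffun 'I_n -> N} (fun j v => forall p, ghomog (a p + j) (v p))).
- by move=> j p; rewrite ffunE; apply: ghomog0.
- by move=> j x y hx hy p; rewrite !ffunE; apply: ghomogB.
- by move=> i j b x hb hx p; rewrite ffunE addrCA; apply: ghomogZ.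
- move=> x; pose e p (y : N) : {ffun 'I_n -> N} :=
    [ffun q => if q == p then y else 0].
  have x_sum : x = \sum_(p <- enum 'I_n) e p (x p).
    apply/ffunP => q; rewrite sum_ffunE big_enum /= (bigD1 q) //= big1.
      by rewrite ffunE eqxx addr0.
    by move=> p pq; rewrite ffunE eq_sym (negPf pq).
  rewrite {}x_sum; elim: (enum _) => [|p r [s [hs sE]]].
    by exists [::]; split=> //; rewrite !big_nil.
  have [t [ht tE]] := ghomog_span (x p).
  exists ([seq (u.1 - a p, e p u.2) | u <- t] ++ s); split=> [u|].
    rewrite mem_cat => /orP[/mapP[w wt -> q]|]; last exact: hs.
    rewrite ffunE; case: eqP => [->|_]; last exact: ghomog0.
    by rewrite addrC subrK; apply: ht.
  rewrite big_cons sE big_cat big_map /=; congr (_ + _).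
  apply/ffunP => q; rewrite sum_ffunE ffunE tE.
  under [RHS]eq_bigr do rewrite ffunE.
  by case: eqP => // _; rewrite big1_eq.
- move=> s c s_uniq hc sum0 j js; apply/ffunP => p; rewrite ffunE.
  have inj_a : injective (fun i => a p + i) by apply: addrI.
  have := @ghomog_direct N [seq a p + i | i <- s] (fun i => c (i - a p) p).
  rewrite map_inj_uniq // => /(_ s_uniq) H.
  have {}H := H _ _ (a p + j) (map_f _ js).
  rewrite /= addrAC subrr add0r in H; apply: H => [i|].
    by have := hc (i - a p) p; rewrite addrC subrK.
  have /ffunP/(_ p) := sum0; rewrite sum_ffunE [RHS]ffunE => sum0p.
  rewrite big_map -[RHS]sum0p; apply: eq_bigr => i _.
  by rewrite addrAC subrr add0r.
Defined.

(* The graded free module with basis elements in degrees a p. *)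
Definition gfree (n : nat) (a : 'I_n -> int) : gmod :=
  gsum gring (fun p => - a p).

Definition gbasis (n : nat) (a : 'I_n -> int) (p : 'I_n) : gfree a :=
  [ffun q => (p == q)%:R : vring^o].
End Constructions.

Definition degree0 (M N : gmod) (f : M -> N) : Prop :=
  forall j x, ghomog j x -> ghomog j (f x).

Definition surjective_map (M N : gmod) (f : M -> N) : Prop :=
  forall y, exists x, f x = y.

(* Exactness of L --g--> M --f--> N at M. *)
Definition exact_at (L M N : gmod) (g : L -> M) (f : M -> N) : Prop :=
  forall x, f x = 0 <-> exists y, g y = x.

Definition fin_gen (M : gmod) : Prop :=
  exists (n : nat) (x : 'I_n -> M),
    forall y, exists b : 'I_n -> vring, y = \sum_(i < n) b i *: x i.

Definition nonzero_module (M : gmod) : Prop := exists x : M, x <> 0.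

Definition is_submodule (M : gmod) (U : M -> Prop) : Prop :=
  [/\ U 0, forall x y, U x -> U y -> U (x + y)
    & forall (b : vring) x, U x -> U (b *: x)].

Definition strict_sub (M : gmod) (U V : M -> Prop) : Prop :=
  (forall x, U x -> V x) /\ exists x, V x /\ ~ U x.

(* The lengths of the chains of submodules of M are bounded. *)
Definition finite_length (M : gmod) : Prop :=
  exists n : nat, forall U : nat -> M -> Prop,
    (forall i, is_submodule (U i)) ->
    ~ (forall i, (i <= n)%N -> strict_sub (U i) (U i.+1)).

Definition in_max_ideal (b : vring) : Prop := (val b)@_(0%MM) = 0.

Definition in_max_ideal_mul (M : gmod) (x : M) : Prop :=
  exists (n : nat) (b : 'I_n -> vring) (y : 'I_n -> M),
    (forall i, in_max_ideal (b i)) /\ x = \sum_(i < n) b i *: y i.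

Definition minimal_map (M N : gmod) (f : M -> N) : Prop :=
  forall x, in_max_ideal_mul (f x).

Section Betti.
Hypothesis d_gt0 : (0 < d)%N.

(* A graded free resolution of M by free modules of finite rank. *)
Record free_res (M : gmod) := FreeRes {
  fr_rank : nat -> nat;
  fr_deg : forall i, 'I_(fr_rank i) -> int;
  fr_diff : forall i,
    {linear gfree d_gt0 (fr_deg (i := i.+1)) -> gfree d_gt0 (fr_deg (i := i))};
  fr_aug : {linear gfree d_gt0 (fr_deg (i := 0)) -> M};
  fr_diff_degree0 : forall i, degree0 (fr_diff i);
  fr_aug_degree0 : degree0 fr_aug;
  fr_aug_surj : surjective_map fr_aug;
  fr_exact0 : exact_at (fr_diff 0) fr_aug;
  fr_exact : forall i, exact_at (fr_diff i.+1) (fr_diff i)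
}.

(* Tor^B_i(k, M)_j is the homology in degree j of k (x)_B F, for a graded free
   resolution F of M.  Here k (x)_B F_i = F_i / m F_i = k^(rank F_i) is the space
   of row vectors, and the differential is the matrix of constant terms. *)
Section Tor.
Variables (M : gmod) (F : free_res M).

Definition tor_diff (i : nat) : 'M[k]_(fr_rank F i.+1, fr_rank F i) :=
  \matrix_(p, q)
    (val ((fr_diff F i (gbasis d_gt0 _ p) : {ffun _ -> vring^o}) q : vring))
      @_(0%MM).

(* Its row space is the degree j part of k (x)_B F_i. *)
Definition tor_part (i : nat) (j : int) : 'M[k]_(fr_rank F i) :=
  diag_mx (\row_p (fr_deg (f := F) p == j)%:R).

Definition tor_cycles (i : nat) (j : int) : 'M[k]_(fr_rank F i) :=
  match i return 'M[k]_(fr_rank F i) with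
  | 0 => tor_part 0 j
  | i'.+1 => (tor_part i'.+1 j :&: kermx (tor_diff i'))%MS
  end.

Definition tor_boundaries (i : nat) (j : int) :
    'M[k]_(fr_rank F i.+1, fr_rank F i) :=
  tor_part i.+1 j *m tor_diff i.

(* No truncation: the boundaries are contained in the cycles. *)
Definition tor_dim (i : nat) (j : int) : nat :=
  (\rank (tor_cycles i j) - \rank (tor_boundaries i j))%N.
End Tor.
End Betti.
End Veronese.

(* The Betti tables live in the subspace of tables with finite rows
   (j |-> b i j). *)
Definition table := nat -> int -> rat.

Definition is_betti (k : fieldType) (d : nat) (d_gt0 : (0 < d)%N)
    (M : gmod k d) (b : table) : Prop :=
  exists F : free_res d_gt0 M, forall i j, b i j = (tor_dim F i j)%:R.

Definition cone_gen (X : table -> Prop) (t : table) : Prop :=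
  exists (n : nat) (c : 'I_n -> rat) (b : 'I_n -> table),
    [/\ forall s, 0 <= c s, forall s, X (b s)
      & forall i j, t i j = \sum_(s < n) c s * b s i j].

(* The cone generated by the Betti tables of the finitely generated graded
   B-modules with the property P. *)
Definition betti_cone (k : fieldType) (d : nat) (d_gt0 : (0 < d)%N)
    (P : gmod k d -> Prop) : table -> Prop :=
  cone_gen (fun b => exists M : gmod k d,
    [/\ fin_gen M, P M & is_betti d_gt0 M b]).

Definition ray (v t : table) : Prop :=
  exists c : rat, 0 <= c /\ forall i j, t i j = c * v i j.

Definition extremal_ray (C R : table -> Prop) : Prop :=
  [/\ exists v : table, [/\ C v, exists i j, v i j <> 0
        & forall t, R t <-> ray v t]
    & forall t u : table, C t -> C u ->
        R (fun i j => t i j + u i j) -> R t /\ R u].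

Definition has_pure_res (k : fieldType) (d : nat) (d_gt0 : (0 < d)%N)
    (M : gmod k d) (d0 d1 d2 : int) (l : nat) : Prop :=
  exists n0 n1 r : nat,
  let F0 := gfree k d_gt0 (fun _ : 'I_n0 => d0) in
  let F1 := gfree k d_gt0 (fun _ : 'I_n1 => d1) in
  let E2 := gsum (gver k d_gt0 l) (fun _ : 'I_r => - d2) in
  exists (f2 : {linear E2 -> F1}) (f1 : {linear F1 -> F0})
    (f0 : {linear F0 -> M}),
  [/\ [/\ degree0 f2, degree0 f1 & degree0 f0],
      [/\ injective f2, exact_at f2 f1, exact_at f1 f0 & surjective_map f0]
    & minimal_map f1 /\ minimal_map f2].

(* Main.v *)
Require Import Defs.
From HB Require Import structures.
From mathcomp Require Import all_boot all_order all_algebra.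
From mathcomp Require Import mpoly.
From mathcomp Require Import generic_quotient ring_quotient.
From mathcomp Require Import zify ring lra.
From Stdlib Require Import Classical ClassicalEpsilon.
Set Implicit Arguments.
Unset Strict Implicit.
Unset Printing Implicit Defensive.
Import Order.TTheory GRing.Theory Num.Theory.
Local Open Scope ring_scope.

(** Why the theorem holds.  Setting one of the two variables to 1 turns S_t into
    the polynomials of degree at most t in one variable z, hence a graded map
    between free B-modules into a matrix over k[z], and an element of degree j
    into a row vector whose entries have degrees bounded in terms of j * d.  The
    kernel of such a matrix has a basis adapted to these bounds, as in Forney's
    theory of minimal bases ([adapted_basis_exists]); a basis vector of degree
    e = j * d - l with 0 <= l < d spans a copy of M^(l)(-j).  So the second syzygy
    module of a graded B-module is a direct sum of twists of the M^(l)
    ([kernel_stage]).  The M^(l) have linear resolutions, obtained from the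
    relations z * z^i = z^(i+1) alone ([next_adapted]), and as Tor can be computed
    from any resolution ([tor_dim_unique]), the Betti table of M is determined by
    three finite families of integers, in degrees over S: a for the generators, b
    for the first syzygies, e for the summands of the second syzygy module
    ([presentation_tor]).

    For M of finite length the Hilbert functions cancel in large degrees, which
    gives two equations: the a and the e together are as many as the b, and have
    the same sum ([balance]).  Minimality of the presentation gives inequalities,
    by comparing ranks of blocks of the matrices over the fraction field of k[z]
    ([presentation_bound]).  Under these conditions a greedy procedure, which
    always uses the smallest remaining members of the three families, writes
    (a, b, e) as a positive combination of triples a < b < e with the weights
    e - b, e - a, b - a ([pure_decomposition]).  Such a triple carries the table
    of a pure resolution of type (d0, d1, d2; l); these tables are affine
    functions of l, so those with 0 < l < d - 1 are convex combinations of the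
    ones with l = 0 and l = d - 1 ([pure_tab_interpolation]).  Hence the Betti
    table of M lies in the cone of the pure tables ([betti_decomposition]).

    Conversely, the pure tables come from modules.  Euclid's algorithm on
    p = (d1 - d0) * d and q = d2 * d - l - d1 * d builds a (p + q) x q matrix of
    forms of degree p without syzygies of degree less than q
    ([pure_matrix_exists]).  Its cokernel has finite length, and counting degrees
    shows that all its second syzygies have degree exactly q
    ([pure_module_exists]).  So the cone of finite length modules is the cone of
    the pure tables ([betti_cone_pure]).

    Finally, a pure table is recognised, up to a factor, by the face of the cone
    it lies in: d0, d1, d2 are read off from the support, the entry (3, d2 + 1)
    vanishes for l = 0 only, and the linear form
    (d - 1) * t(2, d2) - t(3, d2 + 1) is nonnegative on the cone and among the
    tables of the given degrees vanishes for l = d - 1 only ([pure_summand]).  The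
    pure tables with l = 0 or l = d - 1 therefore span exactly the extremal
    rays. *)

(** * Splitting degree sequences into pure triples *)

Section Greedy.
Variables (na nb ne : nat).
Variables (a : 'I_na -> int) (b : 'I_nb -> int) (e : 'I_ne -> int).
Local Notation "x %:q" := (x%:~R : rat) (at level 2, format "x %:q").

(** What minimality gives about the parts of b up to c: these rows of the
    presentation matrix can only involve generators of degree less than c, and
    TI, TK index independent columns of two complementary blocks. *)
Definition initial_bound : Prop := forall c : int,
  exists (TI : {set 'I_na}) (TK : {set 'I_ne}),
  [/\ forall p, p \in TI -> a p < c,
      (#|TI| + #|TK| = #|[set q | (b q <= c)%R]|)%N,
      (#|[set s | (e s <= c + 1)%R]| <= #|TK|)%N
    & \sum_(p in TI) (a p)%:q + \sum_(s in TK) (e s)%:q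
        <= \sum_(q | (b q <= c)%R) (b q)%:q].

Hypothesis card_bal : (na + ne = nb)%N.
Hypothesis sum_bal : \sum_p (a p)%:q + \sum_s (e s)%:q = \sum_q (b q)%:q.
Hypothesis ib : initial_bound.

Lemma weight0 (x : rat) : 0 <= x <= 1 -> ~ 0 < x -> x = 0.
Proof. by case/andP=> x0 _ /negP; rewrite -leNgt => h; apply/eqP; rewrite eq_le h. Qed.

Lemma exists_min n (P : pred 'I_n) (f : 'I_n -> int) i : P i ->
  exists2 j, P j & forall j', P j' -> f j <= f j'.
Proof. by move=> Pi; case: (arg_minP f Pi) => j; exists j. Qed.

Lemma sum_setE (T : finType) (A : {set T}) (f : T -> rat) :
  \sum_(p in A) f p = \sum_p (p \in A)%:R * f p.
Proof.
rewrite [RHS](bigID (mem A)) /= [X in _ + X]big1 ?addr0 => [|p /negPf->].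
  by apply: eq_bigr => p ->; rewrite mul1r.
by rewrite mul0r.
Qed.

Lemma sum_predE (T : finType) (A : pred T) (f : T -> rat) :
  \sum_(p | A p) f p = \sum_p (A p)%:R * f p.
Proof.
rewrite [RHS](bigID A) /= [X in _ + X]big1 ?addr0 => [|p /negPf->].
  by apply: eq_bigr => p ->; rewrite mul1r.
by rewrite mul0r.
Qed.

Lemma card_sumE (T : finType) (A : {set T}) : (#|A|%:R : rat) = \sum_p (p \in A)%:R.
Proof.
rewrite -sum1_card natr_sum sum_setE; apply: eq_bigr => p _; exact: mulr1.
Qed.

Lemma sum_shift (T : finType) (w f : T -> rat) E :
  \sum_p w p * (f p - E) = \sum_p w p * f p - E * \sum_p w p.
Proof.
rewrite mulr_sumr -sumrB; apply: eq_bigr => p _.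
by rewrite mulrBr [E * _]mulrC.
Qed.

(** The terms of the used part, compared with an arbitrary subset c of the full
    family, if remaining members lie above and used members below the threshold. *)
Lemma used_term (w x : rat) (c : bool) : 0 <= w <= 1 -> (c -> 0 < w -> 0 <= x) ->
  (w < 1 -> x <= 0) -> (1 - w) * x <= c%:R * x.
Proof.
move=> /andP[w0 w1] h1 h2; case: c h1 => h1; last first.
  rewrite mul0r; have [/h2 x0|w1'] := ltrP w 1; first by rewrite mulr_ge0_le0 ?subr_ge0.
  by have -> : w = 1; [apply/eqP; rewrite eq_le w1|rewrite subrr mul0r].
rewrite mulrBl lerBlDr lerDl; move: w0; rewrite le_eqVlt => /orP[/eqP <-|w0].
  by rewrite mul0r.
by rewrite mulr_ge0 ?h1 // ltW.
Qed.

(** The state of the greedy procedure: al, be, ep are the parts of the weights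
    1, 1, 1 that are still to be used.  Members are used up in increasing order
    (rest_la, rest_lb, rest_le), and every touched a lies below every remaining
    e (rest_ae). *)
Record rest (al : 'I_na -> rat) (be : 'I_nb -> rat) (ep : 'I_ne -> rat) : Prop :=
 Rest {
  rest_a : forall p, 0 <= al p <= 1;
  rest_b : forall q, 0 <= be q <= 1;
  rest_e : forall s, 0 <= ep s <= 1;
  rest_mass : \sum_p al p + \sum_s ep s = \sum_q be q;
  rest_mean : \sum_p al p * (a p)%:q + \sum_s ep s * (e s)%:q
                = \sum_q be q * (b q)%:q;
  rest_la : forall p p', al p < 1 -> 0 < al p' -> a p <= a p';
  rest_lb : forall q q', be q < 1 -> 0 < be q' -> b q <= b q';
  rest_le : forall s s', ep s < 1 -> 0 < ep s' -> e s <= e s';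
  rest_ae : forall p s, al p < 1 -> 0 < ep s -> a p < e s
}.

Section Progress.
Variables (al : 'I_na -> rat) (be : 'I_nb -> rat) (ep : 'I_ne -> rat).
Hypothesis H : rest al be ep.

(** The used part is balanced as well, both in mass and in mean; shifting the
    degrees by E merges the two equations into one, with E free to choose. *)
Lemma used_shift (E : rat) :
  \sum_p (1 - al p) * ((a p)%:q - E) + \sum_s (1 - ep s) * ((e s)%:q - E)
    = \sum_q (1 - be q) * ((b q)%:q - E).
Proof.
rewrite !sum_shift.
under eq_bigr do rewrite mulrBl mul1r.
under [X in _ + (X - _) = _]eq_bigr do rewrite mulrBl mul1r.
under [X in _ = (X - _)]eq_bigr do rewrite mulrBl mul1r.
rewrite !sumrB !sumr_const !card_ord.
have := rest_mass H; have := rest_mean H.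
have : (na%:R + ne%:R = nb%:R :> rat) by rewrite -card_bal natrD.
move: sum_bal.
set x1 := \sum_p _; set x2 := \sum_s _; set x3 := \sum_q _.
set y1 := \sum_p _; set y2 := \sum_s _; set y3 := \sum_q _.
set z1 := \sum_p _; set z2 := \sum_s _; set z3 := \sum_q _.
rewrite -[1 *+ na]/(na%:R) -[1 *+ ne]/(ne%:R) -[1 *+ nb]/(nb%:R).
move=> h1 h2 h3 h4.
have -> : y1 = y3 - y2 by rewrite -h3 addrK.
have -> : z1 = z3 - z2 by rewrite -h4 addrK.
have -> : x1 = x3 - x2 by rewrite -h1 addrK.
rewrite -h2; ring.
Qed.

(** Mass and mean parts of the initial bound, merged by the same shift by E. *)
Lemma bound_shift (c : int) (E : rat) :
  exists (TI : {set 'I_na}) (TK : {set 'I_ne}),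
  [/\ forall p, p \in TI -> a p < c,
      (#|[set s | (e s <= c + 1)%R]| <= #|TK|)%N
    & \sum_p (p \in TI)%:R * ((a p)%:q - E) + \sum_s (s \in TK)%:R * ((e s)%:q - E)
        <= \sum_q (b q <= c)%R%:R * ((b q)%:q - E)].
Proof.
have [TI [TK [h1 h2 h3 h4]]] := ib c.
exists TI, TK; split=> //.
move: h4; rewrite !sum_setE sum_predE !sum_shift.
have := congr1 (fun n => n%:R : rat) h2; rewrite natrD !card_sumE => h2'.
have -> : \sum_q (b q <= c)%R%:R = \sum_q (q \in [set q | (b q <= c)%R])%:R :> rat.
  by apply: eq_bigr => q _; rewrite inE.
rewrite -h2' mulrDr.
lra.
Qed.

(** If every remaining a is at least the smallest remaining b, the used part
    violates the initial bound at c = b q: up to c, the used part of b is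
    strictly smaller than the full family, and with E between the used e and the
    remaining e (and above the used a) all deviations have the same sign. *)
Lemma no_low_b (q : 'I_nb) (E : rat) :
  0 < be q -> (forall q', 0 < be q' -> b q <= b q') ->
  (forall p, 0 < al p -> b q <= a p) ->
  (b q)%:q < E -> (forall p, al p < 1 -> (a p)%:q <= E) ->
  (forall s, ep s < 1 -> (e s)%:q <= E) ->
  (forall s, 0 < ep s -> E <= (e s)%:q) -> False.
Proof.
move=> q0 qmin qa qE aE eE1 eE2.
have [TI [TK [h1 _ h2]]] := bound_shift (b q) E.
have h3 : \sum_q' (b q' <= b q)%R%:R * ((b q')%:q - E)
    < \sum_q' (1 - be q') * ((b q')%:q - E).
  rewrite [ltLHS](bigD1 q) //= [ltRHS](bigD1 q) //= lexx.
  apply: ltr_leD.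
    rewrite ltr_nM2r; last by rewrite subr_lt0.
    by rewrite ltrBlDr ltrDl.
  apply: ler_sum => q' _; have /andP[bq0 bq1] := rest_b H q'.
  case: (ltrgtP (b q') (b q)) => hbq.
  - have /eqP -> : be q' == 0.
      rewrite eq_le bq0 andbT leNgt; apply/negP => /qmin.
      by rewrite leNgt hbq.
    by rewrite subr0.
  - have /eqP -> : be q' == 1.
      rewrite eq_le bq1 leNgt; apply/negP => /(rest_lb H)/(_ q0).
      by rewrite leNgt hbq.
    by rewrite subrr.
  - rewrite ler_nM2r; last by rewrite hbq subr_lt0.
    by rewrite lerBlDr lerDl.
have h4 := le_lt_trans h2 h3; rewrite -used_shift in h4.
have h5 : \sum_p (1 - al p) * ((a p)%:q - E) <= \sum_p (p \in TI)%:R * ((a p)%:q - E).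
  apply: ler_sum => p _; apply: used_term (rest_a H p) _ _ => [/h1 apq /qa|/aE].
    by rewrite leNgt apq.
  by rewrite subr_le0.
have h6 : \sum_s (1 - ep s) * ((e s)%:q - E) <= \sum_s (s \in TK)%:R * ((e s)%:q - E).
  apply: ler_sum => s _; apply: used_term (rest_e H s) _ _ => [_ /eE2|/eE1].
    by rewrite subr_ge0.
  by rewrite subr_le0.
have := lt_le_trans h4 (lerD h5 h6); by rewrite ltxx.
Qed.

(** If the smallest remaining e is at most every remaining b, the used part
    violates the initial bound at c = e s - 1; here E separates the used a from
    the remaining a, and the count of TK in the initial bound gives strictness. *)
Lemma no_low_e (s : 'I_ne) (E : rat) :
  0 < ep s -> (forall s', 0 < ep s' -> e s <= e s') ->
  (forall q, 0 < be q -> e s <= b q) ->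
  E < (e s)%:q -> (forall p, al p < 1 -> (a p)%:q <= E) ->
  (forall p, 0 < al p -> E <= (a p)%:q) -> False.
Proof.
move=> s0 smin qs Es aE1 aE2.
have [TI [TK [_ h1 h2]]] := bound_shift (e s - 1) E.
rewrite subrK in h1.
have h3 : \sum_q (b q <= e s - 1)%R%:R * ((b q)%:q - E)
    <= \sum_q (1 - be q) * ((b q)%:q - E).
  apply: ler_sum => q _; have /andP[bq0 bq1] := rest_b H q.
  case: (lerP (b q) (e s - 1)) => h.
    have hq : b q < e s by lia.
    have /eqP -> : be q == 0.
      rewrite eq_le bq0 andbT leNgt; apply/negP => /qs.
      by rewrite leNgt hq.
    by rewrite subr0.
  rewrite mul0r mulr_ge0 ?subr_ge0 //.
  apply: (le_trans (ltW Es)); rewrite ler_int; lia.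
have h4 := le_trans h2 h3; rewrite -used_shift in h4.
have h5 : \sum_p (1 - al p) * ((a p)%:q - E) <= \sum_p (p \in TI)%:R * ((a p)%:q - E).
  apply: ler_sum => p _; apply: used_term (rest_a H p) _ _ => [_ /aE2|/aE1].
    by rewrite subr_ge0.
  by rewrite subr_le0.
(* the split compares with e s instead of E, which costs (e s - E) times a
   difference of counts *)
have h6 : \sum_s' (1 - ep s') * ((e s')%:q - E) < \sum_s' (s' \in TK)%:R * ((e s')%:q - E).
  have split2 (w : 'I_ne -> rat) : \sum_s' w s' * ((e s')%:q - E) =
     \sum_s' w s' * ((e s')%:q - (e s)%:q) + ((e s)%:q - E) * \sum_s' w s'.
    by rewrite mulr_sumr -big_split /=; apply: eq_bigr => s' _; ring.
  rewrite !split2; apply: ler_ltD.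
    apply: ler_sum => s' _; apply: used_term (rest_e H s') _ _ => [_ /smin|/(rest_le H)/(_ s0)] h.
      by rewrite subr_ge0 ler_int.
    by rewrite subr_le0 ler_int.
  rewrite ltr_pM2l ?subr_gt0 // -card_sumE.
  apply: (@lt_le_trans _ _ (#|[set s0 | (e s0 <= e s)%R]|%:R)); last by rewrite ler_nat.
  rewrite card_sumE [ltLHS](bigD1 s) //= [ltRHS](bigD1 s) //= inE lexx.
  apply: ltr_leD; first by rewrite ltrBlDr ltrDl.
  apply: ler_sum => s' _; rewrite inE; have /andP[ap0 ap1] := rest_e H s'.
  case: (lerP (e s') (e s)) => h; first by rewrite lerBlDr lerDl.
  rewrite subr_le0 leNgt; apply/negP => /(rest_le H)/(_ s0).
  by rewrite leNgt h.
have := lt_le_trans (ler_ltD h5 h6) h4; by rewrite ltxx.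
Qed.

Lemma sum_tail (N n : nat) : (n <= N)%N ->
  (\sum_(i < N) (n <= i)%N%:R : rat) = N%:R - n%:R.
Proof.
elim: N n => [|N IH] [|n] // nN; rewrite ?big_ord0 ?subrr //.
  rewrite subr0; under eq_bigr do rewrite leq0n.
  by rewrite sumr_const card_ord.
rewrite big_ord_recl /= add0r.
under eq_bigr do rewrite /bump add1n ltnS.
by rewrite IH // -!natr1; ring.
Qed.

(** If e is exhausted, the remaining a and b have equal mass and equal mean,
    whereas the count in the initial bound makes the remaining a lie to the left
    of the remaining b; summing the distribution functions over all thresholds
    turns this into a contradiction with equality of the means. *)
Lemma no_early_end (p : 'I_na) (q : 'I_nb) :
  (forall s, ep s = 0) -> 0 < be q -> (forall q', 0 < be q' -> b q <= b q') ->
  0 < al p -> a p < b q -> False.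
Proof.
move=> e0 q0 qmin p0 pq.
have count c : b q <= c ->
    \sum_q' (b q' <= c)%R%:R * be q' <= \sum_p' (a p' < c)%R%:R * al p'.
  move=> qc; have [TI [TK [h1 h2 h3 _]]] := ib c.
  have hb : \sum_q' (b q' <= c)%R%:R * be q' =
      #|[set q' | (b q' <= c)%R]|%:R - \sum_q' (1 - be q').
    rewrite card_sumE -sumrB; apply: eq_bigr => q' _; rewrite inE.
    case: lerP => h; first by rewrite mul1r opprB addrCA subrr addr0.
    have /andP[ap0 ap1] := rest_b H q'.
    rewrite (_ : be q' = 1) ?mul0r ?subrr //.
    apply/eqP; rewrite eq_le ap1 leNgt; apply/negP => /(rest_lb H)/(_ q0); lia.
  have ha : \sum_p' (a p' < c)%R%:R * al p' =
      #|[set p' | (a p' < c)%R]|%:R - \sum_p' (1 - al p').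
    rewrite card_sumE -sumrB; apply: eq_bigr => p' _; rewrite inE.
    case: ltrP => h; first by rewrite mul1r opprB addrCA subrr addr0.
    have /andP[ap0 ap1] := rest_a H p'.
    rewrite (_ : al p' = 1) ?mul0r ?subrr //.
    apply/eqP; rewrite eq_le ap1 leNgt; apply/negP => /(rest_la H)/(_ p0); lia.
  rewrite ha hb -h2 natrD !sumrB !sumr_const !card_ord -(rest_mass H) -card_bal.
  rewrite [\sum_s ep s]big1 // addr0 mulrnDr.
  have : (#|TK|%:R <= ne%:R :> rat) by rewrite ler_nat -[X in (_ <= X)%N]card_ord max_card.
  have : (#|TI|%:R <= #|[set p' | (a p' < c)%R]|%:R :> rat).
    by rewrite ler_nat subset_leq_card //; apply/subsetP => x /h1; rewrite inE.
  lra.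
(* L bounds all degrees from below, L + N from above *)
pose N0 := (\sum_p' `|a p'| + \sum_q' `|b q'|)%N.
have bnda p' : (`|a p'| <= N0)%N.
  by rewrite /N0 (bigD1 p') //= -!addnA leq_addr.
have bndb q' : (`|b q'| <= N0)%N.
  by rewrite /N0 addnC (bigD1 q') //= -!addnA leq_addr.
pose L : int := - N0%:Z; pose N := (N0 + N0)%N.
have conv (x : int) : (`|x| <= N0)%N ->
    x%:q = (L + N%:Z)%:q - \sum_(i < N) (x <= L + i%:Z)%R%:R.
  move=> xN; have hx : x = L + `|x - L|%N%:Z by rewrite /L; lia.
  have hn : (`|x - L| <= N)%N by rewrite /N /L; lia.
  under eq_bigr => i _.
    have -> : (x <= L + i%:Z) = (`|x - L| <= i)%N by rewrite /L; lia.
    over.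
  rewrite sum_tail // {1}hx !intrD; ring.
have mean := rest_mean H; rewrite [X in _ + X = _]big1 ?addr0 in mean; last first.
  by move=> s _; rewrite e0 mul0r.
have mass := rest_mass H; rewrite [X in _ + X = _]big1 ?addr0 in mass; last first.
  by move=> s _; rewrite e0.
move: mean.
under eq_bigr => p' _ do rewrite (conv (a p')) ?bnda // mulrBr mulr_sumr.
under [RHS]eq_bigr => q' _ do rewrite (conv (b q')) ?bndb // mulrBr mulr_sumr.
rewrite !sumrB -!mulr_suml mass => /addrI/oppr_inj.
rewrite exchange_big [RHS]exchange_big /= => /eqP; rewrite eq_sym -subr_eq0 -sumrB => /eqP.
apply/eqP; rewrite lt_eqF //.
have hn : (`|a p - L| < N)%N by have := bndb q; have := bnda p; rewrite /N /L; lia.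
have hL : L + `|a p - L|%:Z = a p by have := bnda p; rewrite /L; lia.
have term (c : int) : \sum_q' be q' * (b q' <= c)%R%:R <= \sum_p' al p' * (a p' <= c)%R%:R.
  case: (lerP (b q) c) => h.
    have := count _ h; under eq_bigr do rewrite mulrC.
    move/le_trans; apply; apply: ler_sum => p' _.
    have /andP[ap0 ap1] := rest_a H p'.
    rewrite mulrC ler_wpM2l // ler_nat.
    by case: ltrP => // /ltW ->.
  rewrite big1 => [|q' _].
    apply: sumr_ge0 => p' _; have /andP[ap0 ap1] := rest_a H p'.
    by rewrite mulr_ge0 // ler0n.
  case: lerP => h'; last by rewrite mulr0.
  have /andP[ap0 ap1] := rest_b H q'.
  rewrite (_ : be q' = 0) ?mul0r //; apply/eqP; rewrite eq_le ap0 andbT leNgt.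
  by apply/negP => /qmin; lia.
rewrite (bigD1 (Ordinal hn)) //= hL.
rewrite -[ltRHS]addr0; apply: ltr_leD; last first.
  by apply: sumr_le0 => i _; rewrite subr_le0 term.
rewrite subr_lt0 [ltLHS]big1 => [|q' _].
  rewrite (bigD1 p) //= lexx mulr1 ltr_pwDl // sumr_ge0 // => p' _.
  have /andP[ap0 ap1] := rest_a H p'.
  by rewrite mulr_ge0 // ler0n.
case: lerP => h'; last by rewrite mulr0.
have /andP[ap0 ap1] := rest_b H q'.
rewrite (_ : be q' = 0) ?mul0r //; apply/eqP; rewrite eq_le ap0 andbT leNgt.
by apply/negP => /qmin; lia.
Qed.

(** The smallest remaining members always form a triple a < b < e; the three
    ways in which this could fail are the three preceding lemmas. *)
Lemma progress (q0 : 'I_nb) : 0 < be q0 -> exists p q s,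
  [/\ [/\ 0 < al p, 0 < be q & 0 < ep s], a p < b q, b q < e s,
      (forall p', 0 < al p' -> a p <= a p') &
      (forall q', 0 < be q' -> b q <= b q') /\
      (forall s', 0 < ep s' -> e s <= e s')].
Proof.
move=> /(exists_min (P := fun q => 0 < be q) b) [q {}q0 qmin].
have aub : exists E : rat, [/\ (b q)%:q < E, forall p, (a p)%:q <= E & forall s, (e s)%:q <= E].
  exists (\sum_p `|(a p)%:q| + \sum_s `|(e s)%:q| + `|(b q)%:q| + 1).
  have pa : 0 <= \sum_p `|(a p)%:q| by apply: sumr_ge0.
  have pe : 0 <= \sum_s `|(e s)%:q| by apply: sumr_ge0.
  split=> [|p|s].
  - have := ler_norm (b q)%:q; lra.
  - have := ler_norm (a p)%:q; move: pa; rewrite (bigD1 p) //=.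
    have : 0 <= \sum_(i < na | i != p) `|(a i)%:q| by apply: sumr_ge0.
    have := normr_ge0 (b q)%:q; lra.
  - have := ler_norm (e s)%:q; move: pe; rewrite (bigD1 s) //=.
    have : 0 <= \sum_(i < ne | i != s) `|(e i)%:q| by apply: sumr_ge0.
    have := normr_ge0 (b q)%:q; lra.
(* aub serves the last case, without remaining e, where any large E will do *)
case: (pickP (fun s => 0 < ep s)) => [s1 s1P | noe].
  have [s s0 smin] := exists_min (P := fun s => 0 < ep s) e s1P.
  case: (lerP (e s) (b q)) => [esq|qes].
    exfalso; case: (pickP (fun p => al p < 1)) => [p1 p1P|noa].
      have [p /= pl pmax] := exists_min (P := fun p => al p < 1) (fun p => - a p) p1P.
      apply: (@no_low_e s (a p)%:q) => //.
      - by move=> q' /qmin; apply: le_trans.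
      - by rewrite ltr_int (rest_ae H).
      - by move=> p' h; rewrite ler_int -lerN2 pmax.
      - by move=> p' h; rewrite ler_int (rest_la H).
    have [E [_ E1 E2]] : exists E, [/\ True, E < (e s)%:q & forall p, E <= (a p)%:q].
      exists ((e s)%:q - 1 - \sum_p `|(a p)%:q| - `|(e s)%:q|).
      have pa : 0 <= \sum_p `|(a p)%:q| by apply: sumr_ge0.
      split=> // [|p]; first by have := normr_ge0 (e s)%:q; lra.
      have := ler_norm (- (a p)%:q); rewrite normrN; move: pa; rewrite (bigD1 p) //=.
      have : 0 <= \sum_(i < na | i != p) `|(a i)%:q| by apply: sumr_ge0.
      have := ler_norm (e s)%:q; lra.
    apply: (@no_low_e s E) => //.
    - by move=> q' /qmin; apply: le_trans.
    - by move=> p'; rewrite noa.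
  case: (pickP (fun p => (0 < al p) && (a p < b q))) => [p1 /andP[p10 p1q]|noa].
    have [p p0 pmin] := exists_min (P := fun p => 0 < al p) a p10.
    exists p, q, s; split=> //.
    by apply: le_lt_trans p1q; apply: pmin.
  exfalso; apply: (@no_low_b q (e s)%:q) => //.
  - by move=> p h; have := noa p; rewrite h /= ltNge => /negbFE.
  - by rewrite ltr_int.
  - by move=> p h; rewrite ler_int ltW // (rest_ae H).
  - by move=> s' h; rewrite ler_int (rest_le H).
  - by move=> s' h; rewrite ler_int smin.
have ep0 s : ep s = 0 by apply: weight0 (rest_e H s) _; rewrite noe.
exfalso; case: (pickP (fun p => (0 < al p) && (a p < b q))) => [p1 /andP[p10 p1q]|noa].
  exact: (@no_early_end p1 q).
have [E [E1 E2 E3]] := aub.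
apply: (@no_low_b q E) => //.
- by move=> p h; have := noa p; rewrite h /= ltNge => /negbFE.
- by move=> s'; rewrite ep0 ltxx.
Qed.

End Progress.

Definition triple := ('I_na * 'I_nb * 'I_ne)%type.
(** The weights e - b, e - a, b - a make a triple balanced in mass and in mean;
    they are the Herzog-Kuehl solution for the degrees a < b < e. *)
Definition pure_comb (w : triple -> rat) al be ep :=
  [/\ forall t, 0 <= w t,
      forall t, w t != 0 -> a t.1.1 < b t.1.2 < e t.2,
      forall p, al p = \sum_(t | t.1.1 == p) w t * (e t.2 - b t.1.2)%:q,
      forall q, be q = \sum_(t | t.1.2 == q) w t * (e t.2 - a t.1.1)%:q
    & forall s, ep s = \sum_(t | t.2 == s) w t * (b t.1.2 - a t.1.1)%:q].

Definition supp n (w : 'I_n -> rat) := #|[set p | 0 < w p]|.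

(** Subtract the largest possible multiple of the triple of smallest members.
    This exhausts one of them, so the total support decreases. *)
Lemma greedy n al be ep : (supp al + supp be + supp ep < n)%N -> rest al be ep ->
  exists w, pure_comb w al be ep.
Proof.
elim: n al be ep => // n IH al be ep hn H.
case: (pickP (fun q => 0 < be q)) => [q1 q1P|nob]; last first.
  have be0 q : be q = 0 by apply: weight0 (rest_b H q) _; rewrite nob.
  have := rest_mass H; rewrite [RHS]big1 // => /eqP.
  have pa : 0 <= \sum_p al p by apply: sumr_ge0 => p _; case/andP: (rest_a H p).
  have pe : 0 <= \sum_s ep s by apply: sumr_ge0 => p _; case/andP: (rest_e H p).
  rewrite paddr_eq0 // => /andP[].
  rewrite !psumr_eq0; [|by move=> p _; case/andP: (rest_e H p)|by move=> p _; case/andP: (rest_a H p)].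
  move=> /allP a0 /allP e0.
  exists (fun=> 0); split=> // [p|q|s].
  - by rewrite (eqP (implyP (a0 p (mem_index_enum _)) isT)) big1 // => t _; rewrite mul0r.
  - by rewrite be0 big1 // => t _; rewrite mul0r.
  - by rewrite (eqP (implyP (e0 s (mem_index_enum _)) isT)) big1 // => t _; rewrite mul0r.
have [p [q [s [[p0 q0 s0] pq qs pmin [qmin smin]]]]] := progress H q1P.
pose A := (e s - b q)%:q; pose B := (e s - a p)%:q; pose E := (b q - a p)%:q.
have A0 : 0 < A by rewrite ltr0z subr_gt0.
have B0 : 0 < B by rewrite ltr0z subr_gt0 (lt_trans pq).
have E0 : 0 < E by rewrite ltr0z subr_gt0.
have AE : B = A + E by rewrite /A /B /E -intrD; congr (_%:~R); lia.
(* the largest multiple of the triple (p, q, s) that can be subtracted *)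
pose th := Num.min (al p / A) (Num.min (be q / B) (ep s / E)).
have th0 : 0 < th by rewrite !lt_min !divr_gt0.
have thA : th * A <= al p by rewrite -ler_pdivlMr // ge_min lexx.
have thB : th * B <= be q by rewrite -ler_pdivlMr // !ge_min lexx orbT.
have thE : th * E <= ep s by rewrite -ler_pdivlMr // !ge_min lexx !orbT.
pose upd m (w : 'I_m -> rat) i c := fun j => w j - (j == i)%:R * c.
pose al' := upd _ al p (th * A); pose be' := upd _ be q (th * B); pose ep' := upd _ ep s (th * E).
have updle m (w : 'I_m -> rat) i c j : 0 < c -> upd m w i c j <= w j.
  by move=> c0; rewrite /upd lerBlDr lerDl mulr_ge0 // ?ler0n // ltW.
have upd01 m (w : 'I_m -> rat) i c : 0 < c -> c <= w i -> (forall j, 0 <= w j <= 1) ->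
    forall j, 0 <= upd m w i c j <= 1.
  move=> c0 cw w01 j; case/andP: (w01 j) => w0 w1.
  rewrite (le_trans (updle _ _ _ _ _ c0) w1) andbT /upd.
  by case: eqP => [->|_]; rewrite ?mul1r ?mul0r ?subr0 // subr_ge0.
have updpos m (w : 'I_m -> rat) i c j : 0 < c -> 0 < upd m w i c j -> 0 < w j.
  by move=> c0 h; apply: lt_le_trans h _; apply: updle.
have updlt m (w : 'I_m -> rat) i c j : upd m w i c j < 1 -> (w j < 1) \/ j = i.
  by rewrite /upd; case: eqP => [->|_]; [right|left; move: H0; rewrite mul0r subr0].
have updsum m (w f : 'I_m -> rat) i c : \sum_j upd m w i c j * f j = \sum_j w j * f j - c * f i.
  under eq_bigr do rewrite /upd mulrBl.
  rewrite sumrB; congr (_ - _).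
  by rewrite (bigD1 i) //= eqxx mul1r big1 ?addr0 // => j /negPf->; rewrite !mul0r.
have updsum1 m (w : 'I_m -> rat) i c : \sum_j upd m w i c j = \sum_j w j - c.
  have := updsum m w (fun=> 1) i c; rewrite mulr1.
  by under eq_bigr do rewrite mulr1; under [in RHS]eq_bigr do rewrite mulr1.
have cA : 0 < th * A by rewrite mulr_gt0.
have cB : 0 < th * B by rewrite mulr_gt0.
have cE : 0 < th * E by rewrite mulr_gt0.
have H' : rest al' be' ep'.
  split.
  - exact: upd01 (rest_a H).
  - exact: upd01 (rest_b H).
  - exact: upd01 (rest_e H).
  - rewrite !updsum1 AE -(rest_mass H); ring.
  - rewrite !updsum -(rest_mean H) AE /A /E !intrD !mulrNz; ring.
  - move=> i j /updlt [h1|->] h2; [apply: (rest_la H) => // |apply: pmin]; exact: updpos h2.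
  - move=> i j /updlt [h1|->] h2; [apply: (rest_lb H) => // |apply: qmin]; exact: updpos h2.
  - move=> i j /updlt [h1|->] h2; [apply: (rest_le H) => // |apply: smin]; exact: updpos h2.
  - move=> i j /updlt [h1|->] h2; first by apply: (rest_ae H) => //; exact: updpos h2.
    by apply: lt_le_trans (lt_trans pq qs) _; apply: smin; exact: updpos h2.
have suppsub m (w : 'I_m -> rat) i c : 0 < c -> (supp (upd m w i c) <= supp w)%N.
  by move=> c0; apply: subset_leq_card; apply/subsetP => j; rewrite !inE; apply: updpos.
have supplt m (w : 'I_m -> rat) i c : 0 < c -> c = w i -> (supp (upd m w i c) < supp w)%N.
  move=> c0 cw; apply: proper_card; apply/properP; split.
    by apply/subsetP => j; rewrite !inE; apply: updpos.
  by exists i; rewrite !inE -?cw // /upd eqxx mul1r cw subrr ltxx.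
have hlt : (supp al' + supp be' + supp ep' < supp al + supp be + supp ep)%N.
  have hA := suppsub _ al p _ cA; have hB := suppsub _ be q _ cB; have hE := suppsub _ ep s _ cE.
  have : [\/ th * A = al p, th * B = be q | th * E = ep s].
    rewrite /th; case: leP => _; first by constructor 1; rewrite divfK // gt_eqF.
    by case: leP => _; [constructor 2|constructor 3]; rewrite divfK // gt_eqF.
  case=> h.
  - by rewrite -!addnA; exact: leq_add (supplt _ al p _ cA h) (leq_add hB hE).
  - by rewrite -!addnA -addnS; exact: leq_add hA (leq_add (supplt _ be q _ cB h) hE).
  - by rewrite -addnS; exact: leq_add (leq_add hA hB) (supplt _ ep s _ cE h).
have [w [w0 wlt wa wb we]] := IH _ _ _ (leq_trans hlt hn) H'.
have wsum m (pr : triple -> 'I_m) (f : triple -> rat) i :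
    \sum_(t | pr t == i) (w t + (t == (p, q, s))%:R * th) * f t
    = \sum_(t | pr t == i) w t * f t + (i == pr (p, q, s))%:R * (th * f (p, q, s)).
  under eq_bigr do rewrite mulrDl; rewrite big_split; congr (_ + _).
  case: eqP => [->|ip].
    rewrite (bigD1 (p, q, s)) //= eqxx big1 ?addr0 ?mul1r // => t /andP[_ /negPf->].
    by rewrite !mul0r.
  rewrite mul0r big1 // => t /eqP ti; case: eqP => [tE|_]; last by rewrite !mul0r.
  by case: ip; rewrite -ti tE.
exists (fun t => w t + (t == (p, q, s))%:R * th); split.
- by move=> t; rewrite addr_ge0 // mulr_ge0 ?ler0n // ltW.
- move=> t; case: (t =P (p, q, s)) => [->|_]; first by rewrite /= pq qs.
  by rewrite mul0r addr0; apply: wlt.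
- by move=> i; rewrite wsum -wa /al' /upd -/A subrK.
- by move=> i; rewrite wsum -wb /be' /upd -/B subrK.
- by move=> i; rewrite wsum -we /ep' /upd -/E subrK.
Qed.

(** Nothing is used at the start, so all conditions on used members are void. *)
Theorem pure_decomposition :
  exists w, pure_comb w (fun=> 1) (fun=> 1) (fun=> 1).
Proof.
apply: (greedy (ltnSn _)); split.
1-3: by move=> i; rewrite ler01 lexx.
- by rewrite !sumr_const !card_ord -card_bal natrD.
- under eq_bigr do rewrite mul1r; under [X in _ + X]eq_bigr do rewrite mul1r.
  by under [RHS]eq_bigr do rewrite mul1r.
all: by move=> i j; rewrite ltxx.
Qed.

End Greedy.

(** * Polynomials and row vectors of bounded degree *)

Section DegreeBounds.
Variable k : fieldType.
Implicit Types (p q : {poly k}) (s t : int).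

(** Degree at most t, for an integer bound t which may be negative, in which case
    the polynomial is zero. *)
Definition dle t p := forall i : nat, t < i%:Z -> p`_i = 0.

Lemma dle0 t : dle t 0. Proof. by move=> i _; rewrite coef0. Qed.
Lemma dleD t p q : dle t p -> dle t q -> dle t (p + q).
Proof. by move=> hp hq i it; rewrite coefD hp ?hq ?addr0. Qed.
Lemma dleN t p : dle t p -> dle t (- p).
Proof. by move=> hp i it; rewrite coefN hp ?oppr0. Qed.
Lemma dleB t p q : dle t p -> dle t q -> dle t (p - q).
Proof. by move=> hp hq; apply: dleD => //; apply: dleN. Qed.
Lemma dle_sum t (I : Type) (r : seq I) (P : pred I) (F : I -> {poly k}) :
  (forall i, P i -> dle t (F i)) -> dle t (\sum_(i <- r | P i) F i).
Proof. by move=> h; elim/big_ind: _; [exact: dle0 | exact: dleD | ]. Qed.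
Lemma dle_le s t p : s <= t -> dle s p -> dle t p.
Proof. by move=> st hp i it; apply: hp; apply: le_lt_trans it. Qed.
Lemma dle_neg t p : t < 0 -> dle t p -> p = 0.
Proof. by move=> t0 hp; apply/polyP => i; rewrite coef0 hp //; lia. Qed.
Lemma dleM s t p q : dle s p -> dle t q -> dle (s + t) (p * q).
Proof.
move=> hp hq i it; rewrite coefM big1 // => j _.
case: (ltP s j%:Z) => h; first by rewrite hp ?mul0r.
by rewrite hq ?mulr0 //; have := ltn_ord j; lia.
Qed.
Lemma dleX n : dle n%:Z 'X^n.
Proof. by move=> i it; rewrite coefXn; case: eqP => // e; lia. Qed.
Lemma dleC (c : k) : dle 0 c%:P.
Proof. by move=> i it; rewrite coefC; case: i it. Qed.
Lemma dleZ t c p : dle t p -> dle t (c *: p).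
Proof. by move=> hp i it; rewrite coefZ hp ?mulr0. Qed.
Lemma dle_size p : dle (size p)%:Z p.
Proof. by move=> i; rewrite ltz_nat => /ltnW it; rewrite nth_default. Qed.

(** Integer indices give a leading coefficient with respect to any bound t, also
    to a negative one. *)
Definition coefz p t : k := if t is Posz n then p`_n else 0.

Lemma dle_top t p : dle t p -> coefz p t = 0 -> dle (t - 1) p.
Proof.
case: t => [n|n] hp h i it; last by apply: hp; lia.
case: (altP (i =P n)) => [->|/eqP ne]; first exact: h.
by apply: hp; lia.
Qed.

Lemma coefzB p q t : coefz (p - q) t = coefz p t - coefz q t.
Proof. by case: t => n /=; rewrite ?coefB ?subr0. Qed.
Lemma coefz_sum t (I : Type) (r : seq I) (P : pred I) (F : I -> {poly k}) :
  coefz (\sum_(i <- r | P i) F i) t = \sum_(i <- r | P i) coefz (F i) t.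
Proof. by case: t => n /=; [rewrite coef_sum|rewrite big1]. Qed.

Lemma coefzM s t p q : dle s p -> dle t q ->
  coefz (p * q) (s + t) = coefz p s * coefz q t.
Proof.
move=> hp hq.
case: (ltP s 0) => s0; first by rewrite (dle_neg s0 hp) mul0r; case: s {s0 hp} => n; rewrite /= ?coef0 mul0r; case: (_ + _) => m //=; rewrite coef0.
case: (ltP t 0) => t0; first by rewrite (dle_neg t0 hq) mulr0; case: t {t0 hq} => n; rewrite /= ?coef0 mulr0; case: (_ + _) => m //=; rewrite coef0.
case: s s0 hp => // m _ hp; case: t t0 hq => // n _ hq /=.
have hm : (m < (m + n).+1)%N by rewrite ltnS leq_addr.
rewrite coefM (bigD1 (Ordinal hm)) //= addKn big1 ?addr0 // => j jm.
case: (ltnP m j) => h; first by rewrite hp ?mul0r.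
by rewrite hq ?mulr0 //; move: jm; rewrite -val_eqE /=; lia.
Qed.

(** The homogeneous elements of a given degree in a graded free module: the
    bound of an entry is that degree minus the degree of its basis element. *)
Definition box n (u : 'I_n -> int) (v : 'rV[{poly k}]_n) :=
  forall i, dle (u i) (v 0 i).

Lemma boxD n (u : 'I_n -> int) v w : box u v -> box u w -> box u (v + w).
Proof. by move=> hv hw i; rewrite mxE; apply: dleD. Qed.
Lemma boxB n (u : 'I_n -> int) v w : box u v -> box u w -> box u (v - w).
Proof. by move=> hv hw i; rewrite !mxE; apply: dleB. Qed.
Lemma box0 n (u : 'I_n -> int) : box u 0.
Proof. by move=> i; rewrite mxE; apply: dle0. Qed.
Lemma box_neg n (u : 'I_n -> int) v : (forall i, u i < 0) -> box u v -> v = 0.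
Proof. by move=> un hv; apply/rowP => i; rewrite mxE; apply: dle_neg (hv i). Qed.

Lemma box_mul n m (t : int) (e : 'I_n -> int) (b : 'I_m -> int) f
  (G : 'M[{poly k}]_(n, m)) :
  box (fun x => t - e x) f -> (forall x, box (fun i => e x - b i) (row x G)) ->
  box (fun i => t - b i) (f *m G).
Proof.
move=> hf hG i; rewrite mxE; apply: dle_sum => x _.
have -> : t - b i = (t - e x) + (e x - b i) by lia.
by apply: dleM => //; have := hG x i; rewrite mxE.
Qed.

Definition bdim n (u : 'I_n -> int) : nat := \sum_i absz (Num.max 0 (u i + 1))%R.

(** Boxes have dimension bdim over k.  The parametrization is kept linear in the
    explicit form F (c *: x + y), as 'rV[{poly k}]_n is not given as a k-space. *)
Lemma box_param n (u : 'I_n -> int) :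
  exists F : 'rV[k]_(bdim u) -> 'rV[{poly k}]_n,
  [/\ forall c x y, F (c *: x + y) = c%:P *: F x + F y,
      forall x, box u (F x),
      forall v, box u v -> exists x, F x = v
    & forall x, F x = 0 -> x = 0].
Proof.
pose w i := absz (Num.max 0 (u i + 1))%R.
pose T := {i : 'I_n & 'I_(w i)}.
have cT : #|{: T}| = bdim u.
  by rewrite card_tagged sumnE big_map big_enum; apply: eq_bigr => i _; rewrite card_ord.
move: (bdim u) cT => m cT; subst m.
pose F (x : 'rV[k]_#|{: T}|) : 'rV[{poly k}]_n :=
  \row_i \sum_(j < w i) x 0 (enum_rank (Tagged (fun i => 'I_(w i)) j : T)) *: 'X^j.
have FE x i m : (F x 0 i)`_m =
    if (insub m : option 'I_(w i)) is Some j then x 0 (enum_rank (Tagged (fun i => 'I_(w i)) j : T)) else 0.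
  rewrite mxE coef_sum; case: insubP => [j _ jm|hm].
    rewrite (bigD1 j) //= coefZ coefXn jm eqxx mulr1 big1 ?addr0 // => j' jj'.
    rewrite coefZ coefXn -jm; case: eqP => [/val_inj e|_]; last by rewrite mulr0.
    by rewrite e eqxx in jj'.
  rewrite big1 // => j _; rewrite coefZ coefXn; case: eqP => [e|_]; last by rewrite mulr0.
  by rewrite e ltn_ord in hm.
exists F; split.
- move=> c x y; apply/rowP => i; apply/polyP => m; rewrite [in RHS]mxE coefD [in RHS]mxE coefCM !FE.
  by case: insubP => [j _ _|_]; rewrite ?mxE // mulr0 addr0.
- move=> x i m hm; rewrite FE; case: insubP => // j; rewrite /w => h _; exfalso; lia.
- move=> v hv; exists (\row_(j < #|{: T}|) (v 0 (tag (enum_val j : T)))`_(nat_of_ord (tagged (enum_val j : T)))).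
  apply/rowP => i; apply/polyP => m; rewrite FE; case: insubP => [j _ <-|h].
    by rewrite mxE enum_rankK.
  by rewrite hv //; move: h; rewrite /w; lia.
- move=> x Fx; apply/rowP => j; rewrite mxE.
  rewrite -(enum_valK j); case: (enum_val j) => i m.
  have := FE x i m; rewrite Fx mxE coef0; case: insubP => [m' _ /val_inj ->|]; last by rewrite ltn_ord.
  by move->.
Qed.

Section Dim.
Variables (n m : nat) (u : 'I_n -> int).

Lemma lin_sum (F : 'rV[k]_m -> 'rV[{poly k}]_n) :
  (forall c x y, F (c *: x + y) = c%:P *: F x + F y) ->
  forall x, F x = map_mx polyC x *m \matrix_i F (delta_mx 0 i).
Proof.
move=> FL x; have F0 : F 0 = 0.
  by have := FL (-1) 0 0; rewrite scaler0 add0r polyCN polyC1 scaleN1r addNr.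
rewrite mulmx_sum_row [in LHS](row_sum_delta x).
have -> : F (\sum_(j < m) x 0 j *: delta_mx 0 j) = \sum_j (x 0 j)%:P *: F (delta_mx 0 j).
  elim: (index_enum _) => [|i r IH]; first by rewrite !big_nil.
  by rewrite !big_cons FL IH.
by apply: eq_bigr => i _; rewrite mxE rowK.
Qed.
End Dim.

(** Dimension count for v |-> (v *m A, w), where w is attached to the kernel
    vectors v by a linear relation R that determines v. *)
Lemma box_dim_le n n1 n2 (u : 'I_n -> int) (u1 : 'I_n1 -> int) (u2 : 'I_n2 -> int)
  (A : 'M[{poly k}]_(n, n1)) (R : 'rV[{poly k}]_n -> 'rV[{poly k}]_n2 -> Prop) :
  R 0 0 ->
  (forall c v w v' w', R v w -> R v' w' -> R (c%:P *: v + v') (c%:P *: w + w')) ->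
  (forall v, box u v -> box u1 (v *m A)) ->
  (forall v, box u v -> v *m A = 0 -> exists2 w, box u2 w & R v w) ->
  (forall v, box u v -> v *m A = 0 -> R v 0 -> v = 0) ->
  (bdim u <= bdim u1 + bdim u2)%N.
Proof.
move=> R0 RL hA hR Rinj.
have [F [FL Fb Fs Fi]] := box_param u.
have [F1 [FL1 Fb1 Fs1 Fi1]] := box_param u1.
have [F2 [FL2 Fb2 Fs2 Fi2]] := box_param u2.
have [phi hphi] : exists phi : 'M[k]_(bdim u, bdim u1), forall x, F1 (x *m phi) = F x *m A.
  have /fin_all_exists [r hr] : forall i, exists y, F1 y = F (delta_mx 0 i) *m A.
    by move=> i; apply: Fs1; apply: hA.
  exists (\matrix_i r i) => x; rewrite (lin_sum FL) (lin_sum FL1) -!mulmxA map_mxM -mulmxA.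
  congr (_ *m _); apply/row_matrixP => i.
  by rewrite !row_mul -map_row !rowK -hr (lin_sum FL1).
have [K [Ks Kf]] : exists K : 'M[k]_(\rank (kermx phi), bdim u), (K <= kermx phi)%MS /\ row_free K.
  by exists (row_base (kermx phi)); rewrite eq_row_base row_base_free.
have KA i : F (row i K) *m A = 0.
  rewrite -hphi -row_mul.
  rewrite (sub_kermxP Ks).
  by rewrite row0 (lin_sum FL1) map_mx0 mul0mx.
have /fin_all_exists [r hr] : forall i, exists y, R (F (row i K)) (F2 y).
  move=> i; have [w /Fs2 [y <-] h] := hR _ (Fb _) (KA i); by exists y.
pose X := \matrix_i r i.
have RX (c : 'rV[k]_(\rank (kermx phi))) : R (F (c *m K)) (F2 (c *m X)).
  rewrite (lin_sum FL) (lin_sum FL2) !map_mxM -!mulmxA !mulmx_sum_row.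
  elim/big_ind2: _ => //.
    move=> v w v' w' h h'; have := RL 1 _ _ _ _ h h'.
    by rewrite polyC1 !scale1r.
  move=> i _; rewrite !row_mul mxE -!map_row -[row i X]/(row i (\matrix_i r i)) rowK.
  rewrite -[map_mx polyC (row i K) *m _](lin_sum FL) -[map_mx polyC (r i) *m _](lin_sum FL2).
  by have := RL (c 0 i) _ _ _ _ (hr i) R0; rewrite !addr0.
have free : row_free X.
  rewrite -kermx_eq0; apply/eqP/row_matrixP => i; rewrite row0.
  set c := row i _; have cX : c *m X = 0 by rewrite /c -row_mul mulmx_ker row0.
  have h := RX c; rewrite cX [F2 0](lin_sum FL2) map_mx0 mul0mx in h.
  have hz : F (c *m K) *m A = 0.
    rewrite -hphi -mulmxA.
    rewrite (sub_kermxP Ks).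
    by rewrite mulmx0 (lin_sum FL1) map_mx0 mul0mx.
  have /Fi : F (c *m K) = 0 by apply: Rinj.
  by rewrite -(mul0mx _ K) => /(row_free_inj Kf).
have := rank_leq_col X; rewrite (eqP free) mxrank_ker.
by have := rank_leq_col phi; lia.
Qed.

(** Preimages of a basis of the box u1, together with the image of a basis of the
    box u2, are linearly independent. *)
Lemma box_dim_ge n n1 n2 (u : 'I_n -> int) (u1 : 'I_n1 -> int) (u2 : 'I_n2 -> int)
  (A : 'M[{poly k}]_(n, n1)) (G : 'M[{poly k}]_(n2, n)) :
  (forall w, box u1 w -> exists2 v, box u v & v *m A = w) ->
  (forall f, box u2 f -> box u (f *m G)) -> G *m A = 0 ->
  (forall f : 'rV_n2, f *m G = 0 -> f = 0) ->
  (bdim u1 + bdim u2 <= bdim u)%N.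
Proof.
move=> hA hG GA Ginj.
have [F [FL Fb Fs Fi]] := box_param u.
have [F1 [FL1 Fb1 Fs1 Fi1]] := box_param u1.
have [F2 [FL2 Fb2 Fs2 Fi2]] := box_param u2.
have /fin_all_exists [r hr] : forall i, exists y, F y *m A = F1 (delta_mx 0 i).
  by move=> i; have [v /Fs[y <-] <-] := hA _ (Fb1 (delta_mx 0 i)); exists y.
have /fin_all_exists [g hg] : forall i, exists y, F y = F2 (delta_mx 0 i) *m G.
  by move=> i; apply: Fs; apply: hG.
pose V := \matrix_i r i; pose H := \matrix_i g i.
have VE c : F (c *m V) *m A = F1 c.
  rewrite (lin_sum FL) (lin_sum FL1) map_mxM -!mulmxA; congr (_ *m _).
  by apply/row_matrixP => i; rewrite !row_mul -map_row !rowK -hr (lin_sum FL) mulmxA.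
have HE c : F (c *m H) = F2 c *m G.
  rewrite (lin_sum FL) (lin_sum FL2) map_mxM -!mulmxA; congr (_ *m _).
  by apply/row_matrixP => i; rewrite !row_mul -map_row !rowK -hg (lin_sum FL).
have FD x y : F (x + y) = F x + F y by have := FL 1 x y; rewrite polyC1 !scale1r.
have F10 : F1 0 = 0 by rewrite (lin_sum FL1) map_mx0 mul0mx.
have F0 : F 0 = 0 by rewrite (lin_sum FL) map_mx0 mul0mx.
have F20 : F2 0 = 0 by rewrite (lin_sum FL2) map_mx0 mul0mx.
suff : row_free (col_mx V H) by move=> /eqP <-; exact: rank_leq_col.
rewrite -kermx_eq0; apply/eqP/row_matrixP => i; rewrite row0.
set c := row i _; have : c *m col_mx V H = 0 by rewrite /c -row_mul mulmx_ker row0.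
rewrite -[c]hsubmxK mul_row_col => cVH.
have h : F (lsubmx c *m V) + F (rsubmx c *m H) = 0 by rewrite -FD cVH F0.
have c1 : lsubmx c = 0.
  apply: Fi1; rewrite -VE; have := congr1 (mulmx^~ A) h.
  by rewrite mulmxDl HE -mulmxA GA mulmx0 addr0 mul0mx.
have c2 : rsubmx c = 0.
  by apply: Fi2; apply: Ginj; rewrite -HE; move: h; rewrite c1 mul0mx F0 add0r.
by rewrite c1 c2 row_mx0.
Qed.

(** Equality of the dimensions makes the injection v |-> v *m A a bijection. *)
Lemma box_surj n n1 (u : 'I_n -> int) (u1 : 'I_n1 -> int) (A : 'M[{poly k}]_(n, n1)) :
  (forall v, box u v -> box u1 (v *m A)) ->
  (forall v, box u v -> v *m A = 0 -> v = 0) -> (bdim u1 <= bdim u)%N ->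
  forall w, box u1 w -> exists2 v, box u v & v *m A = w.
Proof.
move=> hA Ainj hd.
have [F [FL Fb Fs Fi]] := box_param u.
have [F1 [FL1 Fb1 Fs1 Fi1]] := box_param u1.
have [phi hphi] : exists phi : 'M[k]_(bdim u, bdim u1), forall x, F1 (x *m phi) = F x *m A.
  have /fin_all_exists [r hr] : forall i, exists y, F1 y = F (delta_mx 0 i) *m A.
    by move=> i; apply: Fs1; apply: hA.
  exists (\matrix_i r i) => x; rewrite (lin_sum FL) (lin_sum FL1) -!mulmxA map_mxM -mulmxA.
  congr (_ *m _); apply/row_matrixP => i.
  by rewrite !row_mul -map_row !rowK -hr (lin_sum FL1).
have free : row_free phi.
  rewrite -kermx_eq0; apply/eqP/row_matrixP => i; rewrite row0; apply: Fi.
  apply: Ainj => //; rewrite -hphi -row_mul mulmx_ker row0.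
  by rewrite (lin_sum FL1) map_mx0 mul0mx.
have full : row_full phi by rewrite /row_full eqn_leq rank_leq_col (eqP free) hd.
move=> w /Fs1 [y <-]; have /submxP [x ->] : (y <= phi)%MS by apply: submx_full.
by exists (F x) => //; rewrite hphi.
Qed.

End DegreeBounds.

(** * Adapted bases of kernels of polynomial matrices *)

Section Forney.
Variable k : fieldType.

Section LeadingCoefficient.
Variables (n : nat) (b : 'I_n -> int).
Implicit Types (t : int) (v : 'rV[{poly k}]_n).

(** Leading coefficients with respect to the degree t of v as an element of a
    graded module, not to the actual degrees of the entries. *)
Definition lc t v : 'rV[k]_n := \row_i coefz (v 0 i) (t - b i).

Lemma lcB t v w : lc t (v - w) = lc t v - lc t w.
Proof. by apply/rowP => i; rewrite !mxE coefzB. Qed.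

Lemma lc_top t v : box (fun i => t - b i) v -> lc t v = 0 ->
  box (fun i => t - 1 - b i) v.
Proof.
move=> hv /rowP h i; have -> : t - 1 - b i = t - b i - 1 by lia.
by apply: dle_top => //; have := h i; rewrite !mxE.
Qed.

Lemma lc_mul t r (e : 'I_r -> int) (G : 'M[{poly k}]_(r, n)) f :
  box (fun s => t - e s) f -> (forall s, box (fun i => e s - b i) (row s G)) ->
  lc t (f *m G) = (\row_s coefz (f 0 s) (t - e s)) *m \matrix_s lc (e s) (row s G).
Proof.
move=> hf hG; apply/rowP => i; rewrite !mxE coefz_sum; apply: eq_bigr => s _.
have -> : t - b i = (t - e s) + (e s - b i) by lia.
rewrite coefzM //; last by have := hG s i; rewrite mxE.
by rewrite !mxE.
Qed.
End LeadingCoefficient.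

Section Adapted.
Variables (n m : nat) (b : 'I_n -> int) (D : 'M[{poly k}]_(n, m)).

(** A basis of the kernel of D for which degrees add up: the predictable degree
    property of a minimal basis.  In geometric terms it is the splitting of a
    vector bundle on the projective line into line bundles of degrees - e s. *)
Definition adapted_basis r (e : 'I_r -> int) (G : 'M[{poly k}]_(r, n)) :=
  [/\ forall s, box (fun i => e s - b i) (row s G),
      G *m D = 0,
      forall t v, box (fun i => t - b i) v -> v *m D = 0 ->
        exists2 f, box (fun s => t - e s) f & v = f *m G
    & forall f : 'rV_r, f *m G = 0 -> f = 0].

(** The leading vector of v is explained by basis vectors of degree at most t. *)
Definition covers r (E : 'rV[int]_r) (L : 'M[k]_(r, n)) t v :=
  exists2 c : 'rV[k]_r, lc b t v = c *m L & forall s, t < E 0 s -> c 0 s = 0.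

Definition lcmx r (E : 'rV[int]_r) (G : 'M[{poly k}]_(r, n)) :=
  \matrix_s lc b (E 0 s) (row s G).

(** Independent leading vectors give an adapted basis: subtracting the right
    combination lowers the degree of a kernel element, and a relation of least
    degree would be a relation between the leading vectors. *)
Lemma covers_repr r (E : 'rV[int]_r) (G : 'M[{poly k}]_(r, n)) :
  (forall s, box (fun i => E 0 s - b i) (row s G)) -> G *m D = 0 ->
  row_free (lcmx E G) ->
  (forall t v, box (fun i => t - b i) v -> v *m D = 0 -> covers E (lcmx E G) t v) ->
  adapted_basis (fun s => E 0 s) G.
Proof.
move=> hG GD Lf cov; split=> //.
  pose t0 : int := - (\sum_i `|b i|)%:Z.
  have bt0 i : t0 <= b i.
    rewrite /t0 (bigD1 i) //=; have := leq0n (\sum_(j | j != i) `|b j|)%N; lia.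
  move=> t v; have [N] : exists N : nat, t < t0 + N%:Z.
    by exists `|t - t0|.+1; lia.
  elim: N t v => [|N IH] t v tN hv vD.
    have -> : v = 0 by apply: box_neg hv => i; have := bt0 i; lia.
    by exists 0; [exact: box0|rewrite mul0mx].
  have [c cE c0] := cov t v hv vD.
  pose f0 : 'rV[{poly k}]_r := \row_s ((c 0 s)%:P * 'X^(absz (t - E 0 s)%R)).
  have hf0 : box (fun s => t - E 0 s) f0.
    move=> s; rewrite mxE mul_polyC; case: (ltP t (E 0 s)) => h.
      by rewrite c0 // scale0r; apply: dle0.
    apply: dleZ; have {1}-> : t - E 0 s = (absz (t - E 0 s)%R)%:Z by lia.
    exact: dleX.
  have lf0 : lc b t (f0 *m G) = lc b t v.
    rewrite (lc_mul hf0 hG) cE; congr (_ *m _); apply/rowP => s; rewrite !mxE.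
    case: (ltP t (E 0 s)) => h; first by rewrite c0 // polyC0 mul0r; case: (_ - _) => ? //=; rewrite coef0.
    have {2}-> : t - E 0 s = (absz (t - E 0 s)%R)%:Z by lia.
    by rewrite /= coefCM coefXn eqxx mulr1.
  have [|||f hf vf] := IH (t - 1) (v - f0 *m G) _ _ _.
  - by lia.
  - apply: lc_top; last by rewrite lcB lf0 subrr.
    by apply: boxB => //; apply: box_mul.
  - by rewrite mulmxBl vD -mulmxA GD mulmx0 subr0.
  exists (f + f0); last by rewrite mulmxDl -vf subrK.
  by apply: boxD => // s; apply: dle_le (hf s); lia.
move=> f fG.
pose e0 : int := - (\sum_s absz (E 0 s)%R)%N%:Z.
have Ee0 s : e0 <= E 0 s.
  rewrite /e0 (bigD1 s) //=; have := leq0n (\sum_(j | j != s) absz (E 0 j)%R)%N; lia.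
have [t ht] : exists t, box (fun s => t - E 0 s) f.
  exists (\sum_s ((size (f 0 s))%:Z + (absz (E 0 s)%R)%:Z)) => s.
  apply: dle_le (@dle_size k (f 0 s)); rewrite (bigD1 s) //=.
  have : 0 <= \sum_(i | i != s) ((size (f 0 i))%:Z + (absz (E 0 i)%R)%:Z) by apply: sumr_ge0.
  move: (\sum_(i | _) _) (size _) (E 0 s) => x y z; lia.
have [N] : exists N : nat, t < e0 + N%:Z by exists `|t - e0|.+1; lia.
elim: N t ht => [|N IH] t ht tN.
  by apply: box_neg ht => s; have := Ee0 s; lia.
apply: (IH (t - 1)); last by lia.
have h := lc_mul ht hG; rewrite fG in h.
have h0 : \row_s coefz (f 0 s) (t - E 0 s) *m lcmx E G = 0.
  rewrite -h; apply/rowP => i; rewrite !mxE; by case: (_ - _) => ? //=; rewrite coef0.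
have {}h0 : \row_s coefz (f 0 s) (t - E 0 s) = 0.
  by apply: (row_free_inj Lf); rewrite h0 mul0mx.
move=> s; have -> : t - 1 - E 0 s = t - E 0 s - 1 by lia.
by apply: dle_top => //; move/rowP/(_ s): h0; rewrite !mxE.
Qed.

Lemma nat_least (P : nat -> Prop) N : P N ->
  exists2 N0, P N0 & forall N', (N' < N0)%N -> ~ P N'.
Proof.
elim/ltn_ind: N => N IH PN.
case: (classic (exists2 N', (N' < N)%N & P N')) => [[N' lt PN']|h]; first exact: IH lt PN'.
by exists N => // N' lt PN'; apply: h; exists N'.
Qed.

(** Start from the empty basis, and adjoin a kernel element of the least degree
    whose leading vector is not yet explained.  The leading vectors stay
    independent, so at most n vectors are adjoined. *)
Lemma adapted_basis_exists :
  exists r (e : 'I_r -> int) (G : 'M[{poly k}]_(r, n)), adapted_basis e G.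
Proof.
pose t0 : int := - (\sum_i `|b i|)%:Z.
have bt0 i : t0 <= b i.
  rewrite /t0 (bigD1 i) //=; have := leq0n (\sum_(j | j != i) `|b j|)%N; lia.
(* the elements of degree less than tau are already explained; n - r bounds the
   number of vectors that can still be adjoined *)
suff main N r (E : 'rV[int]_r) (G : 'M[{poly k}]_(r, n)) tau : (n - r < N)%N ->
    (forall s, box (fun i => E 0 s - b i) (row s G)) -> G *m D = 0 ->
    row_free (lcmx E G) -> (forall s, E 0 s <= tau) -> t0 <= tau ->
    (forall t v, t < tau -> box (fun i => t - b i) v -> v *m D = 0 ->
       covers E (lcmx E G) t v) ->
    exists r (e : 'I_r -> int) (G : 'M[{poly k}]_(r, n)), adapted_basis e G.
  apply: (main n.+1 0%N 0 0 t0); rewrite ?ltnS ?leq_subr ?mul0mx //; try by case.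
    by rewrite /row_free -leqn0 rank_leq_row.
  move=> t v tt0 hv _.
  have -> : v = 0 by apply: box_neg hv => i; have := bt0 i; lia.
  exists 0 => [|[] //]; apply/rowP => i; rewrite mul0mx !mxE.
  by case: (_ - _) => ? //=; rewrite coef0.
elim: N r E G tau => // N IH r E G tau hN hG GD Lf Etau t0tau cov.
pose bad (N : nat) := exists v, [/\ box (fun i => tau + N%:Z - b i) v, v *m D = 0 &
   ~ covers E (lcmx E G) (tau + N%:Z) v].
case: (classic (exists N, bad N)) => [[N0 bad0]|nobad]; last first.
  exists r, (fun s => E 0 s), G; apply: covers_repr => //; move=> t v hv vD.
  case: (ltP t tau) => h; first by apply: cov.
  apply: NNPP => hc; apply: nobad; exists (absz (t - tau)%R); exists v.
  by have -> : tau + (absz (t - tau)%R)%:Z = t by lia.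
have [N1 [v [hv vD hbad]] hmin] := nat_least bad0.
set t := tau + N1%:Z in hv hbad.
have Et j : (row_mx E (t%:M : 'M_1)) 0 (rshift r j) = t.
  by rewrite row_mxEr ord1 mxE eqxx mulr1n.
have tEs s : E 0 s <= t by apply: le_trans (Etau s) _; rewrite /t; lia.
have LE : lcmx (row_mx E (t%:M : 'M_1)) (col_mx G v) = col_mx (lcmx E G) (lc b t v).
  apply/row_matrixP => s; rewrite rowK -[s]splitK; case: (split s) => j /=.
    by rewrite row_mxEl !rowKu rowK.
  by rewrite Et !rowKd ord1 !row_id.
have Lf' : row_free (lcmx (row_mx E (t%:M : 'M_1)) (col_mx G v)).
  rewrite LE -kermx_eq0; apply/eqP/row_matrixP => i; rewrite row0.
  set c := row i _; have : c *m col_mx (lcmx E G) (lc b t v) = 0 by rewrite /c -row_mul mulmx_ker row0.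
  rewrite -[c]hsubmxK mul_row_col [rsubmx c]mx11_scalar mul_scalar_mx.
  case: (eqVneq (rsubmx c 0 0) 0) => [->|nz] h.
    rewrite scale0r addr0 in h; have -> : lsubmx c = 0.
      by apply: (row_free_inj Lf); rewrite h mul0mx.
    by rewrite raddf0 row_mx0.
  case: hbad; exists (- (rsubmx c 0 0)^-1 *: lsubmx c); last by move=> s; rewrite ltNge tEs.
  rewrite -scalemxAl; move/eqP: h; rewrite addr_eq0 => /eqP ->.
  by rewrite scalerN scaleNr opprK scalerA mulVf // scale1r.
have rn : (r + 1 <= n)%N.
  by move: Lf' => /eqP <-; apply: rank_leq_col.
apply: (IH _ (row_mx E (t%:M : 'M_1)) (col_mx G v) t) => //.
- by move: hN rn; lia.
- move=> s; rewrite -[s]splitK; case: (split s) => j /=.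
    by rewrite row_mxEl rowKu.
  by rewrite Et rowKd ord1 row_id.
- by rewrite mul_col_mx GD vD col_mx0.
- move=> s; rewrite -[s]splitK; case: (split s) => j /=.
    by rewrite row_mxEl.
  by rewrite Et.
- by rewrite /t; lia.
- move=> t' v' tt' hv' vD'.
  have [c h1 h2] : covers E (lcmx E G) t' v'.
    case: (ltP t' tau) => h; first exact: cov.
    have h' : (absz (t' - tau)%R < N1)%N by move: tt'; rewrite /t; lia.
    apply: NNPP => hc; apply: (hmin _ h'); exists v'.
    by have -> : tau + (absz (t' - tau)%R)%:Z = t' by lia.
  exists (row_mx c 0); first by rewrite LE mul_row_col mul0mx addr0.
  move=> s; rewrite -[s]splitK; case: (split s) => j /=.
    by rewrite !row_mxEl; apply: h2.
  by rewrite !row_mxEr !mxE.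
Qed.

End Adapted.
End Forney.

(** * Numerical constraints on a minimal presentation *)

Lemma pivot_columns (F : fieldType) m n (Y : 'M[F]_(m, n)) :
  exists f : 'I_(\rank Y) -> 'I_n, [/\ injective f,
    forall i, exists p, Y p (f i) != 0
  & exists Z, Y = colsub f Y *m Z].
Proof.
rewrite -mxrank_tr; exists (maxrankfun Y^T).
have free : row_free (rowsub (maxrankfun Y^T) Y^T) by apply: maxrowsub_free.
split.
- exact: maxrankfun_inj.
- move=> i; apply/existsP; apply: contraT; rewrite negb_exists => /forallP h.
  move: free; rewrite -kermx_eq0 => /eqP K0.
  have : (delta_mx (0 : 'I_1) i <= kermx (rowsub (maxrankfun Y^T) Y^T))%MS.
    apply/sub_kermxP; rewrite -rowE; apply/rowP => p; rewrite !mxE.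
    by have := h p; rewrite negbK => /eqP.
  rewrite K0 submx0 => /eqP /matrixP /(_ 0 i); rewrite !mxE !eqxx => /eqP.
  by rewrite oner_eq0.
- have /submxP [Z hZ] : (Y^T <= rowsub (maxrankfun Y^T) Y^T)%MS by rewrite eq_maxrowsub.
  exists Z^T; apply: trmx_inj; rewrite trmx_mul trmxK {1}hZ; congr (_ *m _).
  by apply/matrixP => i j; rewrite !mxE.
Qed.

Section Numerics.
Variable k : fieldType.

Lemma bdim_large n (s : 'I_n -> int) (t : int) : (forall i, s i <= t + 1) ->
  (bdim (fun i => t - s i))%:Z = n%:Z * (t + 1) - \sum_i s i.
Proof.
move=> h; rewrite /bdim.
have -> : (\sum_i absz (Num.max 0 (t - s i + 1))%R)%N%:Z = \sum_i (t + 1 - s i).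
  elim/big_rec2: _ => // i x y _ <-; rewrite PoszD; congr (_ + _); have := h i; lia.
by rewrite sumrB sumr_const card_ord -mulr_natl natz.
Qed.

Lemma big_bound n (s : 'I_n -> int) : exists T, forall i, s i <= T.
Proof.
exists (\sum_i absz (s i))%N%:Z => i; rewrite (bigD1 i) //=.
have := leq0n (\sum_(j | j != i) absz (s j))%N; lia.
Qed.

Variables (d na nb ne : nat).
Variables (a : 'I_na -> int) (b : 'I_nb -> int) (e : 'I_ne -> int).
Variables (A : 'M[{poly k}]_(nb, na)) (G : 'M[{poly k}]_(ne, nb)).
Hypothesis hA : forall p, box (fun q => b p - a q) (row p A).
Hypothesis hG : adapted_basis b A e G.
Lemma large_bounds : exists T : int, [/\ forall i, a i <= T, forall i, b i <= T & forall i, e i <= T].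
Proof.
have [T1 h1] := big_bound a; have [T2 h2] := big_bound b; have [T3 h3] := big_bound e.
exists (Num.max T1 (Num.max T2 T3)); split=> i; rewrite !le_max ?h1 ?h2 ?h3 ?orbT //.
Qed.

(** The degree t part of the complex is exact, so dimensions add up. *)
Lemma bdim_exact (t : int) : (forall w, box (fun q => t - a q) w ->
    exists2 v, box (fun p => t - b p) v & v *m A = w) ->
  bdim (fun p => t - b p) = (bdim (fun q => t - a q)%R + bdim (fun s => t - e s)%R)%N.
Proof.
move=> surj; have [h1 h2 h3 h4] := hG; apply/eqP; rewrite eqn_leq; apply/andP; split.
  apply: (@box_dim_le k _ _ _ _ _ _ A (fun v f => v = f *m G)).
  - by rewrite mul0mx.
  - by move=> c v w v' w' -> ->; rewrite mulmxDl -scalemxAl.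
  - by move=> v hv; apply: box_mul hv hA.
  - by move=> v hv vA; have [f] := h3 _ _ hv vA; exists f.
  - by move=> v _ _ ->; rewrite mul0mx.
apply: (@box_dim_ge k _ _ _ _ _ _ A G) => //.
by move=> f hf; apply: box_mul hf h1.
Qed.

Section Bound.
Hypothesis sA : forall p q, A p q != 0 -> a q < b p.
Hypothesis sG : forall s p, G s p != 0 -> b p < e s.

Local Notation tofrac := (@FracField.tofrac {poly k}).
Local Notation toK := (map_mx (@FracField.tofrac {poly k})).

Lemma frac_denom (x : {fraction {poly k}}) :
  exists2 c : {poly k}, c != 0 & exists y, tofrac c * x = tofrac y.
Proof.
elim/quotW: x => r; exists (frac r).2; first exact: denom_ratioP.
exists (frac r).1; unlock FracField.tofrac.
rewrite -[LHS]FracField.pi_mul; apply/eqmodP; rewrite /= FracField.equivfE.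
have h1 : 1 != 0 :> {poly k} by rewrite oner_eq0.
have h2 : 1 * \d_r != 0 by rewrite mul1r denom_ratioP.
rewrite /FracField.mulf !(numer_Ratio _ h1) !(denom_Ratio _ h1) (numer_Ratio _ h2) (denom_Ratio _ h2).
by rewrite mulr1 mul1r.
Qed.

Lemma frac_denom_row n (x : 'rV[{fraction {poly k}}]_n) :
  exists2 c : {poly k}, c != 0 & exists y, tofrac c *: x = toK y.
Proof.
have /fin_all_exists2 [c c0 /fin_all_exists [y hy]] := fun i => frac_denom (x 0 i).
exists (\prod_i c i); first by apply/prodf_neq0 => i _.
exists (\row_i ((\prod_(j | j != i) c j) * y i)); apply/rowP => i; rewrite !mxE.
by rewrite tofracM -hy mulrA -tofracM (bigD1 i) //= [c i * _]mulrC.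
Qed.

Lemma toK_eq0 m n (X : 'M[{poly k}]_(m, n)) : toK X = 0 -> X = 0.
Proof.
move=> /matrixP h; apply/matrixP => i j; have := h i j; rewrite !mxE.
by move=> /eqP; rewrite tofrac_eq0 => /eqP.
Qed.

Lemma basis_row_free : row_free (toK G).
Proof.
rewrite -kermx_eq0; apply/eqP/row_matrixP => i; rewrite row0.
set x := row i _; have xG : x *m toK G = 0 by rewrite /x -row_mul mulmx_ker row0.
have [c c0 [y hy]] := frac_denom_row x.
have : y *m G = 0 by apply: toK_eq0; rewrite map_mxM -hy -scalemxAl xG scaler0.
have [_ _ _ h] := hG; move=> /h y0; move: hy; rewrite y0 map_mx0 => /eqP.
by rewrite scaler_eq0 tofrac_eq0 (negPf c0) => /eqP.
Qed.

(** The rows of S are the unit vectors of B, so X |-> X *m S^T restricts X to the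
    coordinates in B, and S puts them back. *)
Lemma subset_rank_free (F : fieldType) m (B : {set 'I_m}) :
  exists S : 'M[F]_(#|B|, m), [/\ row_free S,
    forall n (X : 'M_(n, m)), (forall i p, p \notin B -> X i p = 0) -> X = X *m S^T *m S,
    S *m S^T = 1%:M
  & forall t, exists2 p, p \in B & row t S = delta_mx 0 p].
Proof.
pose S : 'M[F]_(#|B|, m) := \matrix_(t, p) (enum_val t == p)%:R.
have SS : S *m S^T = 1%:M.
  apply/matrixP => i j; rewrite !mxE (bigD1 (enum_val i)) //= !mxE eqxx mul1r.
  rewrite big1 => [|p pi]; first by rewrite addr0 (inj_eq enum_val_inj) eq_sym.
  by rewrite !mxE eq_sym (negPf pi) mul0r.
exists S; split=> //.
- rewrite /row_free eqn_leq rank_leq_row -{1}[#|B|](mxrank1 F) -SS.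
  exact: mxrankM_maxl.
- move=> n X hX; apply/matrixP => i p; rewrite mxE.
  have XS t : (X *m S^T) i t = X i (enum_val t).
    rewrite mxE (bigD1 (enum_val t)) //= !mxE eqxx mulr1 big1 ?addr0 // => q qt.
    by rewrite !mxE eq_sym (negPf qt) mulr0.
  case: (boolP (p \in B)) => pB.
    rewrite (bigD1 (enum_rank_in pB p)) //= XS mxE enum_rankK_in // eqxx mulr1.
    rewrite big1 ?addr0 // => t tp; rewrite [S t p]mxE; case: eqP => [e1|_]; last by rewrite mulr0.
    by case/eqP: tp; apply: enum_val_inj; rewrite enum_rankK_in.
  rewrite hX // big1 // => t _; rewrite [S t p]mxE; case: eqP => [e1|_]; last by rewrite mulr0.
  by rewrite -e1 enum_valP in pB.
- by move=> t; exists (enum_val t); [exact: enum_valP|apply/rowP => p; rewrite !mxE eqxx eq_sym].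
Qed.

(** Take the b up to c, and let A' be the corresponding rows of A, and G' the
    remaining columns of G.  Over the fraction field the kernel W of G' is sent
    by G into the kernel of A', so rank W + rank A' is at most the number of
    these b.  Pivot columns of A' and of W then parametrize the vectors supported
    on these b: the dimension count in large degrees t gives, in the coefficient of
    t, equality of the ranks, and, in the constant term, the inequality between
    the sums of degrees.  By minimality a pivot column of A' has degree less than c,
    and W contains all basis vectors of degree at most c + 1. *)
Lemma presentation_bound : initial_bound a b e.
Proof.
move=> c; have [hG1 GA hrep _] := hG.
pose A' : 'M[{poly k}]_(nb, na) := \matrix_(p, q) if b p <= c then A p q else 0.
pose G' : 'M[{poly k}]_(ne, nb) := \matrix_(s, p) if b p <= c then 0 else G s p.
pose Y := toK A'; pose W := kermx (toK G').
pose B := [set p | b p <= c].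
have [f1 [f1i f1n [Z1 hZ1]]] := pivot_columns Y.
have [f2 [f2i f2n [Z2 hZ2]]] := pivot_columns W.
(* W *m G and A' are supported on the coordinates in B, and their product is 0 *)
have rk : (\rank W + \rank Y <= #|B|)%N.
  have [S [Sf SX SS _]] := subset_rank_free {fraction {poly k}} B.
  have E1 : W *m toK G = W *m toK G *m S^T *m S.
    apply: SX => i p; rewrite inE => pB.
    have := mulmx_ker (toK G') => /matrixP/(_ i p); rewrite !mxE => h.
    rewrite -[RHS]h; apply: eq_bigr => s _; rewrite !mxE; by rewrite (negPf pB).
  have E2 : Y = S^T *m (S *m Y).
    apply: trmx_inj; rewrite !trmx_mul trmxK -mulmxA mulmxA; apply: SX => i p.
    by rewrite inE !mxE => /negPf->; rewrite tofrac0.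
  have Z : (W *m toK G *m S^T) *m (S *m Y) = 0.
    rewrite -mulmxA -E2 -[RHS](mulmx0 _ W) -(map_mx0 (@FracField.tofrac {poly k})) -GA.
    rewrite map_mxM mulmxA; apply/matrixP => i q; rewrite [LHS]mxE [RHS]mxE; apply: eq_bigr => p _.
    rewrite [Y p q]mxE [A' p q]mxE [toK A p q]mxE; case: ifP => pB //.
    have -> : (W *m toK G) i p = 0; last by rewrite !mul0r.
    have := mulmx_ker (toK G') => /matrixP/(_ i p); rewrite !mxE => h.
    by rewrite -[RHS]h; apply: eq_bigr => s _; rewrite !mxE pB.
  have r1 : \rank W = \rank (W *m toK G) by rewrite mxrankMfree // basis_row_free.
  have r2 : (\rank (W *m toK G) <= \rank (W *m toK G *m S^T))%N by rewrite {1}E1 mxrankM_maxl.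
  have r3 : (\rank Y <= \rank (S *m Y))%N by rewrite {1}E2 mxrankM_maxr.
  apply: leq_trans (mulmx0_rank_max Z); apply: leq_add => //; by rewrite r1.
have rkW : (#|[set s | (e s <= c + 1)%R]| <= \rank W)%N.
  have [S [Sf _ _ hS]] := subset_rank_free {fraction {poly k}} [set s | (e s <= c + 1)%R].
  rewrite -(eqP Sf); apply: mxrankS; apply/row_subP => t; have [s] := hS t.
  rewrite inE => es ->; apply/sub_kermxP; rewrite -rowE; apply/rowP => p; rewrite !mxE.
  case: ifP => pB; first by rewrite tofrac0.
  apply/eqP; rewrite tofrac_eq0; apply: contraFT pB => /sG; lia.
(* a vector v in the box of u is determined by the pivot coordinates of v *m A',
   and, if these vanish, by the pivot coordinates of its representation by G *)
have ineq (t : int) : (forall p, b p <= t + 1) -> (forall p, a p <= t + 1) -> (forall s, e s <= t + 1) ->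
   #|B|%:Z * (t + 1) - \sum_(q in B) b q <=
   (\rank Y)%:Z * (t + 1) - \sum_i a (f1 i) + ((\rank W)%:Z * (t + 1) - \sum_i e (f2 i)).
  move=> tb ta te; pose u p := if b p <= c then t - b p else -1.
  have -> : #|B|%:Z * (t + 1) - \sum_(q in B) b q = (bdim u)%:Z.
    have -> : (bdim u)%:Z = \sum_(p in B) (t + 1 - b p).
      rewrite [RHS]big_mkcond /bdim /=.
      elim/big_rec2: _ => // i x y _ <-; rewrite PoszD inE /u; congr (_ + _).
      by have := tb i; case: ifP => _; lia.
    by rewrite sumrB sumr_const -mulr_natl natz.
  have ub : (bdim u <= bdim (fun i => t - a (f1 i))%R + bdim (fun i => t - e (f2 i))%R)%N.
    have off (v : 'rV[{poly k}]_nb) p : box u v -> ~~ (b p <= c) -> v 0 p = 0.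
      by move=> hv /negPf pB; have := hv p; rewrite /u pB; apply: dle_neg.
    have boxu (v : 'rV[{poly k}]_nb) : box u v -> box (fun p => t - b p) v.
      move=> hv p; apply: dle_le (hv p); rewrite /u; case: ifP => // _.
      by have := tb p; lia.
    have col v n (X : 'M[{poly k}]_(nb, n)) (X' : 'M[{poly k}]_(nb, n)) : box u v ->
       (forall p q, b p <= c -> X p q = X' p q) -> v *m X = v *m X'.
      move=> hv hX; apply/rowP => q; rewrite !mxE; apply: eq_bigr => p _.
      case: (boolP (b p <= c)) => pB; first by rewrite hX.
      by rewrite off // !mul0r.
    apply: (@box_dim_le k _ _ _ _ _ _ (colsub f1 A) (fun v w => exists2 f, v = f *m G & w = colsub f2 f)).
    - by exists 0; rewrite ?mul0mx //; apply/rowP => i; rewrite !mxE.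
    - move=> x v w v' w' [f -> ->] [f' -> ->]; exists (x%:P *: f + f').
        by rewrite mulmxDl -scalemxAl.
      by apply/rowP => i; rewrite !mxE.
    - move=> v hv i; have := box_mul (boxu _ hv) hA => /(_ (f1 i)).
      by rewrite mxE [in X in _ -> X]mxE; under [in X in _ -> X]eq_bigr do rewrite mxE.
    - move=> v hv vA1.
      have vA : v *m A = 0.
        rewrite (col v _ A A' hv); last by move=> p q pB; rewrite mxE pB.
        apply: toK_eq0; rewrite map_mxM -/Y hZ1 mulmxA.
        suff -> : toK v *m colsub f1 Y = 0 by rewrite mul0mx.
        have -> : colsub f1 Y = toK (colsub f1 A') by apply/matrixP => i j; rewrite !mxE.
        rewrite -map_mxM (col v _ _ (colsub f1 A) hv) ?vA1 ?map_mx0 //.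
        by move=> p q pB; rewrite !mxE pB.
      have [f hf vf] := hrep _ _ (boxu _ hv) vA.
      by exists (colsub f2 f); [move=> i; rewrite mxE; apply: hf | exists f].
    - move=> v hv _ [f vf f0].
      suff fz : f = 0 by rewrite vf fz mul0mx.
      apply: toK_eq0.
      have /submxP [x hx] : (toK f <= W)%MS.
        apply/sub_kermxP; rewrite -map_mxM.
        suff -> : f *m G' = 0 by rewrite map_mx0.
        apply/rowP => p; rewrite !mxE.
        case: (boolP (b p <= c)) => pB; first by rewrite big1 // => s _; rewrite mxE pB mulr0.
        have := off v p hv pB; rewrite vf mxE => h; rewrite -[RHS]h.
        by apply: eq_bigr => s _; rewrite mxE (negPf pB).
      rewrite hx hZ2 mulmxA.
      suff -> : x *m colsub f2 W = 0 by rewrite mul0mx.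
      have -> : x *m colsub f2 W = colsub f2 (toK f).
        by rewrite hx; apply/matrixP => i j; rewrite !mxE; apply: eq_bigr => s _; rewrite !mxE.
      have -> : colsub f2 (toK f) = toK (colsub f2 f) by apply/matrixP => i j; rewrite !mxE.
      by rewrite -f0 map_mx0.
  rewrite -!bdim_large; [|by move=> i|by move=> i].
  by rewrite -PoszD lez_nat.
have [T [Ta Tb Te]] := large_bounds.
(* a strict inequality of ranks would contradict the count for large t *)
have rkE : (\rank W + \rank Y = #|B|)%N.
  apply/eqP; rewrite eqn_leq rk leqNgt; apply/negP => lt.
  pose x := \sum_(q in B) b q - \sum_i a (f1 i) - \sum_i e (f2 i).
  pose t : int := (absz T + absz x)%N%:Z.
  have : T <= t + 1 by rewrite /t; lia.
  move=> Tt; have := ineq t; have := fun p => le_trans (Ta p) Tt.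
  have := fun p => le_trans (Tb p) Tt; have := fun p => le_trans (Te p) Tt.
  move=> h1 h2 h3 /(_ h2 h3 h1).
  have -> : #|B|%:Z = (\rank Y)%:Z + (\rank W)%:Z + (#|B| - (\rank W + \rank Y))%N%:Z by lia.
  have : t + 1 <= (#|B| - (\rank W + \rank Y))%N%:Z * (t + 1) by rewrite ler_peMl; lia.
  rewrite !mulrDl; move: (_ * _) (_ * _) (_ * _) => y1 y2 y3.
  rewrite /t /x; lia.
exists (f1 @: setT), (f2 @: setT); split.
- move=> p /imsetP [i _ ->]; have [p'] := f1n i; rewrite mxE tofrac_eq0 mxE.
  by case: ifP => [pc /sA h|_]; [apply: lt_le_trans h pc|rewrite eqxx].
- by rewrite !card_imset // !cardsT !card_ord addnC.
- by rewrite card_imset // cardsT card_ord.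
rewrite big_imset /=; last by move=> ? ? _ _; apply: f1i.
rewrite big_imset /=; last by move=> ? ? _ _; apply: f2i.
have -> : \sum_(q | b q <= c) (b q)%:~R = \sum_(q in B) (b q)%:~R :> rat.
  by apply: eq_bigl => q; rewrite inE.
rewrite -!(rmorph_sum (intmul 1)) -intrD ler_int.
rewrite [X in X + _](eq_bigl xpredT) => [|i]; last by rewrite inE.
rewrite [X in _ + X](eq_bigl xpredT) => [|i]; last by rewrite inE.
have Tt : T <= (absz T)%:Z + 1 by lia.
have := ineq _ (fun p => le_trans (Tb p) Tt) (fun p => le_trans (Ta p) Tt) (fun p => le_trans (Te p) Tt).
rewrite -rkE PoszD mulrDl; move: (_ * _) (_ * _) => y1 y2.
by move: (\sum_i _) (\sum_i _) (\sum_(i in B) _) => y3 y4 y5; lia.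
Qed.

End Bound.

Hypothesis d_gt0 : (0 < d)%N.
Hypothesis fin : exists N : nat, forall n : nat, (N <= n)%N ->
  forall w, box (fun q => (n * d)%N%:Z - a q) w ->
  exists2 v, box (fun p => (n * d)%N%:Z - b p) v & v *m A = w.

(** Both sides of the dimension count are affine in the degree, so the
    coefficients agree. *)
Lemma balance : (na + ne = nb)%N /\ \sum_p a p + \sum_s e s = \sum_q b q.
Proof.
have [N hN] := fin; have [T [Ta Tb Te]] := large_bounds.
have rel n : (N <= n)%N -> (absz T <= n)%N ->
    nb%:Z * ((n * d)%N%:Z + 1) - \sum_q b q
    = na%:Z * ((n * d)%N%:Z + 1) - \sum_p a p + (ne%:Z * ((n * d)%N%:Z + 1) - \sum_s e s).
  move=> Nn Tn.
  have hT : T <= (n * d)%N%:Z + 1 by have := leq_pmulr n d_gt0; lia.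
  rewrite -!bdim_large; try by move=> i; apply: le_trans hT.
  by rewrite bdim_exact ?PoszD //; apply: hN.
pose n := (N + absz T)%N.
have r1 := rel n (leq_addr _ _) (leq_addl _ _).
have r2 := rel n.+1 (leqW (leq_addr _ _)) (leqW (leq_addl _ _)).
rewrite mulSn PoszD in r2.
have hn : (na + ne)%N%:Z * d%:Z = nb%:Z * d%:Z.
  rewrite PoszD; move: r1 r2; set x := (n * d)%N%:Z; move=> r1 r2.
  have : nb%:Z * d%:Z = (nb%:Z * (d%:Z + x + 1) - \sum_q b q) - (nb%:Z * (x + 1) - \sum_q b q) by ring.
  by rewrite r1 r2 => ->; ring.
have {}hn : (na + ne)%N = nb.
  by apply/eqP; move: hn => /eqP; rewrite -!PoszM eqz_nat eqn_pmul2r.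
split=> //; move: r1; rewrite -{1}hn PoszD => r1.
have -> : \sum_p a p = (na%:Z * ((n * d)%N%:Z + 1)) - (na%:Z * ((n * d)%N%:Z + 1) - \sum_p a p) by ring.
lia.
Qed.

End Numerics.

(** * Dehomogenization *)

Section Dehomogenization.
Variable k : fieldType.

Definition dehom_var (i : 'I_2) : {poly k} := if i == 0 then 1 else 'X.
Definition dehom : {mpoly k[2]} -> {poly k} := mmap (@polyC k) dehom_var.

HB.instance Definition _ := GRing.RMorphism.on dehom.

Lemma dehomX (m : 'X_{1..2}) : dehom 'X_[m] = 'X^(m 1).
Proof.
rewrite /dehom mmapX /mmap1 !big_ord_recl big_ord0 mulr1 /dehom_var /= expr1n mul1r.
by congr (_ ^+ m _); apply: val_inj.
Qed.

Lemma dehomZ c p : dehom (c *: p) = c *: dehom p.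
Proof. by rewrite /dehom mmapZ mul_polyC. Qed.

Lemma mdeg2 (m : 'X_{1..2}) : mdeg m = (m 0%R + m 1%R)%N.
Proof.
rewrite mdegE !big_ord_recl big_ord0 addn0; congr (m _ + m _)%N; exact: val_inj.
Qed.

Lemma dehom_coef t (p : {mpoly k[2]}) (m : 'X_{1..2}) :
  p \is t.-homog -> mdeg m = t -> (dehom p)`_(m 1) = p@_m.
Proof.
move=> /dhomogP hp mt; rewrite {1}(mpolyE p) raddf_sum coef_sum /=.
have zero (m' : 'X_{1..2}) : m' \in msupp p -> m' != m -> (dehom (p@_m' *: 'X_[m']))`_(m 1) = 0.
  move=> m'p m'm; rewrite dehomZ dehomX coefZ coefXn; case: eqP => [e|_]; last by rewrite mulr0.
  case/eqP: m'm; apply/mnmP => i; have := hp _ m'p; rewrite -mt /= !mdeg2 e => /addIn h.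
  by case: i => [[|[|]]] //= hi; [rewrite (_ : Ordinal hi = 0)|rewrite (_ : Ordinal hi = 1)]; try exact: val_inj.
case: (boolP (m \in msupp p)) => mp.
  rewrite (bigD1_seq m) //= ?msupp_uniq // big_seq_cond big1 => [|m' /andP[m'p m'm]].
    by rewrite addr0 dehomZ dehomX coefZ coefXn eqxx mulr1.
  exact: zero.
rewrite big_seq big1 => [|m' m'p]; first by apply/esym/eqP; rewrite mcoeff_eq0.
by apply: zero => //; apply: contraNneq mp => <-.
Qed.

Lemma dehom_inj t (p : {mpoly k[2]}) : p \is t.-homog -> dehom p = 0 -> p = 0.
Proof.
move=> hp p0; apply/mpolyP => m; rewrite mcoeff0.
case: (boolP (m \in msupp p)) => mp; last by apply/eqP; rewrite mcoeff_eq0.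
rewrite -(dehom_coef hp); first by rewrite p0 coef0.
by move/dhomogP: hp => /(_ _ mp).
Qed.

Lemma dehom_dle t (p : {mpoly k[2]}) : p \is t.-homog -> dle t%:Z (dehom p).
Proof.
move=> /dhomogP hp; rewrite (mpolyE p) raddf_sum /= big_seq; apply: dle_sum => m mp.
rewrite dehomZ dehomX; apply: dleZ; apply: dle_le (@dleX k _).
by have := hp _ mp; rewrite /= mdeg2; lia.
Qed.

Definition homog_lift t (q : {poly k}) : {mpoly k[2]} :=
  \sum_(i < t.+1) q`_i *: ('X_0 ^+ (t - i) * 'X_1 ^+ i).

Lemma homog_lift_homog t q : homog_lift t q \is t.-homog.
Proof.
apply: rpred_sum => i _; apply: rpredZ.
rewrite !mpolyXn -mpolyXD dhomogX /= mdegD !mdegMn !mdeg1 !mul1n subnK //.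
exact: ltn_ord i.
Qed.

Lemma homog_liftK t q : dle t%:Z q -> dehom (homog_lift t q) = q.
Proof.
move=> hq; rewrite raddf_sum /=; apply/polyP => j.
under eq_bigr => i _.
  have -> : dehom (q`_i *: ('X_0 ^+ (t - i) * 'X_1 ^+ i)) = q`_i *: 'X^i.
    rewrite dehomZ rmorphM !rmorphXn /= !dehomX !mnm1E /= expr0 expr1n mul1r expr1 //.
  over.
rewrite coef_sum; case: (ltnP j t.+1) => h.
  rewrite (bigD1 (Ordinal h)) //= coefZ coefXn eqxx mulr1 big1 ?addr0 // => i ij.
  rewrite coefZ coefXn; case: eqP => [e|_]; last by rewrite mulr0.
  by case/eqP: ij; apply: val_inj.
rewrite hq // big1 // => i _; rewrite coefZ coefXn; case: eqP => [e|_]; last by rewrite mulr0.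
by have := ltn_ord i; rewrite -e ltnNge h.
Qed.

Variable d : nat.

Lemma vhomog_dle l j p : vhomog d l j p -> dle (j * d%:Z + l%:Z) (dehom p).
Proof.
case: j => n /=; last by move=> /eqP ->; rewrite rmorph0; apply: dle0.
by move/dehom_dle; rewrite PoszD PoszM.
Qed.

Lemma vhomog_inj l j p : vhomog d l j p -> dehom p = 0 -> p = 0.
Proof. by case: j => n /=; [exact: dehom_inj|move=> /eqP]. Qed.

Lemma vhomog_lift l j q : (l < d)%N -> dle (j * d%:Z + l%:Z) q ->
  exists2 p, vhomog d l j p & dehom p = q.
Proof.
move=> ld; case: j => n hq; last first.
  exists 0; first exact: vhomog0.
  rewrite rmorph0 (dle_neg _ hq) //; rewrite NegzE; nia.
exists (homog_lift (n * d + l) q); first exact: homog_lift_homog.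
by apply: homog_liftK; rewrite PoszD PoszM.
Qed.

End Dehomogenization.

(** * Graded modules and maps of free modules *)

Section Graded.
Variables (k : fieldType) (d : nat).
Implicit Types M N P : gmod k d.

Lemma ghomogN M j (x : M) : ghomog j x -> ghomog j (- x).
Proof. by move=> hx; rewrite -sub0r; apply: ghomogB => //; apply: ghomog0. Qed.

Lemma ghomogD M j (x y : M) : ghomog j x -> ghomog j y -> ghomog j (x + y).
Proof. by move=> hx hy; rewrite -[y]opprK; apply: ghomogB => //; apply: ghomogN. Qed.

Lemma ghomog_sum M j (I : Type) (r : seq I) (Q : pred I) (F : I -> M) :
  (forall i, Q i -> ghomog j (F i)) -> ghomog j (\sum_(i <- r | Q i) F i).
Proof. by move=> h; elim/big_ind: _; [exact: ghomog0 | exact: ghomogD | ]. Qed.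

Lemma homog_decomp M (x : M) : exists (s : seq int) (c : int -> M),
  [/\ uniq s, forall j, ghomog j (c j) & x = \sum_(j <- s) c j].
Proof.
have [L [hL ->]] := ghomog_span x.
exists (undup [seq t.1 | t <- L]), (fun j => \sum_(t <- L | t.1 == j) t.2); split.
- exact: undup_uniq.
- move=> j; rewrite big_seq_cond; apply: ghomog_sum => t /andP[/hL h /eqP <-] //.
- rewrite [RHS](exchange_big_dep xpredT) //=; apply: eq_big_seq => t tL.
  rewrite big_mkcond (bigD1_seq t.1) ?undup_uniq ?mem_undup ?map_f //= eqxx.
  by rewrite big1 ?addr0 // => j; rewrite eq_sym => /negPf->.
Qed.

(** Take the component of degree j of any preimage. *)
Lemma homog_preimage M N (f : {linear M -> N}) j (y : N) x :
  degree0 f -> ghomog j y -> f x = y -> exists2 x', ghomog j x' & f x' = y.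
Proof.
move=> f0 hy fx; have [s [c [us hc xE]]] := homog_decomp x.
pose s' := if j \in s then s else j :: s.
have us' : uniq s' by rewrite /s'; case: ifP => //= ->.
have js' : j \in s' by rewrite /s'; case: ifP => //; rewrite inE eqxx.
pose c' i := if i \in s then c i else 0.
have hc' i : ghomog i (c' i) by rewrite /c'; case: ifP => // _; apply: ghomog0.
have xE' : x = \sum_(i <- s') c' i.
  have -> : x = \sum_(i <- s) c' i by rewrite xE; apply: eq_big_seq => i; rewrite /c' => ->.
  by rewrite /s'; case: ifP => // js; rewrite big_cons /c' js add0r.
exists (c' j) => //; apply/eqP; rewrite -subr_eq0; apply/eqP.
have := @ghomog_direct _ _ N s' (fun i => f (c' i) - (if i == j then y else 0)) us'.
move=> /(_ _ _ j js'); rewrite eqxx; apply.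
- move=> i; apply: ghomogB; first exact: f0.
  by case: eqP => [->|_] //; apply: ghomog0.
- rewrite sumrB (_ : \sum_(i <- s') f (c' i) = y); last by rewrite -[LHS](raddf_sum f) -xE'.
  rewrite (bigD1_seq j) //= eqxx big1 ?addr0 ?subrr //.
  by move=> i /negPf ->.
Qed.

Lemma homog_kernel M N (f : {linear M -> N}) s (c : int -> M) :
  degree0 f -> uniq s -> (forall j, ghomog j (c j)) -> f (\sum_(j <- s) c j) = 0 ->
  forall j, j \in s -> f (c j) = 0.
Proof.
move=> f0 us hc fz j js.
by apply: (ghomog_direct us (c := fun j => f (c j))) => //; [move=> i; apply: f0|rewrite -raddf_sum].
Qed.

(** The kernel of a graded map is graded, so exactness may be tested on
    homogeneous elements. *)
Lemma graded_exact M N P (g : {linear M -> N}) (f : {linear N -> P}) :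
  degree0 f -> (forall x, f (g x) = 0) ->
  (forall j x, ghomog j x -> f x = 0 -> exists y, g y = x) -> exact_at g f.
Proof.
move=> f0 fg h x; split=> [fx|[y <-]]; last exact: fg.
have [s [c [us hc xE]]] := homog_decomp x; rewrite xE in fx *.
have hk := homog_kernel f0 us hc fx; rewrite big_seq.
elim/big_ind: _ => [|u v [y1 <-] [y2 <-]|j js]; first by exists 0; rewrite raddf0.
- by exists (y1 + y2); rewrite raddfD.
- by apply: h (hc j) _; apply: hk.
Qed.

Hypothesis d_gt0 : (0 < d)%N.
Local Notation B := (vring k d).
Local Notation free := (gfree k d_gt0).

Section Free.
Variables (n : nat) (a : 'I_n -> int).
Implicit Types v w : free a.

Lemma gfreeD v w p : (v + w) p = v p + w p. Proof. by rewrite ffunE. Qed.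
Lemma gfreeZ (b : B) v p : (b *: v) p = b * (v p : B) :> B. Proof. by rewrite ffunE. Qed.

Lemma gfree_sum (I : Type) (r : seq I) (Q : pred I) (F : I -> free a) p :
  (\sum_(i <- r | Q i) F i) p = \sum_(i <- r | Q i) F i p.
Proof. by rewrite sum_ffunE. Qed.

Lemma gbasisE p q : (gbasis k d_gt0 a p) q = (p == q)%:R :> B.
Proof. by rewrite ffunE. Qed.

Lemma gbasis_homog p : ghomog (a p) (gbasis k d_gt0 a p).
Proof.
move=> q /=; rewrite ffunE; case: eqP => [->|_]; last exact: vhomog0.
by rewrite addrC subrr /= dhomog1.
Qed.

Lemma gfree_expand v : v = \sum_p (v p : B) *: gbasis k d_gt0 a p.
Proof.
apply/ffunP => q; rewrite gfree_sum.
have E p : ((v p : B) *: gbasis k d_gt0 a p) q = if p == q then v p : B else 0 :> B.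
  by rewrite gfreeZ gbasisE; case: (p == q); rewrite ?mulr1 ?mulr0.
rewrite (eq_bigr _ (fun p _ => E p)) -big_mkcond; symmetry; exact: big_pred1_eq.
Qed.

Lemma free_lift N (y : 'I_n -> N) : (forall p, ghomog (a p) (y p)) ->
  exists f : {linear free a -> N},
    degree0 f /\ forall v, f v = \sum_p (v p : B) *: y p.
Proof.
move=> hy; pose f (v : free a) : N := \sum_p (v p : B) *: y p.
have fL : linear f.
  move=> b v w; rewrite /f scaler_sumr -big_split; apply: eq_bigr => p _.
  by rewrite gfreeD gfreeZ scalerDl scalerA.
exists (HB.pack f (GRing.isLinear.Build B (free a) N *:%R f fL) : {linear free a -> N}).
split=> // j v hv; apply: ghomog_sum => p _.
have -> : j = (- a p + j) + a p by lia.
by apply: ghomogZ (hy p); apply: hv.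
Qed.

Lemma gfree_mapE N (f : {linear free a -> N}) v :
  f v = \sum_p (v p : B) *: f (gbasis k d_gt0 a p).
Proof. by rewrite {1}[v]gfree_expand linear_sum; apply: eq_bigr => p _; apply: linearZ. Qed.

(** Graded free modules are projective. *)
Lemma free_factor N P (g : {linear N -> P}) (h : {linear free a -> P}) :
  degree0 g -> degree0 h -> (forall x, exists y, g y = h x) ->
  exists f : {linear free a -> N}, degree0 f /\ forall x, g (f x) = h x.
Proof.
move=> g0 h0 im; have /fin_all_exists2 [y hy gy] : forall p, exists2 y, ghomog (a p) y & g y = h (gbasis k d_gt0 a p).
  move=> p; have [y gy] := im (gbasis k d_gt0 a p).
  by apply: homog_preimage gy => //; apply: h0; apply: gbasis_homog.
have [f [f0 fE]] := free_lift hy; exists f; split=> // x.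
rewrite fE linear_sum (gfree_mapE h); apply: eq_bigr => p _.
by rewrite -gy; apply: linearZ.
Qed.

Definition dvec v : 'rV[{poly k}]_n := \row_p dehom (val (v p : B)).

Lemma dvecD v w : dvec (v + w) = dvec v + dvec w.
Proof. by apply/rowP => p; rewrite !mxE gfreeD raddfD. Qed.

Lemma dvecZ (b : B) v : dvec (b *: v) = dehom (val b) *: dvec v.
Proof. by apply/rowP => p; rewrite !mxE gfreeZ rmorphM. Qed.

Lemma dvec0 : dvec 0 = 0.
Proof. by apply/rowP => p; rewrite !mxE ffunE raddf0. Qed.

Lemma dvec_sum (I : Type) (r : seq I) (Q : pred I) (F : I -> free a) :
  dvec (\sum_(i <- r | Q i) F i) = \sum_(i <- r | Q i) dvec (F i).
Proof. exact: (big_morph dvec dvecD dvec0). Qed.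

Lemma dvec_box j v : ghomog j v -> box (fun p => j * d%:Z - a p * d%:Z) (dvec v).
Proof.
move=> hv p; rewrite mxE; have := vhomog_dle (hv p); rewrite addr0.
by have -> : (- a p + j) * d%:Z = j * d%:Z - a p * d%:Z by ring.
Qed.

Lemma dvec_inj j v : ghomog j v -> dvec v = 0 -> v = 0.
Proof.
move=> hv /rowP v0; apply/ffunP => p; rewrite ffunE; apply: val_inj.
by apply: (vhomog_inj (hv p)); have := v0 p; rewrite !mxE.
Qed.

Lemma vring_lift j q : dle (j * d%:Z) q ->
  exists2 b : B, vhomog d 0 j (val b) & dehom (val b) = q.
Proof.
rewrite -[j * _]addr0 => /(vhomog_lift d_gt0) [p hp pq].
have pB : p \in vdeg_pred k d 0.
  by case: j hp => m hp; [apply: vhomog_vdeg hp|rewrite (eqP hp) rpred0].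
by exists (VRing pB).
Qed.

Lemma dvec_lift j (w : 'rV[{poly k}]_n) : box (fun p => j * d%:Z - a p * d%:Z) w ->
  exists2 v : free a, ghomog j v & dvec v = w.
Proof.
move=> hw; have /fin_all_exists2 [b hb bE] : forall p, exists2 b : B, vhomog d 0 (- a p + j) (val b) & dehom (val b) = w 0 p.
  move=> p; apply: vring_lift; have -> : (- a p + j) * d%:Z = j * d%:Z - a p * d%:Z by ring.
  exact: hw.
exists [ffun p => b p]; first by move=> p /=; rewrite ffunE.
by apply/rowP => p; rewrite mxE ffunE bE.
Qed.

End Free.

Section Matrix.
Variables (n m : nat) (b : 'I_n -> int) (a : 'I_m -> int).

(** The matrix of a map of graded free modules after dehomogenization. *)
Definition dmx (f : free b -> free a) : 'M[{poly k}]_(n, m) :=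
  \matrix_p dvec (f (gbasis k d_gt0 b p)).

Lemma dvec_map (f : {linear free b -> free a}) v : dvec (f v) = dvec v *m dmx f.
Proof.
rewrite gfree_mapE dvec_sum mulmx_sum_row; apply: eq_bigr => p _.
by rewrite dvecZ rowK mxE.
Qed.

Lemma dmx_box (f : {linear free b -> free a}) : degree0 f ->
  forall p, box (fun q => b p * d%:Z - a q * d%:Z) (row p (dmx f)).
Proof. by move=> f0 p; rewrite rowK; apply: dvec_box; apply: f0; apply: gbasis_homog. Qed.

Lemma dmx_lift (A : 'M[{poly k}]_(n, m)) :
  (forall p, box (fun q => b p * d%:Z - a q * d%:Z) (row p A)) ->
  exists f : {linear free b -> free a}, degree0 f /\ dmx f = A.
Proof.
move=> hA; have /fin_all_exists2 [y hy yE] := fun p => dvec_lift (hA p).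
have [f [f0 fE]] := free_lift hy; exists f; split=> //; apply/row_matrixP => p.
rewrite rowK fE dvec_sum -yE.
have E q : dvec (((gbasis k d_gt0 b p) q : B) *: y q) = if q == p then dvec (y q) else 0.
  by rewrite dvecZ gbasisE eq_sym; case: (q == p); rewrite ?rmorph1 ?scale1r ?rmorph0 ?scale0r.
by rewrite (eq_bigr _ (fun q _ => E q)) -big_mkcond; apply: big_pred1_eq.
Qed.
End Matrix.

(** Exactness can be checked after dehomogenization, degree by degree. *)
Lemma exact_dmx n1 n2 n3 (c : 'I_n1 -> int) (b : 'I_n2 -> int) (a : 'I_n3 -> int)
  (g : {linear free c -> free b}) (f : {linear free b -> free a}) :
  degree0 g -> degree0 f -> dmx g *m dmx f = 0 ->
  (forall (j : int) v, box (fun p => j * d%:Z - b p * d%:Z) v -> v *m dmx f = 0 ->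
     exists2 w, box (fun p => j * d%:Z - c p * d%:Z) w & v = w *m dmx g) ->
  exact_at g f.
Proof.
move=> g0 f0 gf h; apply: graded_exact => // [x|j x hx fx].
  rewrite (gfree_mapE g) linear_sum big1 // => p _.
  suff fg : f (g (gbasis k d_gt0 c p)) = 0.
    transitivity ((x p : B) *: f (g (gbasis k d_gt0 c p))); first exact: linearZ.
    by rewrite fg scaler0.
  apply: (@dvec_inj _ _ (c p)); first by apply/f0/g0/gbasis_homog.
  by rewrite dvec_map -[dvec _](rowK (fun p => dvec (g (gbasis k d_gt0 c p)))) -row_mul gf row0.
have [||w hw wE] := h j (dvec x); first exact: dvec_box.
  by rewrite -dvec_map fx dvec0.
have [y hy yE] := dvec_lift hw; exists y; apply/eqP; rewrite -subr_eq0; apply/eqP.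
apply: (@dvec_inj _ _ j); first by apply: ghomogB => //; apply: g0.
by rewrite -scaleN1r dvecD dvecZ rmorphN1 scaleN1r dvec_map yE -wE subrr.
Qed.

End Graded.

(** * Minimal covers and finitely generated kernels *)

Section Covers.
Variables (k : fieldType) (d : nat).
Implicit Types M N P : gmod k d.
Hypothesis d_gt0 : (0 < d)%N.
Local Notation B := (vring k d).
Local Notation free := (gfree k d_gt0).

Definition fg_kernel N P (g : N -> P) := exists (n : nat) (x : 'I_n -> N),
  (forall i, g (x i) = 0) /\
  forall y, g y = 0 -> exists b : 'I_n -> B, y = \sum_i b i *: x i.

Definition homog_gens N P (g : N -> P) n := exists (a : 'I_n -> int) (x : 'I_n -> N),
  [/\ forall i, ghomog (a i) (x i), forall i, g (x i) = 0 &
  forall y, g y = 0 -> exists b : 'I_n -> B, y = \sum_i b i *: x i].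

Lemma homog_gens_exist N P (g : {linear N -> P}) : degree0 g -> fg_kernel g ->
  exists n, homog_gens g n.
Proof.
move=> g0 [n [x [gx xgen]]].
have /fin_all_exists [s /fin_all_exists [c hc]] := fun i => homog_decomp (x i).
pose T := {i : 'I_n & 'I_(size (s i))}.
pose e (t : T) := (s (tag t))`_(tagged t).
exists #|{: T}|, (fun j => e (enum_val j)), (fun j => c (tag (enum_val j : T)) (e (enum_val j))); split.
- by move=> j; have [_ h _] := hc (tag (enum_val j : T)); apply: h.
- move=> j; have [us h xE] := hc (tag (enum_val j : T)).
  by apply: (homog_kernel g0 us h); rewrite -?xE // mem_nth.
move=> y /xgen [b ->]; exists (fun j => b (tag (enum_val j : T))).
rewrite -(big_enum_val (A := {: T}) (fun t : T => b (tag t) *: c (tag t) (e t))) /=.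
rewrite (eq_bigr (fun i => \sum_(j < size (s i)) b i *: c i (s i)`_j)) => [|i _].
  by rewrite sig_big_dep.
have [us h xE] := hc i.
by rewrite {1}xE (big_nth 0) big_mkord scaler_sumr.
Qed.

Fact vconst_proof (c : k) : c%:MP \in vdeg_pred k d 0.
Proof.
apply: (@vhomog_vdeg k d 0 0); rewrite -[c%:MP]mulr1 mul_mpolyC /= addn0.
by apply: rpredZ; apply: dhomog1.
Qed.
Definition vconst (c : k) : B := VRing (vconst_proof c).

Lemma degree0_const (b : B) : vhomog d 0 0 (val b) -> b = vconst (val b)@_0%MM.
Proof.
move=> /= /dhomogP hb; apply: val_inj => /=; apply/mpolyP => m; rewrite mcoeffC.
case: eqP => [<-|m0]; first by rewrite mulr1.
rewrite mulr0; case: (boolP (m \in msupp (val b))) => [/hb /eqP|h]; last by apply/eqP; rewrite mcoeff_eq0.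
by rewrite mdeg_eq0 => /eqP h; case: m0.
Qed.

(** B is the field k in degree 0. *)
Lemma degree0_unit (b : B) : vhomog d 0 0 (val b) -> b <> 0 -> exists u : B, u * b = 1.
Proof.
move=> /degree0_const bE bz; exists (vconst ((val b)@_0%MM)^-1).
have c0 : (val b)@_0%MM != 0.
  by apply/eqP => c0; apply: bz; rewrite bE c0; apply: val_inj; rewrite /= mpolyC0.
by rewrite {2}bE; apply: val_inj; rewrite /= -mpolyCM mulVf.
Qed.

(** Take a homogeneous generating family with the least number of elements: a
    relation with a unit coefficient would allow to remove an element. *)
Lemma min_cover N P (g : {linear N -> P}) : degree0 g -> fg_kernel g ->
  exists n (a : 'I_n -> int) (f : {linear free a -> N}),
  [/\ degree0 f, exact_at f g &
      forall j v, ghomog j v -> f v = 0 -> forall p, a p = j -> v p = 0].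
Proof.
move=> g0 /(homog_gens_exist g0) [n0 /nat_least [n [a [x [hx gx xgen]]] hmin]].
have [f [f0 fE]] := free_lift d_gt0 hx.
exists n, a, f; split=> // [y|j v hv fv p ap].
  split=> [/xgen [b ->]|[v <-]]; last first.
    rewrite fE linear_sum big1 // => i _; transitivity ((v i : B) *: g (x i)); first exact: linearZ.
    by rewrite gx scaler0.
  by exists [ffun i => b i]; rewrite fE; apply: eq_bigr => i _; rewrite ffunE.
apply: NNPP => vp.
have [u uE] : exists u : B, u * (v p : B) = 1.
  apply: degree0_unit vp; have := hv p; by rewrite ap addNr.
case: n => [|n] in a x hx gx xgen hmin f f0 fE v hv fv p ap vp u uE *; first by case: p {ap vp uE}.
apply: (hmin n (ltnSn n)).
exists (fun i => a (lift p i)), (fun i => x (lift p i)); split=> // y /xgen [b ->].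
exists (fun i => b (lift p i) - b p * u * (v (lift p i) : B)).
rewrite (bigD1_ord p) //=.
have -> : x p = - \sum_i (u * (v (lift p i) : B)) *: x (lift p i).
  move/(congr1 (fun z => u *: z)): fv; rewrite fE (bigD1_ord p) //= scaler0 scalerDr scalerA uE scale1r.
  move/eqP; rewrite addr_eq0 => /eqP ->; rewrite scaler_sumr; congr (- _).
  by apply: eq_bigr => i _; rewrite scalerA.
rewrite scalerN scaler_sumr -sumrN -big_split; apply: eq_bigr => i _ /=.
by rewrite scalerBl scalerA mulrA addrC.
Qed.

Lemma scaleB_linear N P (u : {linear P -> N}) (b : B) x y :
  b *: x - u (b *: y) = b *: (x - u y).
Proof. by rewrite linearZ scalerBr. Qed.

(** Schanuel's lemma in explicit form: if u and v lift the identity of M between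
    the given cover and the one in a resolution F, the kernel is generated by the
    image under u of the first syzygies of F and by the elements e - u (v e). *)
Lemma fg_kernel_cover M n (a : 'I_n -> int) (f0 : {linear free a -> M}) (F : free_res d_gt0 M) :
  degree0 f0 -> surjective_map f0 -> fg_kernel f0.
Proof.
move=> df0 sf0.
have [u [_ uE]] := free_factor df0 (@fr_aug_degree0 _ _ _ _ F) (fun x => sf0 (fr_aug F x)).
have [v [_ vE]] := free_factor (@fr_aug_degree0 _ _ _ _ F) df0 (fun x => @fr_aug_surj _ _ _ _ F (f0 x)).
pose x (i : 'I_(fr_rank F 1 + n)) : free a := match split i with
  | inl i => u (fr_diff F 0 (gbasis k d_gt0 _ i))
  | inr p => gbasis k d_gt0 _ p - u (v (gbasis k d_gt0 _ p)) end.
exists _, x; split=> [i|y fy].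
  rewrite /x; case: (split i) => j.
    by rewrite uE; apply/fr_exact0; eexists.
  by rewrite raddfB /= uE vE subrr.
have [z zE] : exists z, fr_diff F 0 z = v y by apply/fr_exact0; rewrite vE.
exists (fun i => match split i with inl i => z i : B | inr p => y p : B end).
rewrite big_split_ord /=.
transitivity (u (v y) + (y - u (v y))); first by rewrite addrC subrK.
congr (_ + _).
  rewrite -zE (gfree_mapE (fr_diff F 0)) linear_sum; apply: eq_bigr => i _.
  rewrite /x (unsplitK (inl i)); exact: linearZ.
rewrite {1}[y]gfree_expand (gfree_mapE v) linear_sum -sumrB; apply: eq_bigr => i _.
rewrite /x (unsplitK (inr i)).
exact (scaleB_linear u (y i : B) (gbasis k d_gt0 a i) (v (gbasis k d_gt0 a i))).
Qed.

End Covers.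

(** * Independence of Tor from the resolution *)

Section Comparison.
Variables (k : fieldType) (d : nat).
Implicit Types M N P : gmod k d.
Hypothesis d_gt0 : (0 < d)%N.
Local Notation B := (vring k d).
Local Notation free := (gfree k d_gt0).

Definition cst (x : B) : k := (val x)@_0%MM.

Lemma cstD x y : cst (x + y) = cst x + cst y. Proof. exact: mcoeffD. Qed.
Lemma cst0 : cst 0 = 0. Proof. exact: mcoeff0. Qed.
Lemma cst1 : cst 1 = 1. Proof. by rewrite /cst /= mcoeff1 eqxx. Qed.
Lemma cstM x y : cst (x * y) = cst x * cst y. Proof. exact: (rmorphM (mcoeff 0%MM)). Qed.
Lemma cst_sum (I : Type) (r : seq I) (Q : pred I) (F : I -> B) :
  cst (\sum_(i <- r | Q i) F i) = \sum_(i <- r | Q i) cst (F i).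
Proof. exact: (big_morph cst cstD cst0). Qed.

Lemma cst_homog j (x : B) : vhomog d 0 j (val x) -> j != 0 -> cst x = 0.
Proof.
case: j => j /= hx j0; last by rewrite (_ : x = 0) ?cst0 //; apply: val_inj; exact/eqP.
apply/eqP; rewrite mcoeff_eq0; apply/negP => /(dhomogP _ _ _ hx) /=.
by rewrite mdeg0 addn0 => /esym/eqP; rewrite muln_eq0 (gtn_eqF d_gt0) orbF -eqz_nat (negPf j0).
Qed.

Section ConstantTerms.
Variables (n m : nat) (b : 'I_n -> int) (a : 'I_m -> int).
(** The matrix of k (x) f, for a map f of free modules. *)
Definition cmx (f : free b -> free a) : 'M[k]_(n, m) :=
  \matrix_(p, q) cst (f (gbasis k d_gt0 b p) q : B).
End ConstantTerms.

Lemma cmx_comp n1 n2 n3 (c : 'I_n1 -> int) (b : 'I_n2 -> int) (a : 'I_n3 -> int)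
  (g : free c -> free b) (f : {linear free b -> free a}) (h : free c -> free a) :
  (forall x, h x = f (g x)) -> cmx h = cmx g *m cmx f.
Proof.
move=> hE; apply/matrixP => p q; rewrite [LHS]mxE [RHS]mxE hE (gfree_mapE f) gfree_sum cst_sum.
by apply: eq_bigr => r _; rewrite gfreeZ cstM [cmx g p r]mxE [cmx f r q]mxE.
Qed.

Lemma cmx_zero n1 n2 (c : 'I_n1 -> int) (b : 'I_n2 -> int) (h : free c -> free b) :
  (forall x, h x = 0) -> cmx h = 0.
Proof. by move=> h0; apply/matrixP => p q; rewrite !mxE h0 ffunE cst0. Qed.

Lemma cmx_homotopy n (c : 'I_n -> int) (h f g : free c -> free c) :
  (forall x, h x = x + f x + g x) -> cmx h = 1%:M + cmx f + cmx g.
Proof.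
move=> hE; apply/matrixP => p q.
rewrite [LHS]mxE hE !gfreeD !cstD [RHS]mxE [in RHS]mxE [cmx f p q]mxE [cmx g p q]mxE.
by congr (_ + _ + _); rewrite gbasisE !mxE; case: (p == q); rewrite ?cst1 ?cst0.
Qed.

Lemma cmx_degree n m (b : 'I_n -> int) (a : 'I_m -> int) (f : free b -> free a) p q :
  degree0 f -> b p != a q -> cmx f p q = 0.
Proof.
move=> f0 ba; rewrite mxE; apply: (@cst_homog (- a q + b p)).
  exact (f0 (b p) (gbasis k d_gt0 b p) (@gbasis_homog k d d_gt0 n b p) q).
by rewrite addrC subr_eq0.
Qed.

Definition part n (a : 'I_n -> int) (j : int) : 'M[k]_n :=
  diag_mx (\row_p (a p == j)%:R).

Lemma cmx_part n m (b : 'I_n -> int) (a : 'I_m -> int) (f : free b -> free a) j :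
  degree0 f -> part b j *m cmx f = cmx f *m part a j.
Proof.
move=> f0; apply/matrixP => p q; rewrite /part mul_diag_mx mul_mx_diag.
rewrite [LHS]mxE [RHS]mxE ![(\row_p _) _ _]mxE.
case: (eqVneq (b p) (a q)) => [->|ba]; first by rewrite mulrC.
by rewrite (cmx_degree f0 ba) mulr0 mul0r.
Qed.

(** The comparison theorem.  The next map is built from the previous one by
    projectivity, so the recursion carries along the fact that the previous map
    sends boundaries to boundaries. *)
Lemma chain_map M (F G : free_res d_gt0 M) :
  exists phi : forall i, {linear free (fr_deg (f := F) (i := i)) -> free (fr_deg (f := G) (i := i))},
  [/\ forall i, degree0 (phi i), forall x, fr_aug G (phi 0%N x) = fr_aug F x &
      forall i x, fr_diff G i (phi i.+1 x) = phi i (fr_diff F i x)].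
Proof.
pose T i := {f : {linear free (fr_deg (f := F) (i := i)) -> free (fr_deg (f := G) (i := i))} |
   degree0 f /\ forall x, exists y, fr_diff G i y = f (fr_diff F i x)}.
have [f0 [df0 f0E]] := free_factor (@fr_aug_degree0 _ _ _ _ G) (@fr_aug_degree0 _ _ _ _ F)
   (fun x => @fr_aug_surj _ _ _ _ G (fr_aug F x)).
have t0P : degree0 f0 /\ forall x, exists y, fr_diff G 0 y = f0 (fr_diff F 0 x).
  split=> // x; apply/fr_exact0; rewrite f0E; apply/fr_exact0; by exists x.
have step i (t : T i) : {u : T i.+1 | forall x, fr_diff G i (sval u x) = sval t (fr_diff F i x)}.
  apply: constructive_indefinite_description; case: t => f [df fim] /=.
  have dh : degree0 (f \o fr_diff F i) by move=> j x hx; apply/df/fr_diff_degree0.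
  have [g [dg gE]] := free_factor (@fr_diff_degree0 _ _ _ _ G i) dh fim.
  suff gP : degree0 g /\ forall x, exists y, fr_diff G i.+1 y = g (fr_diff F i.+1 x).
    by exists (exist _ g gP).
  split=> // x; apply/fr_exact; rewrite gE /=.
  have -> : fr_diff F i (fr_diff F i.+1 x) = 0 by apply/fr_exact; exists x.
  exact: raddf0.
pose t := fix t i : T i := match i with 0%N => exist _ f0 t0P | i'.+1 => sval (step i' (t i')) end.
exists (fun i => sval (t i)); split=> //.
- by move=> i; have [] := svalP (t i).
- by move=> i x; apply: (svalP (step i (t i))).
Qed.

(** Uniqueness part of the comparison theorem, by the same recursion. *)
Lemma homotopy M (F : free_res d_gt0 M)
  (phi : forall i, {linear free (fr_deg (f := F) (i := i)) -> free (fr_deg (f := F) (i := i))}) :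
  (forall i, degree0 (phi i)) -> (forall x, fr_aug F (phi 0%N x) = fr_aug F x) ->
  (forall i x, fr_diff F i (phi i.+1 x) = phi i (fr_diff F i x)) ->
  exists h : forall i, {linear free (fr_deg (f := F) (i := i)) -> free (fr_deg (f := F) (i := i.+1))},
  [/\ forall i, degree0 (h i), forall x, phi 0%N x = x + fr_diff F 0 (h 0%N x) &
   forall i x, phi i.+1 x = x + fr_diff F i.+1 (h i.+1 x) + h i (fr_diff F i x)].
Proof.
move=> dphi aphi cphi.
have dd i x : fr_diff F i (fr_diff F i.+1 x) = 0 by apply/fr_exact; exists x.
pose T i := {f : {linear free (fr_deg (f := F) (i := i)) -> free (fr_deg (f := F) (i := i.+1))} |
   degree0 f /\ forall x, fr_diff F i (f (fr_diff F i x)) = phi i (fr_diff F i x) - fr_diff F i x}.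
have dth i : degree0 (phi i \- idfun).
  by move=> j x hx; apply: ghomogB => //; apply: dphi.
have im0 x : exists y, fr_diff F 0 y = (phi 0%N \- idfun) x.
  by apply/fr_exact0; rewrite raddfB /= aphi subrr.
have [f0 [df0 f0E]] := free_factor (@fr_diff_degree0 _ _ _ _ F 0) (dth 0%N) im0.
have t0P : degree0 f0 /\ forall x, fr_diff F 0 (f0 (fr_diff F 0 x)) = phi 0%N (fr_diff F 0 x) - fr_diff F 0 x.
  by split=> // x; rewrite f0E.
have step i (t : T i) : {u : T i.+1 | forall x, fr_diff F i.+1 (sval u x) = phi i.+1 x - x - sval t (fr_diff F i x)}.
  apply: constructive_indefinite_description; case: t => f [df fE] /=.
  have dh : degree0 ((phi i.+1 \- idfun) \- (f \o fr_diff F i)).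
    by move=> j x hx; apply: ghomogB; [apply: dth|apply/df/fr_diff_degree0].
  have im x : exists y, fr_diff F i.+1 y = ((phi i.+1 \- idfun) \- (f \o fr_diff F i)) x.
    by apply/fr_exact; rewrite !raddfB /= cphi fE subrr.
  have [g [dg gE]] := free_factor (@fr_diff_degree0 _ _ _ _ F i.+1) dh im.
  suff gP : degree0 g /\ forall x, fr_diff F i.+1 (g (fr_diff F i.+1 x)) = phi i.+1 (fr_diff F i.+1 x) - fr_diff F i.+1 x.
    by exists (exist _ g gP).
  by split=> // x; rewrite gE /= dd raddf0 subr0.
pose t := fix t i : T i := match i with 0%N => exist _ f0 t0P | i'.+1 => sval (step i' (t i')) end.
exists (fun i => sval (t i)); split=> //.
- by move=> i; have [] := svalP (t i).
- by move=> x; rewrite /= f0E /= addrC subrK.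
- move=> i x; have -> : fr_diff F i.+1 (sval (t i.+1) x) = _ := svalP (step i (t i)) x.
  by rewrite -[RHS]addrA subrK addrC subrK.
Qed.

(** If g \o f is the identity on homology, f is injective on homology. *)
Lemma rank_homology (n0 n1 m0 m1 : nat) (ZF : 'M[k]_n0) (BF : 'M[k]_(n1, n0))
  (ZG : 'M[k]_m0) (BG : 'M[k]_(m1, m0)) (f : 'M[k]_(n0, m0)) (g : 'M[k]_(m0, n0)) :
  (BG <= ZG)%MS -> (ZF *m f <= ZG)%MS -> (BG *m g <= BF)%MS ->
  (forall v : 'rV_n0, (v <= ZF)%MS -> (v *m f *m g - v <= BF)%MS) ->
  (\rank ZF - \rank BF <= \rank ZG - \rank BG)%N.
Proof.
move=> BZG fZ gB fg.
pose C := (ZG :\: BG)%MS.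
have rC : \rank C = (\rank ZG - \rank BG)%N.
  have /eqmxP/eqmx_rank e := capmx_idPr BZG.
  by have := mxrank_cap_compl ZG BG; rewrite e -/C => <-; rewrite addKn.
have ZC : (ZG <= BG + C)%MS.
  have : (ZG <= ZG :\: BG + ZG :&: BG)%MS by rewrite addsmx_diff_cap_eq.
  by move/submx_trans; apply; rewrite addsmxC; apply: addsmxS => //; apply: capmxSr.
have sub : (ZF <= BF + C *m g)%MS.
  apply/rV_subP => v vZ.
  have -> : v = v *m f *m g - (v *m f *m g - v) by rewrite opprB addrC subrK.
  apply: addmx_sub; last by rewrite -scaleN1r scalemx_sub // (submx_trans (fg v vZ)) // addsmxSl.
  have : (v *m f <= BG + C)%MS by apply: submx_trans ZC; apply: submx_trans fZ; apply: submxMr.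
  move/(submxMr g)/submx_trans; apply; rewrite addsmxMr.
  by apply: addsmxS.
rewrite leq_subLR -rC; apply: leq_trans (mxrankS sub) _.
apply: leq_trans (mxrank_adds_leqif _ _).1 _; rewrite leq_add2l; exact: mxrankM_maxl.
Qed.

Lemma tor_diffE M (F : free_res d_gt0 M) i : tor_diff F i = cmx (fr_diff F i).
Proof. by []. Qed.

Lemma tor_partE M (F : free_res d_gt0 M) i j : tor_part F i j = part (fr_deg (f := F) (i := i)) j.
Proof. by []. Qed.

Lemma boundaries_cycles M (F : free_res d_gt0 M) i j :
  (tor_boundaries F i j <= tor_cycles F i j)%MS.
Proof.
have hE : tor_boundaries F i j = tor_diff F i *m tor_part F i j.
  by apply: cmx_part; apply: fr_diff_degree0.
rewrite hE; case: i {hE} => [|i] /=; first exact: submxMl.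
rewrite sub_capmx submxMl /=; apply/sub_kermxP; rewrite -mulmxA.
have -> : tor_part F i.+1 j *m tor_diff F i = tor_diff F i *m tor_part F i j.
  by apply: cmx_part; apply: fr_diff_degree0.
rewrite mulmxA !tor_diffE -(cmx_comp (h := fr_diff F i \o fr_diff F i.+1)) //.
by rewrite cmx_zero ?mul0mx // => x; apply/fr_exact; exists x.
Qed.

(** Apply k (x) - to a chain map from F to G and one back, whose composite is
    homotopic to the identity. *)
Lemma tor_dim_le M (F G : free_res d_gt0 M) i j : (tor_dim F i j <= tor_dim G i j)%N.
Proof.
have [phi [dphi aphi cphi]] := chain_map F G.
have [psi [dpsi apsi cpsi]] := chain_map G F.
have dc i' : degree0 (psi i' \o phi i') by move=> ? ? h; apply/dpsi/dphi.
have ac x : fr_aug F ((psi 0%N \o phi 0%N) x) = fr_aug F x by rewrite /= apsi aphi.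
have cc i' x : fr_diff F i' ((psi i'.+1 \o phi i'.+1) x) = (psi i' \o phi i') (fr_diff F i' x).
  by rewrite /= cpsi cphi.
have [h [dh h0 hS]] := @homotopy M F (fun i => (psi i \o phi i)) dc ac cc.
have comm (X Y : free_res d_gt0 M) (f : forall i, {linear free (fr_deg (f := X) (i := i)) -> free (fr_deg (f := Y) (i := i))}) i' :
    (forall i x, fr_diff Y i (f i.+1 x) = f i (fr_diff X i x)) ->
    tor_diff X i' *m cmx (f i') = cmx (f i'.+1) *m tor_diff Y i'.
  move=> cf; rewrite !tor_diffE -(cmx_comp (h := f i' \o fr_diff X i')) //.
  by apply: cmx_comp => x; rewrite cf.
have bnd (v : 'rV_(fr_rank F i)) : (v <= tor_part F i j)%MS ->
    (v *m cmx (h i) *m tor_diff F i <= tor_boundaries F i j)%MS.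
  case/submxP => D ->; rewrite -!mulmxA; apply: mulmx_sub.
  by rewrite /tor_boundaries !mulmxA tor_partE cmx_part // -mulmxA submxMl.
apply: (@rank_homology _ _ _ _ _ _ _ _ (cmx (phi i)) (cmx (psi i))).
- exact: boundaries_cycles.
- case: i {bnd} => [|i] /=; first by rewrite !tor_partE cmx_part // submxMl.
  rewrite sub_capmx; apply/andP; split.
    apply: submx_trans (submxMr _ (capmxSl _ _)) _.
    by rewrite !tor_partE cmx_part // submxMl.
  apply/sub_kermxP; rewrite -mulmxA -comm // mulmxA.
  by rewrite (sub_kermxP (capmxSr _ _)) mul0mx.
- rewrite /tor_boundaries -mulmxA comm // mulmxA !tor_partE cmx_part // -mulmxA; exact: submxMl.
- move=> v vZ; rewrite -mulmxA -(cmx_comp (h := psi i \o phi i)) //.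
  have vP : (v <= tor_part F i j)%MS.
    by case: i v vZ {bnd} => [|i] v //= h'; apply: submx_trans h' (capmxSl _ _).
  have := bnd v vP; case: i v vZ {vP bnd} => [|i] v vZ.
    rewrite (@cmx_homotopy _ _ (psi 0%N \o phi 0%N) (fr_diff F 0 \o h 0%N) (fun=> 0)).
      rewrite [cmx (fun=> 0)]cmx_zero // addr0 mulmxDr mulmx1 addrC addKr.
      by rewrite (cmx_comp (g := h 0%N) (f := fr_diff F 0)) // mulmxA.
    by move=> x; rewrite addr0; apply: h0.
  rewrite (cmx_homotopy (hS i)) !mulmxDr mulmx1 addrC addrA addKr.
  rewrite (cmx_comp (h := fun x => fr_diff F i.+1 _) (g := h i.+1) (f := fr_diff F i.+1)) // mulmxA.
  rewrite (cmx_comp (h := fun x => h i _) (g := fr_diff F i) (f := h i)) // mulmxA.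
  have -> : v *m cmx (fr_diff F i) = 0; last by rewrite mul0mx addr0.
  by apply/sub_kermxP; apply: submx_trans vZ (capmxSr _ _).
Qed.

Lemma tor_dim_unique M (F G : free_res d_gt0 M) i j : tor_dim F i j = tor_dim G i j.
Proof. by apply/eqP; rewrite eqn_leq !tor_dim_le. Qed.

End Comparison.

(** * Linear resolutions of sums of Veronese modules *)

Section LinearResolution.
Variable k : fieldType.

(** The monomials z^i with i <= l generate M^(l) over B. *)
Lemma split_poly l (c : int) (f : {poly k}) : 0 <= c -> dle (c + l%:Z) f ->
  exists2 w : nat -> {poly k}, forall i, dle c (w i) & f = \sum_(i < l.+1) w i * 'X^i.
Proof.
move=> c0 hf; exists (fun i => if (i < l)%N then (f`_i)%:P else drop_poly l f).
  move=> i; case: ifP => _; first exact: dle_le c0 (@dleC k _).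
  by move=> m cm; rewrite coef_drop_poly hf //; lia.
rewrite big_ord_recr /= ltnn -{1}[f](poly_take_drop l); congr (_ + _).
rewrite /take_poly poly_def; apply: eq_bigr => i _.
by rewrite ltn_ord mul_polyC.
Qed.

(** The relations between 1, z, ..., z^l are generated by the obvious ones, z times
    z^i minus 1 times z^(i+1): the f i are the partial sums of the relation divided
    by powers of z. *)
Lemma koszul_chain l (c : int) (v : nat -> {poly k}) :
  (forall i, (i <= l)%N -> dle c (v i)) -> \sum_(i < l.+1) v i * 'X^i = 0 ->
  exists2 f : nat -> {poly k}, forall i, dle (c - 1) (f i) &
    [/\ f l = 0, v 0%N = 'X * f 0%N & forall i, (i < l)%N -> v i.+1 = 'X * f i.+1 - f i].
Proof.
move=> hv v0; (* S l = 0 and later terms are multiples of z^(i+1), so S i is one as well *)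
pose S i := \sum_(u < i.+1) v u * 'X^u.
have S_rec i : S i.+1 = S i + v i.+1 * 'X^(i.+1) by rewrite /S big_ord_recr.
have Slow n i m : (m <= i)%N -> (S (i + n)%N)`_m = (S i)`_m.
  move=> mi; elim: n => [|n IH]; first by rewrite addn0.
  by rewrite addnS S_rec coefD IH coefMXn ltnS (leq_trans mi) ?leq_addr // addr0.
pose f i := drop_poly i.+1 (S i).
have fX i : (i <= l)%N -> f i * 'X^(i.+1) = S i.
  move=> il; rewrite -[RHS](poly_take_drop i.+1) -[LHS]add0r; congr (_ + _).
  apply/polyP => m; rewrite coef0 coef_take_poly; case: ltnP => // mi.
  by rewrite -(Slow (l - i)%N) ?subnKC // /S v0 coef0.
exists (fun i => if (i <= l)%N then f i else 0).
  move=> i; case: ifP => [il|_]; last exact: dle0.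
  move=> m cm; rewrite coef_drop_poly coef_sum big1 // => u _; rewrite coefMXn.
  case: ifP => // _; apply: hv; first by have := ltn_ord u; lia.
  by have := ltn_ord u; lia.
rewrite leqnn leq0n; split.
- by apply: (@mulIf _ ('X^(l.+1))); rewrite ?expf_neq0 ?polyX_eq0 // fX // mul0r.
- by rewrite mulrC -[X in _ * X]expr1 fX // /S big_ord1 expr0 mulr1.
move=> i il; rewrite il (ltnW il).
apply: (@mulIf _ ('X^(i.+1))); first by rewrite expf_neq0 ?polyX_eq0.
have e : 'X * f i.+1 * 'X^(i.+1) = f i.+1 * 'X^(i.+2).
  by rewrite [X in X * _]mulrC -mulrA -exprS.
by rewrite mulrBl e !fX ?(ltnW il) // S_rec addrAC subrr add0r.
Qed.

Definition ord_at m (F : 'I_m -> {poly k}) (i : nat) : {poly k} :=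
  if (insub i : option 'I_m) is Some j then F j else 0.

Lemma ord_atE m (F : 'I_m -> {poly k}) (j : 'I_m) : ord_at F j = F j.
Proof. by rewrite /ord_at valK. Qed.

Lemma ord_at_big m (F : 'I_m -> {poly k}) i : (m <= i)%N -> ord_at F i = 0.
Proof. by move=> mi; rewrite /ord_at insubN // -leqNgt. Qed.

Lemma sum_ord_at m (F : 'I_m -> {poly k}) (c : {poly k}) i :
  \sum_j F j * (if (i == j :> nat) then c else 0) = c * ord_at F i.
Proof.
case: (ltnP i m) => im; last first.
  rewrite ord_at_big // mulr0 big1 // => j _; case: eqP => [e|_]; last by rewrite mulr0.
  by have := ltn_ord j; rewrite -e ltnNge im.
rewrite -[i]/(val (Ordinal im)) ord_atE (bigD1 (Ordinal im)) //= eqxx mulrC.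
rewrite big1 ?addr0 // => j ji; case: eqP => [e|_]; last by rewrite mulr0.
by case/eqP: ji; apply: val_inj.
Qed.

Lemma sum_ord_koszul m (F : 'I_m -> {poly k}) i :
  \sum_j F j * (if (i == j :> nat) then 'X else if (i == j.+1 :> nat) then -1 else 0) =
  'X * ord_at F i - (if i is i'.+1 then ord_at F i' else 0).
Proof.
transitivity (\sum_j (F j * (if (i == j :> nat) then 'X else 0) + F j * (if (i == j.+1 :> nat) then -1 else 0))).
  apply: eq_bigr => j _; rewrite -mulrDr; congr (_ * _).
  case: eqP => [->|_]; last by rewrite add0r.
  by rewrite ltn_eqF ?addr0.
rewrite big_split /= sum_ord_at; congr (_ + _); case: i => [|i].
  by rewrite oppr0 big1 // => j _; rewrite mulr0.
under eq_bigr do rewrite eqSS.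
by rewrite sum_ord_at mulN1r.
Qed.

Variable d : nat.

(** One step in a resolution: a free module with generators in the degrees st_dg,
    and an adapted basis st_g of the next syzygy module, whose s-th vector spans
    a copy of M^(ls s)(- js s). *)
Record stage := Stage {
  st_rk : nat;
  st_dg : 'I_st_rk -> int;
  st_n : nat;
  st_js : 'I_st_n -> int;
  st_ls : 'I_st_n -> nat;
  st_g : 'M[{poly k}]_(st_n, st_rk)
}.

(** M^(l)(-j) is the module of sections of the line bundle O(l - j * d), so over S
    its generator has degree j * d - l. *)
Definition st_e (st : stage) s : int := st_js (s := st) s * d%:Z - (st_ls (s := st) s)%:Z.

Definition gen_ix (st : stage) := {s : 'I_(st_n st) & 'I_(st_ls (s := st) s).+1}.
Definition syz_ix (st : stage) := {s : 'I_(st_n st) & 'I_(st_ls (s := st) s)}.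

(** The copy of M^(l)(-j) spanned by g s is generated over B by the z^i g s with
    i <= l. *)
Definition st_cover (st : stage) : 'M[{poly k}]_(#|{: gen_ix st}|, st_rk st) :=
  \matrix_t ('X^(tagged (enum_val t : gen_ix st)) *: row (tag (enum_val t : gen_ix st)) (st_g st)).

(** The relations z * (z^i g s) = z^(i+1) g s, i < l, have degree js s + 1 over B
    and js s * d + 1 = (js s + 1) * d - (d - 1) over S, so they span copies of
    M^(d-1)(- js s - 1). *)
Definition next (st : stage) : stage := @Stage
  #|{: gen_ix st}| (fun t => st_js (tag (enum_val t : gen_ix st)))
  #|{: syz_ix st}| (fun u => st_js (tag (enum_val u : syz_ix st)) + 1)
  (fun=> d.-1)
  (\matrix_(u, t) let x := (enum_val u : syz_ix st) in let y := (enum_val t : gen_ix st) in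
     if tag x == tag y then
       if (tagged y == tagged x :> nat) then 'X
       else if (tagged y == (tagged x).+1 :> nat) then -1 else 0
     else 0).

Definition stage_ok (st : stage) :=
  [/\ forall s, (st_ls (s := st) s < d)%N,
      forall s, box (fun p => st_e s - st_dg p * d%:Z) (row s (st_g st)),
      forall f : 'rV_(st_n st), f *m st_g st = 0 -> f = 0
    & forall s p, st_g st s p != 0 -> st_dg p * d%:Z < st_e s].

Section Next.
Variable st : stage.
Hypothesis d_gt0 : (0 < d)%N.
Hypothesis ok : stage_ok st.
Local Notation n := (st_n st).
Local Notation ls := (st_ls (s := st)).
Local Notation js := (st_js (s := st)).
Local Notation g := (st_g st).

(** Blockwise coordinates, extended by 0 beyond the block, so that the relations
    in a block need no boundary cases. *)
Definition gat (v : 'rV[{poly k}]_#|{: gen_ix st}|) s :=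
  ord_at (fun j : 'I_(ls s).+1 => v 0 (enum_rank (Tagged (fun s => 'I_(ls s).+1) j : gen_ix st))).

Definition sat (f : 'rV[{poly k}]_#|{: syz_ix st}|) s :=
  ord_at (fun j : 'I_(ls s) => f 0 (enum_rank (Tagged (fun s => 'I_(ls s)) j : syz_ix st))).

Lemma cover_mul v : v *m st_cover st = (\row_s \sum_(i < (ls s).+1) gat v s i * 'X^i) *m g.
Proof.
rewrite !mulmx_sum_row.
rewrite (reindex (@enum_rank {: gen_ix st})) /=; last by apply: onW_bij; apply: enum_rank_bij.
transitivity (\sum_s \sum_(i < (ls s).+1) (gat v s i * 'X^i) *: row s g).
  rewrite (sig_big_dep xpredT (fun i => xpredT) (fun s (i : 'I_(ls s).+1) => (gat v s i * 'X^i) *: row s g)) /=.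
  apply: eq_bigr => -[s i] _ /=; rewrite rowK enum_rankK /= scalerA; congr (_ *: _).
  by rewrite /gat ord_atE.
by apply: eq_bigr => s _; rewrite mxE scaler_suml.
Qed.

Lemma syz_mul f t : (f *m st_g (next st)) 0 t =
  let y := (enum_val t : gen_ix st) in
  'X * sat f (tag y) (tagged y) - (if (tagged y : nat) is i.+1 then sat f (tag y) i else 0).
Proof.
rewrite mxE (reindex (@enum_rank {: syz_ix st})) /=; last by apply: onW_bij; apply: enum_rank_bij.
case yE: (enum_val t) => [s i] /=.
transitivity (\sum_s' \sum_(j < ls s') (f 0 (enum_rank (Tagged (fun s => 'I_(ls s)) j : syz_ix st))) *
   (if s' == s then if (i == j :> nat) then 'X else if (i == j.+1 :> nat) then -1 else 0 else 0)).
  rewrite (sig_big_dep xpredT (fun i => xpredT) (fun s' (j : 'I_(ls s')) => (f 0 (enum_rank (Tagged (fun s => 'I_(ls s)) j : syz_ix st))) *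
   (if s' == s then if (i == j :> nat) then 'X else if (i == j.+1 :> nat) then -1 else 0 else 0))) /=.
  by apply: eq_bigr => -[s' j] _; rewrite mxE enum_rankK yE.
rewrite (bigD1 s) //= [X in _ + X]big1 ?addr0 => [|s' /negPf s's]; last first.
  by rewrite big1 // => j _; rewrite s's mulr0.
under eq_bigr do rewrite eqxx.
exact: sum_ord_koszul.
Qed.

Lemma next_eE u : st_e (st := next st) u = js (tag (enum_val u : syz_ix st)) * d%:Z + 1.
Proof. by rewrite /st_e /= mulrDl mul1r; lia. Qed.

(** Blockwise this is the statement about relations between powers of z. *)
Lemma next_adapted : adapted_basis (fun t => st_dg (s := next st) t * d%:Z) (st_cover st)
  (st_e (st := next st)) (st_g (next st)).
Proof.
have [lsd gbox ginj gmin] := ok.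
have eE := next_eE.
have gatE (v : 'rV[{poly k}]_#|{: gen_ix st}|) t : v 0 t = gat v (tag (enum_val t : gen_ix st)) (tagged (enum_val t : gen_ix st)).
  by rewrite /gat ord_atE; case: (enum_val t) (enum_valK t) => s i /= ->.
have satE (f : 'rV[{poly k}]_#|{: syz_ix st}|) u : f 0 u = sat f (tag (enum_val u : syz_ix st)) (tagged (enum_val u : syz_ix st)).
  by rewrite /sat ord_atE; case: (enum_val u) (enum_valK u) => s i /= ->.
split.
- move=> u t; rewrite eE 2!mxE /=; case: eqP => [e|_]; last exact: dle0.
  rewrite (_ : _ - _ = 1); last by rewrite e addrAC subrr add0r.
  case: eqP => _; first exact: (@dleX k 1).
  case: eqP => _; last exact: dle0.
  by apply: dleN; apply: dle_le (@dleC k 1).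
- apply/row_matrixP => u; rewrite row0 row_mul cover_mul.
  have -> : \row_s \sum_(i < (ls s).+1) gat (row u (st_g (next st))) s i * 'X^i = 0; last by rewrite mul0mx.
  apply/rowP => s; rewrite [LHS]mxE [RHS]mxE.
  case ux: (enum_val u : syz_ix st) => [s' i].
  transitivity (\sum_(j < (ls s).+1) ('X^j * (if s' == s then if (j == i :> nat) then 'X else if (j == i.+1 :> nat) then -1 else 0 else 0) : {poly k})).
    apply: eq_bigr => j _; rewrite /gat ord_atE mulrC; congr (_ * _).
    by rewrite 2!mxE enum_rankK ux.
  case: (eqVneq s' s) => [ss|_]; last by rewrite big1 // => j _; rewrite mulr0.
  have il : (i < ls s)%N by rewrite -ss.
  rewrite (bigD1 (Ordinal (leq_trans il (leqnSn _)))) //= eqxx.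
  have il' : (i.+1 < (ls s).+1)%N by [].
  rewrite (bigD1 (Ordinal il')) /=; last by rewrite -val_eqE /= gtn_eqF.
  rewrite gtn_eqF // eqxx mulrN1 -exprSr addrA subrr add0r big1 // => j.
  by rewrite -!val_eqE /= => /andP[/negPf-> /negPf->]; rewrite mulr0.
- move=> t v hv; rewrite cover_mul => /ginj vz.
  have hc s : exists f : nat -> {poly k}, (forall i, dle (t - js s * d%:Z - 1) (f i)) /\
      [/\ f (ls s) = 0, gat v s 0%N = 'X * f 0%N & forall i, (i < ls s)%N -> gat v s i.+1 = 'X * f i.+1 - f i].
    have [||f f1 f2] := @koszul_chain (ls s) (t - js s * d%:Z) (gat v s).
    - move=> i il; rewrite -ltnS in il; rewrite -[i]/(val (Ordinal il)) /gat ord_atE.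
      by have := hv (enum_rank (Tagged (fun s => 'I_(ls s).+1) (Ordinal il) : gen_ix st)); rewrite /= enum_rankK.
    - by move/rowP/(_ s): vz; rewrite !mxE.
    by exists f.
  have [F hF] := fin_all_exists hc.
  pose f : 'rV[{poly k}]_#|{: syz_ix st}| := \row_u F (tag (enum_val u : syz_ix st)) (tagged (enum_val u : syz_ix st)).
  have fE s i : (i <= ls s)%N -> sat f s i = F s i.
    rewrite leq_eqVlt => /orP[/eqP ->|il].
      by rewrite /sat ord_at_big //; have [_ [-> _ _]] := hF s.
    by rewrite -[i]/(val (Ordinal il)) /sat ord_atE mxE enum_rankK.
  exists f; first by move=> u; rewrite eE mxE; have [h _] := hF (tag (enum_val u : syz_ix st)); apply: dle_le (h _); lia.
  apply/rowP => y; rewrite syz_mul gatE /=; case: (enum_val y) => s [i il] /=.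
  have [_ [_ F2 F3]] := hF s.
  case: i il => [|i] il; first by rewrite fE // subr0.
  have i1 : (i < ls s)%N by []; by rewrite (fE s i.+1 i1) (fE s i (ltnW i1)) F3.
- move=> f fz.
  have h s i : (i < ls s)%N -> sat f s i = 0.
    elim: i => [|i IH] il.
      have := syz_mul f (enum_rank (Tagged (fun s => 'I_(ls s).+1) (Ordinal (leq_trans il (leqnSn _))) : gen_ix st)).
      rewrite fz mxE enum_rankK /= subr0 => /esym/eqP; rewrite mulf_eq0 polyX_eq0 => /eqP //.
    have := syz_mul f (enum_rank (Tagged (fun s => 'I_(ls s).+1) (Ordinal (leq_trans il (leqnSn _))) : gen_ix st)).
    rewrite fz mxE enum_rankK /= IH ?(ltnW il) // subr0 => /esym/eqP; rewrite mulf_eq0 polyX_eq0 => /eqP //.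
  by apply/rowP => u; rewrite satE h ?mxE.
Qed.

Lemma next_ok : stage_ok (next st).
Proof.
have [h1 h2 h3 h4] := next_adapted; split=> //.
- by move=> s /=; rewrite prednK.
- move=> u t; rewrite mxE /=; case: (tag _ =P tag _) => [e|_]; last by rewrite eqxx.
  by move=> _; rewrite next_eE e ltrDl.
Qed.

Lemma cover_box t : box (fun p => st_dg (s := next st) t * d%:Z - st_dg p * d%:Z) (row t (st_cover st)).
Proof.
have [lsd gbox ginj gmin] := ok; move=> p; rewrite 2!mxE /=; case: (enum_val t) => s i /=.
have -> : js s * d%:Z - st_dg p * d%:Z = (ls s)%:Z + (st_e s - st_dg p * d%:Z) by rewrite /st_e; lia.
rewrite mxE; apply: dleM; last by have := gbox s p; rewrite mxE.
by apply: dle_le (@dleX k i); have := ltn_ord i; lia.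
Qed.

Lemma cover_min t p : st_cover st t p != 0 -> st_dg p < st_dg (s := next st) t.
Proof.
have [lsd gbox ginj gmin] := ok; rewrite 3!mxE mulf_eq0 negb_or => /andP[_ /gmin] /=.
rewrite /st_e; move: (st_js _) (st_dg p) => x y h.
have : y * d%:Z < x * d%:Z by lia.
by rewrite ltr_pM2r.
Qed.

Lemma cover_onto (j : int) f : box (fun s => j * d%:Z - st_e s) f ->
  exists2 w, box (fun t => j * d%:Z - st_dg (s := next st) t * d%:Z) w & f *m g = w *m st_cover st.
Proof.
have [lsd gbox ginj gmin] := ok; move=> hf.
have hc s : exists w : nat -> {poly k}, (forall i, dle ((j - js s) * d%:Z) (w i)) /\
    f 0 s = \sum_(i < (ls s).+1) w i * 'X^i.
  case: (lerP 0 (j - js s)) => h.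
    have [||w w1 w2] := @split_poly (ls s) ((j - js s) * d%:Z) (f 0 s); last by exists w.
      by rewrite mulr_ge0.
    by apply: dle_le (hf s); rewrite /st_e; lia.
  exists (fun=> 0); split=> [i|]; first exact: dle0.
  rewrite big1 => [|i _]; last by rewrite mul0r.
  apply: dle_neg (hf s); have := lsd s; rewrite /st_e; nia.
have [w hw] := fin_all_exists hc.
exists (\row_t w (tag (enum_val t : gen_ix st)) (tagged (enum_val t : gen_ix st))).
  move=> t; rewrite mxE /=; have [h _] := hw (tag (enum_val t : gen_ix st)).
  by have := h (tagged (enum_val t : gen_ix st)); rewrite mulrBl.
rewrite cover_mul; congr (_ *m _); apply/rowP => s; rewrite [RHS]mxE.
have [_ ->] := hw s; apply: eq_bigr => i _.
by rewrite /gat ord_atE mxE enum_rankK.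
Qed.

End Next.

(** The Betti numbers of M^(l), all in degree i.  The recursion: M^(l) has l + 1
    generators, and its first syzygy module is the sum of l copies of
    M^(d-1)(-1). *)
Fixpoint vbet (l i : nat) : nat := if i is i'.+1 then (l * vbet d.-1 i')%N else l.+1.

Lemma next_count i st (j : int) :
  #|[pred t | st_dg (s := iter i.+1 next st) t == j]| =
  (\sum_s (st_js s + i%:Z == j)%R * vbet (st_ls (s := st) s) i)%N.
Proof.
have sum_ix (n : nat) (l : 'I_n -> nat) (F : {s : 'I_n & 'I_(l s)} -> nat) (H : 'I_n -> nat) :
    (forall x, F x = H (tag x)) ->
    (\sum_(t < #|{: {s : 'I_n & 'I_(l s)}}|) F (enum_val t) = \sum_s l s * H s)%N.
  move=> FH; rewrite -(big_enum_val F) /=.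
  transitivity (\sum_s \sum_(i < l s) H s)%N.
    by rewrite (sig_big_dep xpredT (fun i => xpredT) (fun s (i : 'I_(l s)) => H s)) /=; apply: eq_bigr.
  by apply: eq_bigr => s _; rewrite sum_nat_const card_ord.
elim: i st => [|i IH] st.
  transitivity (\sum_(t < #|{: gen_ix st}|) ((st_js (tag (enum_val t : gen_ix st)) == j)%R : nat))%N.
    by rewrite -sum1_card big_mkcond; apply: eq_bigr => t _; rewrite inE; case: eqP.
  apply: etrans (sum_ix _ _ (fun x => (st_js (tag x) == j)%R : nat) (fun s => (st_js s == j)%R : nat) _) _ => //.
  by apply: eq_bigr => s _; rewrite addr0 mulnC.
rewrite iterSr IH /=.
apply: etrans (sum_ix _ _ (fun x => (st_js (tag x) + 1 + i%:Z == j)%R * vbet d.-1 i)%N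
  (fun s => (st_js s + 1 + i%:Z == j)%R * vbet d.-1 i)%N _) _ => //.
apply: eq_bigr => s _; rewrite mulnCA; congr (nat_of_bool (_ == _) * _)%N; lia.
Qed.

End LinearResolution.

(** * The minimal resolution attached to a presentation *)

Section Resolution.
Variables (k : fieldType) (d : nat).
Hypothesis d_gt0 : (0 < d)%N.
Local Notation B := (vring k d).
Local Notation free := (gfree k d_gt0).

Lemma rank_part n (a : 'I_n -> int) (j : int) :
  \rank (part k a j) = #|[pred p | a p == j]|.
Proof.
have [S [Sf SX _ hS]] := subset_rank_free k [set p | a p == j].
have -> : #|[pred p | a p == j]| = #|[set p | a p == j]| by apply: eq_card => p; rewrite !inE.
apply/eqP; rewrite eqn_leq; apply/andP; split.
  rewrite {1}[part k a j](SX _ (part k a j)); last first.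
    by move=> i p; rewrite inE !mxE; case: (i =P p) => [->|//] /negPf ->.
  by apply: leq_trans (mxrankM_maxr _ _) _; apply: rank_leq_row.
rewrite -{1}(eqP Sf); apply: mxrankS; apply/row_subP => t; have [p] := hS t.
rewrite inE => /eqP ap ->; apply/submxP; exists (delta_mx 0 p).
rewrite -rowE; apply/rowP => q; rewrite !mxE eqxx /= ap eqxx.
by rewrite [p == q]eq_sym; case: (q == p).
Qed.

Lemma cmx_min n m (b : 'I_n -> int) (a : 'I_m -> int) (f : free b -> free a) :
  degree0 f -> (forall p q, dmx f p q != 0 -> a q < b p) -> cmx f = 0.
Proof.
move=> f0 fmin; apply/matrixP => p q; rewrite [RHS]mxE.
case: (eqVneq (b p) (a q)) => [ba|]; last exact: cmx_degree.
have z : dmx f p q = 0.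
  by apply/eqP; apply: contraT => /fmin; rewrite ba ltxx.
have hv : vhomog d 0 (- a q + b p) (val (f (gbasis k d_gt0 b p) q : B)).
  exact (f0 (b p) (gbasis k d_gt0 b p) (@gbasis_homog k d d_gt0 n b p) q).
have e : f (gbasis k d_gt0 b p) q = 0 :> B.
  by apply: val_inj; apply: (vhomog_inj hv); move: z; rewrite !mxE.
by rewrite mxE e cst0.
Qed.

(** For a minimal resolution all differentials of k (x) F vanish. *)
Lemma tor_dim_minimal (M : gmod k d) (G : free_res d_gt0 M) :
  (forall i, cmx (fr_diff G i) = 0) ->
  forall i j, tor_dim G i j = #|[pred p | fr_deg (f := G) (i := i) p == j]|.
Proof.
move=> Gmin i j; rewrite /tor_dim /tor_boundaries tor_diffE Gmin mulmx0 mxrank0 subn0.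
case: i => [|i]; first exact: rank_part.
rewrite /tor_cycles tor_diffE Gmin -rank_part; apply: eqmx_rank; apply/eqmxP.
apply/capmx_idPl; apply/sub_kermxP; exact: mulmx0.
Qed.

Section FromPresentation.
Variables (M : gmod k d) (n0 : nat) (a : 'I_n0 -> int) (f0 : {linear free a -> M}).
Variables (st : stage k) (f1 : {linear free (st_dg (s := st)) -> free a}).
Hypotheses (df0 : degree0 f0) (sf0 : surjective_map f0).
Hypotheses (df1 : degree0 f1) (ex : exact_at f1 f0).
Hypothesis ok : stage_ok d st.
Hypothesis ad : adapted_basis (fun p => st_dg (s := st) p * d%:Z) (dmx f1) (st_e d (st := st)) (st_g st).
Hypothesis min1 : forall p q, dmx f1 p q != 0 -> a q < st_dg (s := st) p.

Let sts i := iter i (next d) st.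
Let rk i := if i is i'.+1 then st_rk (sts i') else n0.
Let deg i : 'I_(rk i) -> int :=
  match i return 'I_(rk i) -> int with 0%N => a | i'.+1 => st_dg (s := sts i') end.

Lemma sts_ok i : stage_ok d (sts i).
Proof. by elim: i => // i IH; apply: next_ok. Qed.

Lemma cover_map i : {f : {linear free (deg (i := i.+2)) -> free (deg (i := i.+1))} |
  degree0 f /\ dmx f = st_cover (sts i)}.
Proof.
apply: constructive_indefinite_description; apply: dmx_lift => p.
exact: cover_box (sts_ok i) p.
Qed.

Let diff i : {linear free (deg (i := i.+1)) -> free (deg (i := i))} :=
  match i return {linear free (deg (i := i.+1)) -> free (deg (i := i))} with
  | 0%N => f1 | i'.+1 => sval (cover_map i') end.

Lemma diff_degree0 i : degree0 (diff i).
Proof. by case: i => [|i] //; have [] := svalP (cover_map i). Qed.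

Lemma diff_adapted i : adapted_basis (fun p => deg (i := i.+1) p * d%:Z) (dmx (diff i))
   (st_e d (st := sts i)) (st_g (sts i)).
Proof.
case: i => [|i]; first exact: ad.
rewrite /diff; have [_ ->] := svalP (cover_map i).
exact: next_adapted (sts_ok i).
Qed.

Lemma diff_min i p q : dmx (diff i) p q != 0 -> deg (i := i) q < deg (i := i.+1) p.
Proof.
case: i p q => [|i] p q; first exact: min1.
rewrite /diff; have [_ ->] := svalP (cover_map i).
exact: cover_min (sts_ok i) _ _.
Qed.

Lemma diff_exact i : exact_at (diff i.+1) (diff i).
Proof.
have [h1 h2 h3 h4] := diff_adapted i.
have cE : dmx (diff i.+1) = st_cover (sts i) by have [_] := svalP (cover_map i).
apply: exact_dmx; try exact: diff_degree0.
  rewrite cE; apply/row_matrixP => t; rewrite row0 row_mul rowK -scalemxAl -row_mul h2.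
  by rewrite row0 scaler0.
move=> j v hv vD; have [f hf ->] := h3 _ _ hv vD; rewrite cE.
exact: cover_onto (sts_ok i) _ _ hf.
Qed.

(** Splice the presentation with the resolution of the sum of Veronese modules
    which forms its kernel. *)
Definition presentation_res : free_res d_gt0 M :=
  @FreeRes k d d_gt0 M rk (@deg) diff f0 diff_degree0 df0 sf0 ex diff_exact.

Definition presentation_table (i : nat) (j : int) : nat :=
  match i with
  | 0%N => #|[pred p | a p == j]|
  | 1%N => #|[pred p | st_dg (s := st) p == j]|
  | i'.+2 => (\sum_s (st_js (s := st) s + i'%:Z == j)%R * vbet d (st_ls (s := st) s) i')%N
  end.

Lemma presentation_tor (F : free_res d_gt0 M) i j : tor_dim F i j = presentation_table i j.
Proof.
rewrite (tor_dim_unique F presentation_res) tor_dim_minimal; last first.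
  move=> i'; apply: cmx_min; first exact: diff_degree0.
  exact: diff_min.
case: i => [|[|i]] //.
exact: (next_count d i st j).
Qed.

End FromPresentation.
End Resolution.

(** * Finite length modules and minimal presentations *)

Section FiniteLength.
Variables (k : fieldType) (d : nat).
Hypothesis d_gt0 : (0 < d)%N.
Local Notation B := (vring k d).
Implicit Types M : gmod k d.

(** Sums of homogeneous elements of degree at least J; these submodules form a
    descending filtration, strict wherever M has a nonzero element of that degree. *)
Definition tail M (J : int) (x : M) := exists L : seq (int * M),
  (forall t, t \in L -> ghomog t.1 t.2 /\ J <= t.1) /\ x = \sum_(t <- L) t.2.

Lemma tailD M J (x y : M) : tail J x -> tail J y -> tail J (x + y).
Proof.
move=> [L [hL ->]] [L' [hL' ->]]; exists (L ++ L'); split; last by rewrite big_cat.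
by move=> t; rewrite mem_cat => /orP[/hL|/hL'].
Qed.

Lemma tail0 M J : tail J (0 : M).
Proof. by exists [::]; rewrite big_nil. Qed.

Lemma tail_homog M J j (x : M) : ghomog j x -> J <= j -> tail J x.
Proof.
move=> hx Jj; exists [:: (j, x)]; split; last by rewrite big_seq1.
by move=> t; rewrite inE => /eqP ->.
Qed.

Lemma tail_submodule M J : is_submodule (@tail M J).
Proof.
split; [exact: tail0|exact: tailD|move=> b x [L [hL ->]]].
have [Lb [hb bE]] := @ghomog_span k d (gring k d_gt0) b.
rewrite scaler_sumr big_seq; elim/big_ind: _; [exact: tail0|exact: tailD|move=> t /hL [ht Jt]].
have -> : b *: t.2 = \sum_(u <- Lb) (u.2 : B) *: t.2.
  by rewrite -scaler_suml; congr (_ *: _).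
rewrite big_seq; elim/big_ind: _; [exact: tail0|exact: tailD|move=> [i u] /hb /= hu].
case: i hu => i hu.
  by apply: (@tail_homog _ _ (i%:Z + t.1)); [apply: ghomogZ|lia].
have -> : u = 0 by apply: val_inj; apply/eqP.
rewrite scale0r; exact: tail0.
Qed.

Lemma tail_le M J J' (x : M) : J <= J' -> tail J' x -> tail J x.
Proof.
move=> JJ [L [hL ->]]; exists L; split=> // t /hL [ht J't]; split=> //.
exact: le_trans J't.
Qed.

Lemma tail_zero M J j (x : M) : ghomog j x -> j < J -> tail J x -> x = 0.
Proof.
move=> hx jJ [L [hL xE]].
pose s := undup [seq t.1 | t <- L].
have js : j \notin s.
  rewrite mem_undup; apply/mapP => -[t /hL [_ Jt] jt].
  by move: jJ; rewrite jt ltNge Jt.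
have us : uniq (j :: s) by rewrite /= js undup_uniq.
pose c i := if i == j then x else - \sum_(t <- L | t.1 == i) t.2.
have := @ghomog_direct _ _ M (j :: s) c us _ _ j (mem_head _ _).
rewrite /c eqxx; apply.
  move=> i; case: eqP => [->|_] //; apply: ghomogN; rewrite big_seq_cond.
  by apply: ghomog_sum => t /andP[/hL [ht _] /eqP <-].
rewrite big_cons eqxx.
have -> : \sum_(i <- s) (if i == j then x else - \sum_(t <- L | t.1 == i) t.2) = - \sum_(i <- s) \sum_(t <- L | t.1 == i) t.2.
  rewrite -sumrN; apply: eq_big_seq => i is_; case: eqP => // ij.
  by rewrite ij (negPf js) in is_.
rewrite (exchange_big_dep xpredT) //= xE.
apply/eqP; rewrite subr_eq0; apply/eqP; apply: eq_big_seq => t tL.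
rewrite big_mkcond (bigD1_seq t.1) ?undup_uniq ?mem_undup ?map_f //= eqxx.
by rewrite big1 ?addr0 // => i; rewrite eq_sym => /negPf->.
Qed.

(** Otherwise the submodules of elements of degree at least n give chains of any
    length. *)
Lemma finite_length_bounded M : finite_length M ->
  exists N : nat, forall n : nat, (N <= n)%N -> forall x : M, ghomog n%:Z x -> x = 0.
Proof.
move=> [m hm]; apply: NNPP => hN.
have step (N : nat) : {n : nat | (N <= n)%N /\ exists2 x : M, ghomog n%:Z x & x <> 0}.
  apply: constructive_indefinite_description; apply: NNPP => h; apply: hN; exists N.
  by move=> n Nn x hx; apply: NNPP => xz; apply: h; exists n; split=> //; exists x.
pose ns := fix ns i : nat := if i is i'.+1 then sval (step (ns i').+1) else sval (step 0%N).
have ns_lt i : (ns i < ns i.+1)%N by have [] := svalP (step (ns i).+1).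
have ns_nz i : exists2 x : M, ghomog (ns i)%:Z x & x <> 0.
  case: i => [|i]; first by have [] := svalP (step 0%N).
  by have [] := svalP (step (ns i).+1).
apply: (hm (fun i => tail (ns (m.+1 - i)%N)%:Z)) => [i|i im]; first exact: tail_submodule.
rewrite subSn // subSS; split=> [x|].
  by apply: tail_le; rewrite lez_nat ltnW.
have [x hx xz] := ns_nz (m - i)%N; exists x; split; first exact: tail_homog hx _.
by move/(tail_zero hx) => h; apply: xz; apply: h; rewrite ltz_nat.
Qed.

End FiniteLength.

Section MinimalPresentation.
Variables (k : fieldType) (d : nat).
Hypothesis d_gt0 : (0 < d)%N.
Local Notation B := (vring k d).
Local Notation free := (gfree k d_gt0).
Implicit Types M : gmod k d.

Lemma adapted_ext n m (b : 'I_n -> int) (D : 'M[{poly k}]_(n, m)) r (e e' : 'I_r -> int) G :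
  (forall s, e s = e' s) -> adapted_basis b D e G -> adapted_basis b D e' G.
Proof.
move=> ee [h1 h2 h3 h4]; split=> //.
  by move=> s i; rewrite -ee; apply: h1.
move=> t v hv vD; have [f hf vf] := h3 t v hv vD; exists f => // s.
by rewrite -ee; apply: hf.
Qed.

(** The kernel lies in the maximal ideal times the free module: an entry in the
    degree of its basis element is a constant. *)
Definition unit_free_kernel (N : gmod k d) n (a : 'I_n -> int) (f : free a -> N) :=
  forall j v, ghomog j v -> f v = 0 -> forall p, a p = j -> v p = 0.

Lemma min_entries (N : gmod k d) n m (b : 'I_n -> int) (a : 'I_m -> int) (f1 : {linear free b -> free a})
  (f0 : {linear free a -> N}) : degree0 f1 -> (forall x, f0 (f1 x) = 0) -> unit_free_kernel f0 ->
  forall p q, dmx f1 p q != 0 -> a q < b p.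
Proof.
move=> df1 ff uf p q; rewrite !mxE => nz.
have hv : ghomog (b p) (f1 (gbasis k d_gt0 b p)) by apply: df1; apply: gbasis_homog.
rewrite ltNge; apply: contra nz; rewrite le_eqVlt => /orP[/eqP bq|bq].
  by rewrite (uf _ _ hv (ff _) q (esym bq)) rmorph0.
apply/eqP; have := vhomog_dle (hv q); rewrite addr0 => h.
by apply: dle_neg h; rewrite pmulr_llt0; lia.
Qed.

(** Write the degree e of each vector of an adapted basis as j * d - l with
    0 <= l < d.  That f1 has no superfluous generators excludes constant entries,
    which would occur in a degree e that is a multiple of d. *)
Lemma kernel_stage n m (b : 'I_n -> int) (a : 'I_m -> int) (f1 : {linear free b -> free a}) :
  degree0 f1 -> unit_free_kernel f1 ->
  exists r (js : 'I_r -> int) (ls : 'I_r -> nat) (G : 'M[{poly k}]_(r, n)),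
    stage_ok d (Stage b js ls G) /\
    adapted_basis (fun p => b p * d%:Z) (dmx f1) (st_e d (st := Stage b js ls G)) G.
Proof.
move=> df1 uf.
have [r [e [G ad]]] := adapted_basis_exists (fun p => b p * d%:Z) (dmx f1).
have hdiv s : exists x : int * nat, (x.2 < d)%N /\ e s = x.1 * d%:Z - x.2%:Z.
  exists (- ((- e s) %/ d%:Z)%Z, absz ((- e s) %% d%:Z)%Z) => /=; lia.
have [x hx] := fin_all_exists hdiv.
exists r, (fun s => (x s).1), (fun s => (x s).2), G.
have eE s : e s = st_e d (st := Stage b (fun s => (x s).1) (fun s => (x s).2) G) s.
  by rewrite /st_e /=; have [] := hx s.
have ad' := adapted_ext eE ad; split=> //.
have [h1 h2 h3 h4] := ad'; split=> //.
  by move=> s; have [] := hx s.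
move=> s p nz; rewrite -eE ltNge; apply: contra nz => le.
have [g1 _ _ _] := ad.
case: (eqVneq (e s) (b p * d%:Z)) => [ep|ne]; last first.
  have := g1 s p; rewrite mxE => /dle_neg -> //.
  by rewrite subr_lt0 lt_neqAle ne.
have hb : box (fun p' => b p * d%:Z - b p' * d%:Z) (row s G).
  by move=> p'; rewrite -ep; apply: g1.
have [v hv vE] := dvec_lift d_gt0 hb.
have fv : f1 v = 0.
  apply: (dvec_inj (df1 _ _ hv)); by rewrite dvec_map vE -row_mul h2 row0.
have := uf _ _ hv fv p erefl => vp.
by move/rowP/(_ p): vE; rewrite !mxE vp rmorph0 => <-.
Qed.

(** In large degrees M vanishes, so f1 is onto. *)
Lemma presentation_surj M n m (b : 'I_n -> int) (a : 'I_m -> int)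
  (f1 : {linear free b -> free a}) (f0 : {linear free a -> M}) :
  degree0 f0 -> degree0 f1 -> exact_at f1 f0 -> finite_length M ->
  exists N : nat, forall n' : nat, (N <= n')%N ->
  forall w, box (fun q => (n' * d)%N%:Z - a q * d%:Z) w ->
  exists2 v, box (fun p => (n' * d)%N%:Z - b p * d%:Z) v & v *m dmx f1 = w.
Proof.
move=> df0 df1 ex /(finite_length_bounded d_gt0) [N hN]; exists N => n' Nn w hw.
have [x hx xE] : exists2 x : free a, ghomog n'%:Z x & dvec x = w.
  by apply: dvec_lift => q; rewrite -PoszM; apply: hw.
have /ex [y fy] : f0 x = 0 by apply: (hN n' Nn); apply: df0.
have [y' hy' fy'] := homog_preimage df1 hx fy.
exists (dvec y'); last by rewrite -dvec_map fy'.
by move=> p; rewrite PoszM; apply: dvec_box.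
Qed.

(** The three nonzero weights are the Herzog-Kuehl weights for the degrees
    d0 * d, d1 * d, d2 * d - l over S. *)
Definition pure_tab (d0 d1 d2 : int) (l : nat) : table := fun i j =>
  match i with
  | 0%N => if j == d0 then (d2 * d%:Z - l%:Z - d1 * d%:Z)%:~R else 0
  | 1%N => if j == d1 then (d2 * d%:Z - l%:Z - d0 * d%:Z)%:~R else 0
  | i'.+2 => if d2 + i'%:Z == j then ((d1 - d0) * d%:Z)%:~R * (vbet d l i')%:R else 0
  end.

Lemma minimal_presentation M (F : free_res d_gt0 M) : fin_gen M ->
  exists n0 (a : 'I_n0 -> int) n1 (b : 'I_n1 -> int)
    (f0 : {linear free a -> M}) (f1 : {linear free b -> free a}),
  [/\ degree0 f0 /\ degree0 f1, surjective_map f0 /\ exact_at f1 f0,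
      unit_free_kernel f0 & unit_free_kernel f1].
Proof.
move=> [n [x xgen]].
have z0 : degree0 (\0 : {linear M -> M}) by move=> j y _; apply: ghomog0.
have zg : fg_kernel (\0 : {linear M -> M}) by exists n, x.
have [n0 [a [f0 [df0 e0 u0]]]] := min_cover d_gt0 z0 zg.
have sf0 : surjective_map f0 by move=> y; apply/e0.
have [n1 [b [f1 [df1 e1 u1]]]] := min_cover d_gt0 df0 (fg_kernel_cover F df0 sf0).
by exists n0, a, n1, b, f0, f1.
Qed.

End MinimalPresentation.

(** * Decomposition of Betti tables into pure tables *)

Section Cones.
Variable X : table -> Prop.

Lemma cone_ext t u : (forall i j, t i j = u i j) -> cone_gen X t -> cone_gen X u.
Proof. by move=> tu [n [c [b [h1 h2 h3]]]]; exists n, c, b; split=> // i j; rewrite -tu. Qed.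

Lemma cone_in t : X t -> cone_gen X t.
Proof.
move=> Xt; exists 1%N, (fun=> 1), (fun=> t); split=> // i j.
by rewrite big_ord1 mul1r.
Qed.

Lemma cone0 : cone_gen X (fun _ _ => 0).
Proof. by exists 0%N, (fun=> 0), (fun=> fun _ _ => 0); split=> [[]//|[]//|i j]; rewrite big_ord0. Qed.

Lemma cone_add t u : cone_gen X t -> cone_gen X u -> cone_gen X (fun i j => t i j + u i j).
Proof.
move=> [n [c [b [c0 bX tE]]]] [m [c' [b' [c0' bX' uE]]]].
exists (n + m)%N, (fun s => match split s with inl s => c s | inr s => c' s end),
  (fun s => match split s with inl s => b s | inr s => b' s end); split.
- by move=> s; case: (split s).
- by move=> s; case: (split s).
- move=> i j; rewrite tE uE big_split_ord /=; congr (_ + _); apply: eq_bigr => s _.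
    by rewrite (unsplitK (inl s)).
  by rewrite (unsplitK (inr s)).
Qed.

Lemma cone_scale c t : 0 <= c -> cone_gen X t -> cone_gen X (fun i j => c * t i j).
Proof.
move=> c0 [n [c' [b [c0' bX tE]]]]; exists n, (fun s => c * c' s), b; split=> //.
  by move=> s; rewrite mulr_ge0.
by move=> i j; rewrite tE mulr_sumr; apply: eq_bigr => s _; rewrite mulrA.
Qed.

Lemma cone_sum (I : Type) (r : seq I) (c : I -> rat) (t : I -> table) :
  (forall s, 0 <= c s) -> (forall s, c s != 0 -> cone_gen X (t s)) ->
  cone_gen X (fun i j => \sum_(s <- r) c s * t s i j).
Proof.
move=> c0 h; elim: r => [|s r IH].
  by apply: cone_ext cone0 => i j; rewrite big_nil.
apply: (@cone_ext (fun i j => c s * t s i j + \sum_(s <- r) c s * t s i j)).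
  by move=> i j; rewrite big_cons.
apply: cone_add => //; case: (eqVneq (c s) 0) => [->|cs]; last by apply: cone_scale (h _ cs).
by apply: cone_ext cone0 => i j; rewrite mul0r.
Qed.
End Cones.

Lemma cone_sub (X Y : table -> Prop) t : (forall u, X u -> cone_gen Y u) ->
  cone_gen X t -> cone_gen Y t.
Proof.
move=> h [n [c [b [c0 bX tE]]]].
apply: (@cone_ext _ (fun i j => \sum_(s < n) c s * b s i j)) => [i j|]; first by rewrite tE.
by apply: cone_sum => // s _; apply: h.
Qed.

Section PureTables.
Variables (k : fieldType) (d : nat).
Hypothesis d_gt0 : (0 < d)%N.

Definition pure_table (t : table) := exists (d0 d1 d2 : int) (l : nat),
  [/\ d0 < d1, d1 < d2, l = 0%N \/ l = d.-1 & forall i j, t i j = pure_tab d d0 d1 d2 l i j].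

(** The weights and the Betti numbers of M^(l) are affine in l. *)
Lemma pure_tab_interpolation d0 d1 d2 l i j : (l < d)%N -> (1 < d)%N ->
  pure_tab d d0 d1 d2 l i j =
  ((d.-1 - l)%:R / d.-1%:R) * pure_tab d d0 d1 d2 0 i j +
  (l%:R / d.-1%:R) * pure_tab d d0 d1 d2 d.-1 i j.
Proof.
move=> ld d1'.
have d0' : d.-1%:R != 0 :> rat by rewrite pnatr_eq0; lia.
have e1 : (d.-1 - l)%:R = d.-1%:R - l%:R :> rat by rewrite natrB //; lia.
have e2 : ((d.-1 - l)%:R / d.-1%:R) + (l%:R / d.-1%:R) = 1 :> rat.
  by rewrite e1 -mulrDl subrK divff.
have aff (x y : int) : (x - l%:Z - y)%:~R =
    ((d.-1 - l)%:R / d.-1%:R) * (x - 0%:Z - y)%:~R + (l%:R / d.-1%:R) * (x - d.-1%:Z - y)%:~R :> rat.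
  rewrite e1 !intrD !intrN -!pmulrn; field.
  exact: d0'.
case: i => [|[|i]] /=.
- by case: eqP => _; [exact: aff|rewrite !mulr0 addr0].
- by case: eqP => _; [exact: aff|rewrite !mulr0 addr0].
case: eqP => _; last by rewrite !mulr0 addr0.
rewrite !(mulrCA (_ / _)) -mulrDr; congr (_ * _); case: i => [|i] /=.
  by rewrite e1 -!natr1; field; exact: d0'.
by rewrite mul0n mulr0 add0r !natrM mulrA divfK.
Qed.

Lemma pure_tab_in_cone d0 d1 d2 l : (l < d)%N -> d0 < d1 -> d1 < d2 ->
  cone_gen pure_table (pure_tab d d0 d1 d2 l).
Proof.
move=> ld h1 h2; case: (ltnP 1 d) => d1'; last first.
  have -> : l = 0%N by lia.
  by apply: cone_in; exists d0, d1, d2, 0%N; split=> //; left.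
apply: (@cone_ext _ (fun i j => ((d.-1 - l)%:R / d.-1%:R) * pure_tab d d0 d1 d2 0 i j +
  (l%:R / d.-1%:R) * pure_tab d d0 d1 d2 d.-1 i j)).
  by move=> i j; rewrite -pure_tab_interpolation.
apply: cone_add; (apply: cone_scale; first by rewrite divr_ge0 // ler0n); apply: cone_in.
  by exists d0, d1, d2, 0%N; split=> //; left.
by exists d0, d1, d2, d.-1; split=> //; right.
Qed.

Lemma card_pred_sum (T : finType) (P : pred T) : (#|P|%:R : rat) = \sum_p (P p)%:R.
Proof.
by rewrite -sum1_card natr_sum big_mkcond; apply: eq_bigr => p _; rewrite unfold_in; case: (P p).
Qed.

(** The numerical decomposition of (a, b, e), read as an identity of tables. *)
Lemma betti_decomposition (M : gmod k d) (F : free_res d_gt0 M) :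
  fin_gen M -> finite_length M -> cone_gen pure_table (fun i j => (tor_dim F i j)%:R).
Proof.
move=> fg fl; have [n0 [a [n1 [b [f0 [f1 [[df0 df1] [sf0 ex] u0 u1]]]]]]] := minimal_presentation F fg.
have [r [js [ls [G [ok ad]]]]] := kernel_stage df1 u1.
set st := Stage b js ls G in ok ad.
have fz x : f0 (f1 x) = 0 by apply/ex; exists x.
have min1 := min_entries df1 fz u0.
pose a' q := a q * d%:Z; pose b' p := b p * d%:Z; pose e' := st_e d (st := st).
have hA p : box (fun q => b' p - a' q) (row p (dmx f1)) by apply: dmx_box.
have sA p q : dmx f1 p q != 0 -> a' q < b' p by move=> /min1; rewrite /a' /b' ltr_pM2r.
have [lsd _ _ gmin] := ok.
have fin := presentation_surj df0 df1 ex fl.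
have [bal1 bal2] := balance hA ad d_gt0 fin.
have ib := presentation_bound hA ad sA gmin.
have bal2' : \sum_p (a' p)%:~R + \sum_s (e' s)%:~R = \sum_q (b' q)%:~R :> rat.
  by have := congr1 (fun x : int => x%:~R : rat) bal2; rewrite intrD !rmorph_sum.
have [w [w0 wlt wa wb we]] := pure_decomposition bal1 bal2' ib.
pose T := triple n0 n1 r.
apply: (@cone_ext _ (fun i j => \sum_(t : T) w t * pure_tab d (a t.1.1) (b t.1.2) (js t.2) (ls t.2) i j)); last first.
  apply: cone_sum => // t /wlt /andP[]; rewrite /a' /b' /e' /st_e /= ltr_pM2r // => h1 h2.
  apply: pure_tab_in_cone => //; rewrite -(ltr_pM2r (x := d%:Z)) //; lia.
move=> i j; rewrite (@presentation_tor k d d_gt0 M n0 a f0 st f1 df0 sf0 df1 ex ok ad min1).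
case: i => [|[|i]] /=.
- rewrite card_pred_sum (partition_big (fun t : T => t.1.1) xpredT) //=; apply: eq_bigr => p _.
  case: (eqVneq (a p) j) => [aj|aj]; last first.
    rewrite big1 // => t /eqP tp; rewrite tp eq_sym (negPf aj) mulr0 //.
  rewrite [RHS](wa p); apply: eq_bigr => t /eqP tp.
  by rewrite tp aj eqxx /e' /b' /st_e.
- rewrite card_pred_sum (partition_big (fun t : T => t.1.2) xpredT) //=; apply: eq_bigr => p _.
  case: (eqVneq (b p) j) => [aj|aj]; last first.
    rewrite big1 // => t /eqP tp; rewrite tp eq_sym (negPf aj) mulr0 //.
  rewrite [RHS](wb p); apply: eq_bigr => t /eqP tp.
  by rewrite tp aj eqxx /e' /a' /st_e.
- rewrite natr_sum (partition_big (fun t : T => t.2) xpredT) //=; apply: eq_bigr => s _.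
  case: eqP => sj; last first.
    by rewrite mul0n big1 // => t /eqP ->; case: eqP sj => // _; rewrite mulr0.
  rewrite mul1n -[RHS]mul1r [X in X * _](we s) mulr_suml; apply: eq_bigr => t /eqP ts.
  by rewrite ts sj eqxx mulrA /a' /b' mulrBl.
Qed.

End PureTables.

(** * Cokernels of graded maps *)

Section QuotientModule.
Local Open Scope quotient_scope.
Variables (R : nzRingType) (V : lmodType R) (U : V -> Prop).
Hypothesis U0 : U 0.
Hypothesis UB : forall x y, U x -> U y -> U (x - y).
Hypothesis UZ : forall (b : R) x, U x -> U (b *: x).

Definition sub_pred : {pred V} := fun x => if excluded_middle_informative (U x) then true else false.

Lemma sub_predP x : reflect (U x) (x \in sub_pred).
Proof.
by rewrite unfold_in /sub_pred; case: (excluded_middle_informative (U x)) => h; constructor.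
Qed.

Fact sub_zmod : zmod_closed sub_pred.
Proof.
by split=> [|x y /sub_predP hx /sub_predP hy]; apply/sub_predP; [exact: U0|exact: UB].
Qed.

HB.instance Definition _ := GRing.isZmodClosed.Build V sub_pred sub_zmod.

Let I : zmodClosed V := sub_pred.
Local Notation quot_mod := (Quotient.quot I).
Local Notation proj := (\pi_(quot_mod))%qT.

Definition quot_scale (b : R) (x : quot_mod) : quot_mod := proj (b *: repr x).

Lemma quot_eq (x y : V) : (proj x = proj y :> quot_mod) <-> U (x - y).
Proof.
split=> [/eqP|/sub_predP h]; first by rewrite -Quotient.idealrBE => /sub_predP.
by apply/eqP; rewrite -Quotient.idealrBE.
Qed.

Lemma quot_scale_pi b x : quot_scale b (proj x) = proj (b *: x).
Proof.
apply/quot_eq; rewrite -scalerBr; apply: UZ; apply/quot_eq; exact: reprK.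
Qed.

Lemma quot_repr (x : quot_mod) : exists y, x = proj y.
Proof. by exists (repr x); rewrite reprK. Qed.

Fact quot_scaleA a b x : quot_scale a (quot_scale b x) = quot_scale (a * b) x.
Proof. by have [y ->] := quot_repr x; rewrite !quot_scale_pi scalerA. Qed.
Fact quot_scale1 : left_id 1 quot_scale.
Proof. by move=> x; have [y ->] := quot_repr x; rewrite quot_scale_pi scale1r. Qed.
Lemma quot_addE x y : proj x + proj y = proj (x + y) :> quot_mod.
Proof. exact (esym (@Quotient.pi_add V I x y)). Qed.
Fact quot_scaleDr : right_distributive quot_scale +%R.
Proof.
move=> a x y; have [x' ->] := quot_repr x; have [y' ->] := quot_repr y.
by rewrite quot_addE !quot_scale_pi quot_addE scalerDr.
Qed.
Fact quot_scaleDl x : {morph quot_scale^~ x : a b / a + b}.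
Proof. by move=> a b; have [y ->] := quot_repr x; rewrite !quot_scale_pi quot_addE scalerDl. Qed.

HB.instance Definition _ := GRing.Zmodule_isLmodule.Build R quot_mod
  quot_scaleA quot_scale1 quot_scaleDr quot_scaleDl.

Lemma quotient_exists : exists (Q : lmodType R) (f : {linear V -> Q}),
  (forall y, exists x, f x = y) /\ forall x, f x = 0 <-> U x.
Proof.
pose f (x : V) : quot_mod := proj x.
have fL : linear f by move=> b x y; rewrite /f -quot_addE -quot_scale_pi.
exists quot_mod, (HB.pack f (GRing.isLinear.Build R V quot_mod *:%R f fL) : {linear V -> quot_mod}).
split=> [y|x]; first by exists (repr y); exact: reprK.
have -> : (0 : quot_mod) = proj 0 by symmetry; apply: (@addrI _ (proj 0)); rewrite quot_addE !addr0.
by rewrite -{2}[x]subr0 -quot_eq.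
Qed.
End QuotientModule.

Section Cokernel.
Variables (k : fieldType) (d : nat).

(** A graded map has a graded image. *)
Lemma homog_image (M N : gmod k d) (f : {linear M -> N}) (s : seq int) (c : int -> N) z :
  degree0 f -> uniq s -> (forall j, ghomog j (c j)) -> f z = \sum_(j <- s) c j ->
  forall j, j \in s -> exists y, f y = c j.
Proof.
move=> f0 us hc fz j js; have [s' [c' [us' hc' zE]]] := homog_decomp z.
pose S := undup (s ++ s').
pose g i := (if i \in s then c i else 0) - (if i \in s' then f (c' i) else 0).
have := @ghomog_direct _ _ N S g (undup_uniq _) _ _ j.
rewrite mem_undup mem_cat js /g js => h.
have {}h : c j - (if j \in s' then f (c' j) else 0) = 0.
  apply: h => //.
    move=> i; apply: ghomogB; case: ifP => _; try exact: ghomog0.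
      exact: hc.
    by apply: f0.
  rewrite sumrB.
  have sub (t : seq int) (F : int -> N) : uniq t -> {subset t <= S} ->
      \sum_(i <- S) (if i \in t then F i else 0) = \sum_(i <- t) F i.
    move=> ut tS; rewrite -big_mkcond -big_filter; apply: perm_big.
    apply: uniq_perm => //; first by rewrite filter_uniq // undup_uniq.
    by move=> i; rewrite mem_filter; case: (boolP (i \in t)) => // /tS ->.
  rewrite !sub //; try by move=> i it; rewrite mem_undup mem_cat it ?orbT.
  by rewrite -fz zE linear_sum subrr.
move/eqP: h; rewrite subr_eq0 => /eqP ->.
by case: ifP => _; [exists (c' j)|exists 0; rewrite raddf0].
Qed.

Lemma cokernel_exists (L N : gmod k d) (g : {linear L -> N}) : degree0 g ->
  exists (M : gmod k d) (f : {linear N -> M}),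
    [/\ degree0 f, surjective_map f & exact_at g f].
Proof.
move=> g0; pose U (x : N) := exists y, g y = x.
have [|||Q [f [fs fU]]] := @quotient_exists (vring k d) N U.
- by exists 0; rewrite raddf0.
- by move=> x y [x' <-] [y' <-]; exists (x' - y'); rewrite raddfB.
- by move=> b x [x' <-]; exists (b *: x'); rewrite linearZ.
pose hQ (j : int) (y : Q) := exists2 x : N, ghomog j x & f x = y.
have h0 j : hQ j 0 by exists 0; [exact: ghomog0|rewrite raddf0].
have hB j x y : hQ j x -> hQ j y -> hQ j (x - y).
  by move=> [x' hx <-] [y' hy <-]; exists (x' - y'); [exact: ghomogB|rewrite raddfB].
have hZ i j (b : vring k d) x : vhomog d 0 i (val b) -> hQ j x -> hQ (i + j) (b *: x).
  by move=> hb [x' hx <-]; exists (b *: x'); [exact: ghomogZ|rewrite linearZ].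
have hspan x : exists s : seq (int * Q), (forall t, t \in s -> hQ t.1 t.2) /\ x = \sum_(t <- s) t.2.
  have [x' <-] := fs x; have [s [hs ->]] := ghomog_span x'.
  exists [seq (t.1, f t.2) | t <- s]; split; last by rewrite big_map linear_sum.
  by move=> t /mapP [t' /hs ht ->]; exists t'.2.
have hdir (s : seq int) (c : int -> Q) : uniq s -> (forall j, hQ j (c j)) ->
   \sum_(j <- s) c j = 0 -> forall j, j \in s -> c j = 0.
  move=> us hc sz j js.
  have hc' (i : int) : exists x, ghomog i x /\ f x = c i by have [x hx fx] := hc i; exists x.
  pose x i := proj1_sig (constructive_indefinite_description _ (hc' i)).
  have hx i : ghomog i (x i) /\ f (x i) = c i := proj2_sig (constructive_indefinite_description _ (hc' i)).
  have /fU [z gz] : f (\sum_(i <- s) x i) = 0.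
    by rewrite linear_sum -[RHS]sz; apply: eq_bigr => i _; have [] := hx i.
  have [y gy] := homog_image g0 us (fun i => (hx i).1) gz js.
  by rewrite -(hx j).2; apply/fU; exists y.
exists (GMod h0 hB hZ hspan hdir), f; split=> //.
by move=> j x hx; exists x.
Qed.
End Cokernel.

(** * Polynomial matrices without syzygies of low degree *)

Section PureMatrix.
Variable k : fieldType.
Implicit Types (A : nat -> nat -> {poly k}) (f : nat -> {poly k}).

(** The matrix A of p + q rows and q columns, with entries of degree at most p,
    has no syzygies of degree less than q.  This is the generic behaviour: degree q - 1
    of the source and degree p + q - 1 of the target both have dimension
    (p + q) * q.  The middle condition, on divisibility by
    powers of z, is what makes the Euclidean step from (p, q) to (p, p + q)
    possible. *)
Definition pure_matrix (p q : nat) A :=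
  [/\ forall j i, (j < p + q)%N -> (i < q)%N -> dle p%:Z (A j i),
      forall N f, (forall j, (q <= j < p + q)%N -> 'X^N %| f j) ->
        (forall i, (i < q)%N -> \sum_(j < p + q) f j * A j i = 0) ->
        forall j, (j < q)%N -> 'X^N %| f j
    & forall f, (forall j, (j < p + q)%N -> dle (q%:Z - 1) (f j)) ->
        (forall i, (i < q)%N -> \sum_(j < p + q) f j * A j i = 0) ->
        forall j, (j < p + q)%N -> f j = 0].

Lemma sum_delta n (F : nat -> {poly k}) i : (i < n)%N ->
  \sum_(j < n) F j * (if (j == i :> nat) then 1 else 0) = F i.
Proof.
move=> h; rewrite (bigD1 (Ordinal h)) //= eqxx mulr1 big1 ?addr0 // => j ji.
case: eqP => [e|_]; last by rewrite mulr0.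
by case/eqP: ji; apply: val_inj.
Qed.

Lemma dle_Xmul_zero (q : nat) (x y : {poly k}) : dle (q%:Z - 1) x -> x = - ('X^q * y) -> x = 0 /\ y = 0.
Proof.
move=> hx xE; have x0 : x = 0.
  apply/polyP => m; rewrite coef0; case: (ltnP m q) => h; last by apply: hx; lia.
  by rewrite xE coefN mulrC coefMXn h oppr0.
split=> //; move/eqP: xE; rewrite x0 eq_sym oppr_eq0 mulf_eq0 expf_eq0 polyX_eq0 andbF /=.
by move/eqP.
Qed.

Lemma pure_matrix_base q : pure_matrix 0 q (fun j i => if (j == i) then 1 else 0).
Proof.
split.
- by move=> j i _ _; case: ifP => _; [exact: dleC k 1|exact: dle0].
- move=> N f _ h j jq; have := h j jq; rewrite add0n (sum_delta f) // => ->; exact: dvdp0.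
- move=> f _ h j jq; rewrite add0n in jq; have := h j jq; by rewrite add0n (sum_delta f).
Qed.

(** The step (p, q) -> (p + q, q) stacks the identity on top of z^q A: the first
    q entries of a syzygy f have degree less than q, and are also divisible by
    z^q. *)
Lemma pure_matrix_long p q A : pure_matrix p q A ->
  pure_matrix (q + p) q (fun j i => if (j < q)%N then (if (j == i) then 1 else 0)
                                    else 'X^q * A (j - q)%N i).
Proof.
move=> [h1 h2 h3].
have sumE f i : (i < q)%N -> \sum_(j < q + p + q) f j * (if (j < q)%N then (if (j == i :> nat) then 1 else 0)
      else 'X^q * A (j - q)%N i) = f i + 'X^q * \sum_(j < p + q) f (q + j)%N * A j i.
  move=> iq; rewrite -addnA big_split_ord /=; congr (_ + _).
    by rewrite -[RHS](sum_delta f iq); apply: eq_bigr => j _; rewrite ltn_ord.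
  rewrite mulr_sumr; apply: eq_bigr => j _.
  by rewrite ltnNge leq_addr /= addKn mulrCA.
split.
- move=> j i jq iq; case: ltnP => jq'.
    case: ifP => _; last exact: dle0.
    by apply: dle_le (@dleC k 1).
  have -> : (q + p)%N%:Z = q%:Z + p%:Z by [].
  apply: dleM; [exact: dleX|apply: h1 => //; lia].
- move=> N f hf h i iq; have := h i iq; rewrite sumE // => /eqP; rewrite addr_eq0 => /eqP ->.
  rewrite dvdpNr; apply: dvdp_mull.
  elim/big_ind: _ => [|x y hx hy|j _]; [exact: dvdp0|exact: dvdp_add|].
  by apply: dvdp_mulr; apply: hf; have := ltn_ord j; lia.
- move=> f hf h.
  have key i : (i < q)%N -> f i = 0 /\ \sum_(j < p + q) f (q + j)%N * A j i = 0.
    move=> iq; apply: (@dle_Xmul_zero q); first by apply: hf; lia.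
    by have := h i iq; rewrite sumE // => /eqP; rewrite addr_eq0 => /eqP.
  move=> j jq; case: (ltnP j q) => jq'; first by have [] := key j jq'.
  have := h3 (fun j => f (q + j)%N) _ _ (j - q)%N; rewrite subnKC //; apply; last by lia.
    by move=> j' hj'; apply: hf; lia.
  by move=> i iq; have [] := key i iq.
Qed.

(** The step (p, q) -> (p, p + q) adjoins p columns with relations
    f i = - z^p * f (i + p).  They make f i divisible by z^p for q <= i < p + q,
    the middle condition extends this to all i < p + q, and after division by
    z^p the degree is small enough for A. *)
Lemma pure_matrix_short p q A : pure_matrix p q A ->
  pure_matrix p (p + q) (fun j i =>
    if (j < p + q)%N then (if (i < q)%N then A j i else if (j == i) then 1 else 0)
    else if (i < q)%N then 0 else if (j == i + p)%N then 'X^p else 0).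
Proof.
move=> [h1 h2 h3]; set A' := (fun j i => _).
have sumlow f i : (i < q)%N -> \sum_(j < p + (p + q)) f j * A' j i = \sum_(j < p + q) f j * A j i.
  move=> iq; rewrite addnC big_split_ord /= [X in _ + X]big1 ?addr0 => [|j _]; last first.
    by rewrite /A' ltnNge leq_addr /= iq mulr0.
  by apply: eq_bigr => j _; rewrite /A' ltn_ord iq.
have sumhigh f i : (q <= i < p + q)%N -> \sum_(j < p + (p + q)) f j * A' j i = f i + 'X^p * f (i + p)%N.
  move=> /andP[qi ip]; rewrite addnC big_split_ord /=; congr (_ + _).
    rewrite -[RHS](sum_delta f ip); apply: eq_bigr => j _.
    by rewrite /A' ltn_ord ltnNge qi.
  transitivity (\sum_(j < p) (f (p + q + j)%N * 'X^p) * (if (j == i - q :> nat)%N then 1 else 0)).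
    apply: eq_bigr => j _; rewrite /A' ltnNge leq_addr /= ltnNge qi /= -mulrA; congr (_ * _).
    have -> : (p + q + j == i + p)%N = (j == i - q :> nat)%N by lia.
    by case: eqP; rewrite ?mulr1 ?mulr0.
  rewrite (sum_delta (fun j => f (p + q + j)%N * 'X^p)); last by lia.
  by rewrite mulrC; congr (_ * f _); lia.
split.
- move=> j i jq iq; rewrite /A'; case: ltnP => jq'; case: ltnP => iq'.
  + exact: h1.
  + by case: ifP => _; [apply: dle_le (@dleC k 1)|exact: dle0].
  + exact: dle0.
  + by case: ifP => _; [exact: dleX|exact: dle0].
- move=> N f hf h.
  have high i : (q <= i < p + q)%N -> 'X^N %| f i.
    move=> /andP[qi ip]; have := h i ip; rewrite sumhigh ?qi // => /eqP; rewrite addr_eq0 => /eqP ->.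
    by rewrite dvdpNr; apply: dvdp_mull; apply: hf; lia.
  have low := h2 N f high (fun i iq => etrans (esym (sumlow f i iq)) (h i (ltn_addl p iq))).
  move=> j jpq; case: (ltnP j q) => jq; [exact: low|by apply: high; rewrite jq].
- move=> f hf h.
  have rel i : (q <= i < p + q)%N -> f i = - ('X^p * f (i + p)%N).
    move=> qi; have /andP[_ ip] := qi.
    by have := h i ip; rewrite sumhigh // => /eqP; rewrite addr_eq0 => /eqP.
  have high i : (q <= i < p + q)%N -> 'X^p %| f i.
    by move=> /rel ->; rewrite dvdpNr; apply: dvdp_mulIl.
  have sl i : (i < q)%N -> \sum_(j < p + q) f j * A j i = 0.
    by move=> iq; rewrite -sumlow // h // ltn_addl.
  have low := h2 p f high sl.
  have dv j : (j < p + q)%N -> f j = (f j %/ 'X^p) * 'X^p.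
    move=> jpq; rewrite divpK //; case: (ltnP j q) => jq; [exact: low|by apply: high; rewrite jq].
  have f0 j : (j < p + q)%N -> f j = 0.
    move=> jpq; rewrite dv // (h3 (fun j => f j %/ 'X^p)) ?mul0r // => {j jpq}.
      move=> j jpq m hm.
      have : (f j)`_(m + p) = 0 by apply: hf; [lia|rewrite PoszD; lia].
      by rewrite {1}(dv j) // coefMXn ltnNge leq_addl /= addnK.
    move=> i iq; apply: (@mulIf _ ('X^p)); first by rewrite expf_neq0 ?polyX_eq0.
    rewrite mul0r -[RHS](sl i iq) mulr_suml; apply: eq_bigr => j _.
    by rewrite mulrAC -dv.
  move=> j jpq; case: (ltnP j (p + q)) => jq; first exact: f0.
  have := rel (j - p)%N; rewrite f0; last by lia.
  rewrite subnK; last by lia.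
  move=> /(_ _) /esym/eqP; rewrite oppr_eq0 mulf_eq0 expf_eq0 polyX_eq0 andbF /= => e.
  by apply/eqP; apply: e; lia.
Qed.

(** Euclid's algorithm on (p, q). *)
Lemma pure_matrix_exists p q : exists A, pure_matrix p q A.
Proof.
have [n] : exists n, (p + q < n)%N by exists (p + q).+1.
elim: n p q => // n IH p q hn.
case: p hn => [|p] hn; first by eexists; apply: pure_matrix_base.
case: q hn => [|q] hn.
  exists (fun _ _ => 0); split=> // f hf _ j jp.
  by apply: dle_neg (hf j jp).
case: (leqP q.+1 p.+1) => pq.
  have [A hA] : exists A, pure_matrix (p.+1 - q.+1) q.+1 A by apply: IH; lia.
  by have := pure_matrix_long hA; rewrite subnKC //; eexists; eassumption.
have [A hA] : exists A, pure_matrix p.+1 (q.+1 - p.+1) A by apply: IH; lia.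
by have := pure_matrix_short hA; rewrite subnKC ?(ltnW pq) //; eexists; eassumption.
Qed.

Lemma bdim_const n (c : int) : 0 <= c + 1 -> bdim (fun _ : 'I_n => c) = (n * absz (c + 1)%R)%N.
Proof.
by move=> c0; rewrite /bdim sum_nat_const card_ord; congr (_ * absz _)%N; lia.
Qed.

Lemma pure_matrix_inj p q (A : nat -> nat -> {poly k}) (D : 'M[{poly k}]_(p + q, q)) :
  pure_matrix p q A -> (forall j i, D j i = A j i) ->
  forall v, box (fun=> q%:Z - 1) v -> v *m D = 0 -> v = 0.
Proof.
move=> [h1 _ h3] DA v hv vD.
pose f j := if (insub j : option 'I_(p + q)) is Some j' then v 0 j' else 0.
have fE (j : 'I_(p + q)) : f j = v 0 j by rewrite /f valK.
apply/rowP => j; rewrite mxE -fE; apply: h3 => //.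
  by move=> j' hj'; rewrite -[j']/(val (Ordinal hj')) fE; apply: hv.
move=> i iq; move/rowP/(_ (Ordinal iq)): vD; rewrite !mxE => e; rewrite -[RHS]e.
by apply: eq_bigr => j' _; rewrite fE DA.
Qed.

(** For t = p + q - 1 the map is injective between spaces of equal dimension.
    In larger degrees one removes the leading terms. *)
Lemma pure_matrix_surj p q (A : nat -> nat -> {poly k}) (D : 'M[{poly k}]_(p + q, q)) :
  (0 < q)%N -> pure_matrix p q A -> (forall j i, D j i = A j i) ->
  forall (t : int), (p + q)%N%:Z - 1 <= t -> forall w, box (fun=> t) w ->
  exists2 v, box (fun=> t - p%:Z) v & v *m D = w.
Proof.
move=> q0 pm DA; have [h1 _ h3] := pm.
have Dbox v (c : int) : box (fun=> c) v -> box (fun=> c + p%:Z) (v *m D).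
  move=> hv i; rewrite mxE; apply: dle_sum => j _; rewrite DA.
  by apply: dleM => //; apply: h1.
have inj := pure_matrix_inj pm DA.
have base w : box (fun=> (p + q)%N%:Z - 1) w -> exists2 v, box (fun=> q%:Z - 1) v & v *m D = w.
  apply: (@box_surj k _ _ (fun=> q%:Z - 1) (fun=> (p + q)%N%:Z - 1) D) => //.
    by move=> v hv; have := Dbox v _ hv; have -> : q%:Z - 1 + p%:Z = (p + q)%N%:Z - 1 by lia.
  have e1 : absz ((p + q)%N%:Z - 1 + 1)%R = (p + q)%N by lia.
  have e2 : absz (q%:Z - 1 + 1)%R = q by lia.
  rewrite !bdim_const ?e1 ?e2; [by rewrite mulnC|lia|lia].
move=> t ht w hw.
have [m tm] : exists m : nat, t = (p + q)%N%:Z - 1 + m%:Z by exists (absz (t - ((p + q)%N%:Z - 1))%R); lia.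
elim: m t tm ht w hw => [|m IH] t tm ht w hw.
  have e1 : t = (p + q)%N%:Z - 1 by lia.
  have [|v hv vD] := base w; first by rewrite -e1.
  exists v => // i; apply: dle_le (hv i); lia.
pose c := \row_i coefz (w 0 i) t.
(* the leading terms of w, moved down to degree p + q - 1 *)
pose w1 : 'rV[{poly k}]_q := \row_i ((c 0 i)%:P * 'X^((p + q).-1)).
have hw1 : box (fun=> (p + q)%N%:Z - 1) w1.
  move=> i; rewrite mxE mul_polyC; apply: dleZ; apply: dle_le (@dleX k _); lia.
have [v1 hv1 v1D] := base _ hw1.
have hw2 : box (fun=> t - 1) (w - 'X^(m.+1) *: v1 *m D).
  rewrite -scalemxAl v1D => i; rewrite !mxE.
  have et : t = (m.+1 + (p + q).-1)%N%:Z by lia.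
  apply: dle_top.
    apply: dleB; first exact: hw.
    by rewrite mul_polyC -scalerAr -exprD et; apply: dleZ; apply: dleX.
  rewrite coefzB mul_polyC -scalerAr -exprD; apply/eqP; rewrite subr_eq0; apply/eqP.
  by rewrite et /= coefZ coefXn eqxx mulr1.
have [||v2 hv2 v2D] := IH (t - 1) _ _ _ hw2; [lia|lia|].
exists (v2 + 'X^(m.+1) *: v1); last by rewrite mulmxDl v2D subrK.
apply: boxD => i; first by apply: dle_le (hv2 i); lia.
have -> : t - p%:Z = m.+1%:Z + (q%:Z - 1) by lia.
by rewrite mxE; apply: dleM => //; apply: dleX.
Qed.

End PureMatrix.

(** * A criterion for finite length *)

Section FiniteLength.
Variables (k : fieldType) (d : nat).
Hypothesis d_gt0 : (0 < d)%N.
Local Notation B := (vring k d).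
Implicit Types M : gmod k d.

(** Choose one vector in each step of a strict chain.  By dimension these
    vectors are linearly dependent, and a relation puts the last of them into the
    preceding submodule. *)
Lemma finite_span_finite_length M (n : nat) (x : 'I_n -> M) :
  (forall y : M, exists c : 'I_n -> k, y = \sum_i vconst d (c i) *: x i) -> finite_length M.
Proof.
move=> span; exists n => U subU chain.
have mono i j : (i <= j)%N -> (j <= n.+1)%N -> forall y, U i y -> U j y.
  elim: j => [|j IH]; first by rewrite leqn0 => /eqP ->.
  rewrite leq_eqVlt => /orP[/eqP -> //|ij] jn y /(IH ij (ltnW jn) y).
  by have [h _] := chain j jn; apply: h.
have /fin_all_exists [y hy] : forall i : 'I_n.+1, exists y, U i.+1 y /\ ~ U i y.
  by move=> i; have [_] := chain i (ltn_ord i).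
have /fin_all_exists [c hc] : forall i, exists c : 'I_n -> k, y i = \sum_j vconst d (c j) *: x j.
  by move=> i; apply: span.
pose C : 'M[k]_(n.+1, n) := \matrix_(i, j) c i j.
have /rowV0Pn [u /sub_kermxP uC u0] : kermx C != 0.
  by rewrite -mxrank_eq0 mxrank_ker subn_eq0 -ltnNge ltnS rank_leq_col.
have rel : \sum_i vconst d (u 0 i) *: y i = 0.
  transitivity (\sum_i \sum_j vconst d (u 0 i * c i j) *: x j).
    apply: eq_bigr => i _; rewrite hc scaler_sumr; apply: eq_bigr => j _.
    by rewrite scalerA; congr (_ *: _); apply: val_inj; rewrite /= mpolyCM.
  rewrite exchange_big big1 // => j _; rewrite -scaler_suml.
  have -> : \sum_i vconst d (u 0 i * c i j) = vconst d ((u *m C) 0 j).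
    apply: val_inj; rewrite !mxE raddf_sum /= raddf_sum; apply: eq_bigr => i _.
    by rewrite mxE.
  rewrite uC mxE (_ : vconst d 0 = 0) ?scale0r //; apply: val_inj; exact: mpolyC0.
have [i0 ui0] : exists i, u 0 i != 0.
  apply/existsP; apply: contraNT u0; rewrite negb_exists => /forallP h.
  by apply/eqP/rowP => i; rewrite mxE; apply/eqP; have := h i; rewrite negbK.
have [i ui imax] := @arg_maxnP _ i0 (fun i => u 0 i != 0) (fun i => i : nat) ui0.
have [_ ni] := hy i; apply: ni.
have [U0 UD UZ] := subU i.
have -> : y i = vconst d (- (u 0 i)^-1) *: \sum_(j | j != i) vconst d (u 0 j) *: y j.
  have /eqP := rel; rewrite (bigD1 i isT) /= addrC addr_eq0 => /eqP ->.
  rewrite scalerN -scaleNr scalerA.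
  have -> : - vconst d (- (u 0 i)^-1) * vconst d (u 0 i) = 1.
    by apply: val_inj; rewrite /= -mpolyCN opprK -mpolyCM mulVf.
  by rewrite scale1r.
apply: (UZ); elim/big_ind: _ => // j ji; case: (eqVneq (u 0 j) 0) => [->|uj].
  rewrite (_ : vconst d 0 = 0) ?scale0r //; apply: val_inj; exact: mpolyC0.
apply: (UZ); have [hj _] := hy j; apply: mono hj; last by rewrite ltnW // ltnS ltnW.
by rewrite ltn_neqAle -val_eqE in ji *; rewrite ji; apply: imax.
Qed.

Definition vmon (m : 'X_{1..2}) : B := insubd (0 : B) 'X_[m].

Lemma vmonE m : (d %| mdeg m)%N -> val (vmon m) = 'X_[m].
Proof.
move=> dm; rewrite insubdK //; apply/vdegP => m'; rewrite msuppX inE => /eqP ->.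
by rewrite subn0.
Qed.

Lemma vring_expand (b : B) :
  b = \sum_(m <- msupp (val b)) vconst d (val b)@_m * vmon m.
Proof.
apply: val_inj; rewrite raddf_sum [LHS]mpolyE; apply: eq_big_seq => m mb.
have := vdegP _ _ _ (valP b) m mb; rewrite subn0 => /= dm.
have := vmonE dm => /= e; by rewrite /= e mul_mpolyC.
Qed.

Lemma monomial_sum M (b : B) (y : M) (K : nat) :
  (forall m, (d %| mdeg m)%N -> (K <= mdeg m)%N -> vmon m *: y = 0) ->
  b *: y = \sum_(m : 'X_{1..2 < K}) vconst d (val b)@_m *: (vmon m *: y).
Proof.
move=> hK; pose G m := vconst d (val b)@_m *: (vmon m *: y).
have G0 m : m \notin msupp (val b) -> G m = 0.
  move=> mb; rewrite /G (_ : vconst d _ = 0) ?scale0r //; apply: val_inj => /=.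
  by move/eqP: (mcoeff_eq0 (val b) m); rewrite mb => /eqP/eqP ->; rewrite mpolyC0.
transitivity (\sum_(m <- msupp (val b)) G m).
  by rewrite {1}[b]vring_expand scaler_suml; apply: eq_bigr => m _; rewrite -scalerA.
transitivity (\sum_(m <- [seq val m | m : 'X_{1..2 < K}]) G m); last first.
  by rewrite big_map big_enum.
rewrite (bigID (fun m => mdeg m < K)%N) /= [X in _ + X]big_seq_cond [X in _ + X]big1 ?addr0; last first.
  move=> m /andP[/(vdegP _ _ _ (valP b)) h]; rewrite -leqNgt => mK.
  by move: h; rewrite subn0 => /= dm; rewrite /G hK ?scaler0.
rewrite [RHS](bigID (mem (msupp (val b)))) /= [X in _ = _ + X]big1 ?addr0 => [|m]; last exact: G0.
rewrite -big_filter -[RHS]big_filter; apply: perm_big; apply: uniq_perm.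
- by rewrite filter_uniq.
- rewrite filter_uniq // map_inj_uniq ?enum_uniq //; exact: val_inj.
move=> m; rewrite !mem_filter andbC; congr (_ && _).
apply/idP/mapP => [mK|[m' _ ->]]; last exact: bmdeg.
by exists (BMultinom mK) => //; rewrite mem_enum.
Qed.

(** Only finitely many monomials act nontrivially on the generators, so M is
    finite dimensional over k. *)
Lemma bounded_finite_length M n (a : 'I_n -> int) (x : 'I_n -> M) (N : nat) :
  (forall q, ghomog (a q) (x q)) ->
  (forall y : M, exists b : 'I_n -> B, y = \sum_q b q *: x q) ->
  (forall j : nat, (N <= j)%N -> forall y : M, ghomog j%:Z y -> y = 0) -> finite_length M.
Proof.
move=> hx gen hN.
pose K := ((N + \sum_q absz (a q)) * d)%N.
have hK q m : (d %| mdeg m)%N -> (K <= mdeg m)%N -> vmon m *: x q = 0.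
  move=> dm Km.
  have hm : vhomog d 0 (mdeg m %/ d)%N (val (vmon m)).
    by rewrite vmonE //= addn0 divnK // dhomogX.
  have := ghomogZ hm (hx q).
  have [j [Nj ->]] : exists j : nat, (N <= j)%N /\ (mdeg m %/ d)%N%:Z + a q = j.
    have h : (N + absz (a q) <= mdeg m %/ d)%N.
      rewrite leq_divRL //; apply: leq_trans Km; rewrite leq_mul2r; apply/orP; right.
      by rewrite leq_add2l (bigD1 q) //= leq_addr.
    exists (absz ((mdeg m %/ d)%N%:Z + a q)%R); lia.
  by move=> h; apply: hN h.
pose I := ('I_n * 'X_{1..2 < K})%type.
pose z (i : 'I_#|{: I}|) : M := 
  vmon (enum_val i : I).2 *: x (enum_val i : I).1.
apply: (@finite_span_finite_length M #|{: I}| z) => y.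
have [b ->] := gen y.
exists (fun i => (val (b (enum_val i : I).1))@_(val (enum_val i : I).2)).
rewrite -(big_enum_val (A := {: I}) (fun i : I => vconst d (val (b i.1))@_i.2 *: (vmon i.2 *: x i.1))) /=.
rewrite -(pair_big xpredT xpredT (fun q (m : 'X_{1..2 < K}) => vconst d (val (b q))@_m *: (vmon m *: x q))) /=.
by apply: eq_bigr => q _; apply: monomial_sum => m; apply: hK.
Qed.

End FiniteLength.

(** * Maps from sums of Veronese modules *)

Section VeroneseSums.
Variables (k : fieldType) (d : nat).
Hypothesis d_gt0 : (0 < d)%N.
Local Notation B := (vring k d).
Local Notation free := (gfree k d_gt0).
Variables (l r : nat) (d2 : int).
Hypothesis ld : (l < d)%N.
Local Notation E2 := (gsum (gver k d_gt0 l) (fun _ : 'I_r => - d2)).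
Local Notation V := (vmod k d l).

Definition evec (x : E2) : 'rV[{poly k}]_r := \row_s dehom (val (x s : V)).

Lemma evec_lift j w : box (fun=> j * d%:Z - (d2 * d%:Z - l%:Z)) w ->
  exists2 x : E2, ghomog j x & evec x = w.
Proof.
move=> hw; have /fin_all_exists2 [x hx xE] : forall s, exists2 x : V, vhomog d l (- d2 + j) (val x) & dehom (val x) = w 0 s.
  move=> s; have [|p hp pE] := @vhomog_lift k d l (- d2 + j) (w 0 s) ld.
    by have -> : (- d2 + j) * d%:Z + l%:Z = j * d%:Z - (d2 * d%:Z - l%:Z) by ring.
  have pV : p \in vdeg_pred k d l.
    by move: (- d2 + j) hp => [m|m] hp; [apply: vhomog_vdeg hp|rewrite (eqP hp) rpred0].
  by exists (VMod pV).
exists [ffun s => x s]; first by move=> s; rewrite ffunE; apply: hx.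
by apply/rowP => s; rewrite mxE ffunE xE.
Qed.

Lemma evec_inj j (x : E2) : ghomog j x -> evec x = 0 -> x = 0.
Proof.
move=> hx /rowP x0; apply/ffunP => s; rewrite ffunE; apply: val_inj.
by apply: (vhomog_inj (hx s)); have := x0 s; rewrite !mxE.
Qed.

Lemma evec_box j (x : E2) : ghomog j x -> box (fun=> j * d%:Z - (d2 * d%:Z - l%:Z)) (evec x).
Proof.
move=> hx s; rewrite mxE; have -> : j * d%:Z - (d2 * d%:Z - l%:Z) = (- d2 + j) * d%:Z + l%:Z by ring.
exact: vhomog_dle (hx s).
Qed.

Definition summand s (y : V) : E2 := [ffun q => if q == s then y else 0].

Lemma summand_sum (x : E2) : x = \sum_s summand s (x s).
Proof.
apply/ffunP => q; rewrite sum_ffunE (bigD1 q isT) /= big1 => [|s sq].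
  by rewrite ffunE eqxx addr0.
by rewrite ffunE eq_sym (negPf sq).
Qed.

Lemma summandZ s (b : B) y : summand s (b *: y) = b *: summand s y.
Proof. by apply/ffunP => q; rewrite !ffunE; case: eqP => _ //; rewrite scaler0. Qed.

Fact vpow_proof (i : 'I_2) : 'X_i ^+ l \in vdeg_pred k d l.
Proof.
apply: (@vhomog_vdeg k d l 0); rewrite /= mul0n add0n mpolyXn dhomogX /=.
by rewrite mdegMn mdeg1 mul1n.
Qed.
Definition vpow i : V := VMod (vpow_proof i).

Lemma vpow_homog i s : ghomog d2 (summand s (vpow i)).
Proof.
move=> q; rewrite addNr ffunE; case: eqP => _; last exact: vhomog0.
by rewrite /= mul0n add0n mpolyXn dhomogX /= mdegMn mdeg1 mul1n.
Qed.

Lemma dehom_X0 : dehom ('X_0 : {mpoly k[2]}) = 1.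
Proof. by rewrite dehomX mnm1E. Qed.
Lemma dehom_X1 : dehom ('X_1 : {mpoly k[2]}) = 'X.
Proof. by rewrite dehomX mnm1E. Qed.

Section Maps.
Variables (n1 : nat) (b : 'I_n1 -> int) (f2 : {linear E2 -> free b}).

(** A B-linear map out of M^(l) is multiplication by an element of the fraction
    field; after dehomogenization it is the value at x^l, which becomes 1. *)
Definition emx : 'M[{poly k}]_(r, n1) := \matrix_s dvec (f2 (summand s (vpow 0))).

(** Multiply y by x^(d - l) to get an element of B: by linearity,
    x^d f2(y) = x^(d - l) y f2(x^l), and x becomes 1. *)
Lemma dvec_summand s y : dvec (f2 (summand s y)) = dehom (val y) *: row s emx.
Proof.
have cyB : 'X_0 ^+ (d - l) * val y \in vdeg_pred k d 0.
  apply/vdegP => m /msuppM_le /allpairsP [[m1 m2] /= [h1 h2 ->]].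
  have /andP[lm dm] := vdegP _ _ _ (valP y) m2 h2.
  move: h1; rewrite mpolyXn msuppX inE => /eqP ->.
  rewrite mdegD mdegMn mdeg1 mul1n subn0 /=.
  rewrite -(subnKC lm) addnA subnK ?(ltnW ld) //.
  by rewrite dvdn_addr.
have xB : 'X_0 ^+ d \in vdeg_pred k d 0.
  apply/vdegP => m; rewrite mpolyXn msuppX inE => /eqP ->.
  by rewrite mdegMn mdeg1 mul1n subn0 /=.
(* both sides are x^d y in the summand s *)
have e : VRing xB *: summand s y = VRing cyB *: summand s (vpow 0).
  rewrite -!summandZ; congr summand; apply: val_inj => /=.
  by rewrite mulrAC -exprD subnK ?(ltnW ld).
have f2Z (c : B) x : dvec (f2 (c *: x)) = dehom (val c) *: dvec (f2 x).
  by rewrite -dvecZ; congr dvec; exact: linearZ.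
have dX n : dehom ('X_0 ^+ n : {mpoly k[2]}) = 1 by rewrite rmorphXn /= dehom_X0 expr1n.
have xE : dehom (val (VRing xB)) = 1 by exact: dX.
have cyE : dehom (val (VRing cyB)) = dehom (val y).
  transitivity (dehom ('X_0 ^+ (d - l) : {mpoly k[2]}) * dehom (val y)); first exact: rmorphM.
  by rewrite dX mul1r.
rewrite rowK -[LHS]scale1r -xE -cyE; rewrite -[LHS]f2Z -[RHS]f2Z.
by rewrite e.
Qed.

Lemma dvec_emx x : dvec (f2 x) = evec x *m emx.
Proof.
rewrite {1}[x]summand_sum linear_sum dvec_sum mulmx_sum_row; apply: eq_bigr => s _.
by rewrite dvec_summand mxE.
Qed.

(** The entries lie in S-degree d2 * d - b p * d, as x^l has degree d2; the bound
    improves by l since the value at y^l is z^l times the value at x^l. *)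
Lemma emx_box : degree0 f2 -> forall s, box (fun p => d2 * d%:Z - l%:Z - b p * d%:Z) (row s emx).
Proof.
move=> df2 s p m hm.
have /(_ p (m + l)%N) := dvec_box (df2 _ _ (vpow_homog 1 s)).
rewrite dvec_summand mxE /= rmorphXn /= dehom_X1 coefXnM ltnNge leq_addl /= addnK; apply.
by rewrite PoszD; lia.
Qed.

(** Exactness gives the adapted basis property in the degrees t that are
    multiples of d.  For other t, multiply by a power z^m to reach the next
    multiple, and compare with the representation of the vector itself. *)
Lemma emx_adapted n0 (a : 'I_n0 -> int) (f1 : {linear free b -> free a}) :
  degree0 f2 -> degree0 f1 -> injective f2 -> exact_at f2 f1 ->
  adapted_basis (fun p => b p * d%:Z) (dmx f1) (fun=> d2 * d%:Z - l%:Z) emx.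
Proof.
move=> df2 df1 f2I ex.
have inj (f : 'rV_r) : f *m emx = 0 -> f = 0.
  move=> fe; pose n := (\sum_s size (f 0%R s))%N.
  have hf : box (fun=> (d2 + n%:Z) * d%:Z - (d2 * d%:Z - l%:Z)) f.
    move=> s; apply: dle_le (@dle_size k _).
    have -> : (d2 + n%:Z) * d%:Z - (d2 * d%:Z - l%:Z) = n%:Z * d%:Z + l%:Z by ring.
    have : (size (f 0%R s) <= n * d)%N.
      by apply: leq_trans (leq_pmulr n d_gt0); rewrite /n (bigD1 s) //= leq_addr.
    by rewrite -PoszM -PoszD lez_nat => h; apply: leq_trans h (leq_addr _ _).
  have [x hx xE] := evec_lift hf; rewrite -xE (_ : x = 0).
    by apply/rowP => s; rewrite !mxE ffunE /= raddf0.
  apply: f2I; rewrite raddf0; apply: (dvec_inj (df2 _ _ hx)).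
  by rewrite dvec_emx xE.
split=> //.
- exact: emx_box.
- apply/row_matrixP => s; rewrite row_mul rowK -dvec_map row0.
  have -> : f1 (f2 (summand s (vpow 0))) = 0 by apply/ex; exists (summand s (vpow 0)).
  exact: dvec0.
move=> t v hv vD.
have [j [m jt]] : exists (j : int) (m : nat), j * d%:Z = t + m%:Z.
  by exists ((t %/ d%:Z)%Z + 1), (absz (d%:Z - (t %% d%:Z)%Z)%R); lia.
have lift (w : 'rV_n1) : box (fun p => j * d%:Z - b p * d%:Z) w -> w *m dmx f1 = 0 ->
    exists2 f, box (fun=> j * d%:Z - (d2 * d%:Z - l%:Z)) f & w = f *m emx.
  move=> hw wD; have [y hy yE] := dvec_lift d_gt0 hw.
  have /ex [x fx] : f1 y = 0.
    by apply: (dvec_inj (df1 _ _ hy)); rewrite dvec_map yE.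
  have [x' hx' fx'] := homog_preimage df2 hy fx.
  by exists (evec x'); [exact: evec_box|rewrite -dvec_emx fx' yE].
(* f represents v with the weaker bound for degree j, f' represents z^m v with
   the bound for degree j; they satisfy f' = z^m f *)
have [|//|f hf fE] := lift v; first by move=> p; apply: dle_le (hv p); lia.
have [||f' hf' fE'] := lift ('X^m *: v).
- move=> p; rewrite mxE; have -> : j * d%:Z - b p * d%:Z = m%:Z + (t - b p * d%:Z) by lia.
  by apply: dleM => //; apply: dleX.
- by rewrite -scalemxAl vD scaler0.
exists f => // s.
have /rowP/(_ s) : f' - 'X^m *: f = 0.
  by apply: inj; rewrite mulmxBl -scalemxAl -fE -fE' subrr.
rewrite !mxE => /eqP; rewrite subr_eq0 => /eqP fs i hi.
have := hf' s (i + m)%N; rewrite fs coefXnM ltnNge leq_addl /= addnK; apply.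
by rewrite PoszD; lia.
Qed.
End Maps.
End VeroneseSums.

(** * Betti tables of pure resolutions *)

Section PureBetti.
Variables (k : fieldType) (d : nat).
Hypothesis d_gt0 : (0 < d)%N.

(** In a pure resolution f2 is the adapted basis of the kernel of f1, so the
    general formula for the table applies, and the balance equations determine
    the ranks up to a common factor. *)
Lemma pure_res_betti (M : gmod k d) d0 d1 d2 l : d0 < d1 -> d1 < d2 -> (l < d)%N ->
  finite_length M -> nonzero_module M -> has_pure_res d_gt0 M d0 d1 d2 l ->
  exists2 c : rat, 0 < c & (exists F : free_res d_gt0 M, True) /\
    forall (F : free_res d_gt0 M) i j, (tor_dim F i j)%:R = c * pure_tab d d0 d1 d2 l i j.
Proof.
move=> h01 h12 ld fl [x x0] [n0 [n1 [r [f2 [f1 [f0 [[df2 df1 df0] [f2I ex2 ex1 sf0] _]]]]]]].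
have ad := emx_adapted ld df2 df1 f2I ex2.
set e : int := d2 * d%:Z - l%:Z in ad.
have h1e : d1 * d%:Z < e by rewrite /e; nia.
have h01' : d0 * d%:Z < d1 * d%:Z by rewrite ltr_pM2r.
pose st := @Stage k n1 (fun=> d1) r (fun=> d2) (fun=> l) (emx f2).
have ok : stage_ok d st.
  have [h1 h2 h3 h4] := ad; split=> //.
have min1 p q : dmx f1 p q != 0 -> d0 < d1 by [].
have n0_gt0 : (0 < n0)%N.
  rewrite lt0n; apply/eqP => n00; case: x0; have [y <-] := sf0 x.
  have -> : y = 0 by apply/ffunP => p; exfalso; have := leq_ltn_trans (leq0n p) (ltn_ord p); rewrite [X in (_ < X)%N -> _]n00.
  exact: raddf0.
have fin := presentation_surj df0 df1 ex1 fl.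
have [bal1 bal2] := balance (dmx_box df1) ad d_gt0 fin.
have q0 : 0 < e - d1 * d%:Z by rewrite subr_gt0.
have natE (z : int) (n : nat) : z *+ n = n%:Z * z by rewrite -mulr_natl natz.
move: bal2; rewrite !sumr_const !card_ord -bal1 !natE => bal2.
have rq : n0%:Z * (d1 * d%:Z - d0 * d%:Z) = r%:Z * (e - d1 * d%:Z).
  by move: bal2; rewrite PoszD => h; lia.
have q1 : (e - d1 * d%:Z)%:~R != 0 :> rat by rewrite intr_eq0 gt_eqF.
exists (n0%:R / (e - d1 * d%:Z)%:~R); first by rewrite divr_gt0 ?ltr0n ?ltr0z.
split; first by exists (@presentation_res k d d_gt0 M n0 (fun=> d0) f0 st f1 df0 sf0 df1 ex1 ok ad).
move=> F i j.
rewrite (@presentation_tor k d d_gt0 M n0 (fun=> d0) f0 st f1 df0 sf0 df1 ex1 ok ad min1).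
have rE : r%:R = n0%:R / (e - d1 * d%:Z)%:~R * ((d1 - d0) * d%:Z)%:~R :> rat.
  apply: (mulIf q1); rewrite mulrAC divfK //.
  by rewrite !pmulrn -!intrM; congr (_%:~R); rewrite -rq; ring.
have cE n (P : pred 'I_n) (b : bool) : P =1 (fun=> b) -> #|P| = (n * b)%N.
  move=> Pb; case: b Pb => Pb; last by rewrite muln0; apply: eq_card0.
  by rewrite muln1 -[RHS]card_ord; apply: eq_card.
case: i => [|[|i]] /=.
- rewrite (cE _ _ (d0 == j)) // eq_sym natrM; case: eqP => _; rewrite ?mulr0 ?mulr1 //.
  by rewrite -/e divfK.
- rewrite (cE _ _ (d1 == j)) // eq_sym natrM; case: eqP => _; rewrite ?mulr0 ?mulr1 //.
  have -> : (d2 * d%:Z - l%:Z - d0 * d%:Z)%:~R = (e - d1 * d%:Z)%:~R + ((d1 - d0) * d%:Z)%:~R :> rat.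
    by rewrite -intrD; congr (_%:~R); rewrite /e; ring.
  by rewrite -bal1 natrD rE mulrDr divfK.
- rewrite sum_nat_const card_ord natrM -/e.
  by case: eqP => _; rewrite ?mul0n ?mulr0 // mul1n rE mulrA.
Qed.

End PureBetti.

(** * Existence of modules with pure resolutions *)

Section Multiplication.
Variables (k : fieldType) (d : nat).
Hypothesis d_gt0 : (0 < d)%N.
Local Notation B := (vring k d).
Local Notation free := (gfree k d_gt0).
Variables (l : nat).
Local Notation V := (vmod k d l).

Section Form.
Variables (t : nat) (g : {mpoly k[2]}).
Hypotheses (g_homog : g \is t.-homog) (td : (d %| l + t)%N).

Fact mul_form_proof (y : V) : val y * g \in vdeg_pred k d 0.
Proof.
apply/vdegP => m /msuppM_le /allpairsP [[m1 m2] /= [h1 h2 ->]].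
have /andP[lm dm] := vdegP _ _ _ (valP y) m1 h1.
rewrite mdegD (dhomogP _ _ _ g_homog m2 h2) /= subn0.
by rewrite -(subnK lm) -addnA dvdn_add.
Qed.
(** A form of degree t with l + t divisible by d acts as a map M^(l) -> B. *)
Definition mul_form (y : V) : B := VRing (mul_form_proof y).

Lemma mul_form_linear (c : B) y z : mul_form (c *: y + z) = c * mul_form y + mul_form z.
Proof. by apply: val_inj; rewrite /= mulrDl mulrA. Qed.

Lemma mul_form_homog (i : int) y : vhomog d l i (val y) ->
  vhomog d 0 (i + ((l + t) %/ d)%N%:Z) (val (mul_form y)).
Proof.
case: i => [n|n] /= hy; last by rewrite (eqP hy) mul0r vhomog0.
rewrite addn0 mulnDl divnK // addnA; exact: dhomogM.
Qed.

Lemma mul_form_cst y : (0 < t)%N -> cst (mul_form y) = 0.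
Proof.
move=> t0; rewrite /cst /= [LHS](rmorphM (mcoeff 0%MM)).
rewrite [X in _ * X](_ : _ = 0) ?mulr0 //; apply/eqP; rewrite [_ == _]mcoeff_eq0.
apply/negP => /(dhomogP _ _ _ g_homog) /= h; by rewrite -h mdeg0 in t0.
Qed.
End Form.

Variables (r : nat) (d2 : int).
Local Notation E2 := (gsum (gver k d_gt0 l) (fun _ : 'I_r => - d2)).

(** Homogenize the entries of G. *)
Lemma form_map_exists n1 (b : 'I_n1 -> int) (G : 'M[{poly k}]_(r, n1)) :
  (forall p, 0 < d2 * d%:Z - l%:Z - b p * d%:Z) ->
  (forall s, box (fun p => d2 * d%:Z - l%:Z - b p * d%:Z) (row s G)) ->
  exists f2 : {linear E2 -> free b}, [/\ degree0 f2, forall x, dvec (f2 x) = evec x *m G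
    & forall x p, cst (f2 x p : B) = 0].
Proof.
move=> pos hG; pose t p := absz (d2 * d%:Z - l%:Z - b p * d%:Z)%R.
have tE p : (t p)%:Z = d2 * d%:Z - l%:Z - b p * d%:Z by rewrite /t gez0_abs // ltW.
pose g s p := homog_lift (t p) (G s p).
have hg s p : g s p \is (t p).-homog := homog_lift_homog _ _.
have ltE p : (l + t p)%N = (absz (d2 - b p)%R * d)%N.
  apply/eqP; rewrite -eqz_nat PoszD PoszM tE gez0_abs; last by have := pos p; nia.
  by apply/eqP; ring.
have td p : (d %| l + t p)%N by rewrite ltE dvdn_mull.
have dE p : ((l + t p) %/ d)%N%:Z = d2 - b p.
  by rewrite ltE mulnK // gez0_abs //; have := pos p; nia.
pose f (x : E2) : free b := [ffun p => \sum_s mul_form (hg s p) (td p) (x s)].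
have fL : linear f.
  move=> c x y; apply/ffunP => p; rewrite !ffunE.
  transitivity (\sum_s (c * mul_form (hg s p) (td p) (x s) + mul_form (hg s p) (td p) (y s))).
    by apply: eq_bigr => s _; rewrite !ffunE; apply: mul_form_linear.
  by rewrite big_split -mulr_sumr.
exists (HB.pack f (GRing.isLinear.Build B E2 (free b) *:%R f fL) : {linear E2 -> free b}).
split.
- move=> j x hx p; rewrite ffunE; apply: (@ghomog_sum k d (gring k d_gt0)) => s _.
  have -> : - b p + j = (- d2 + j) + ((l + t p) %/ d)%N%:Z by rewrite dE; ring.
  apply: mul_form_homog; exact: hx.
- move=> x; apply/rowP => p; rewrite !mxE ffunE raddf_sum /= raddf_sum.
  apply: eq_bigr => s _; rewrite mxE.
  transitivity (dehom (val (x s : V)) * dehom (g s p)); first exact: rmorphM.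
  congr (_ * _); apply: homog_liftK.
  by rewrite tE; have := hG s p; rewrite mxE.
- move=> x p; rewrite ffunE cst_sum big1 // => s _; apply: mul_form_cst.
  by rewrite -ltz_nat tE.
Qed.
End Multiplication.

Section PureModule.
Variables (k : fieldType) (d : nat).
Hypothesis d_gt0 : (0 < d)%N.
Local Notation B := (vring k d).
Local Notation free := (gfree k d_gt0).

Lemma cst_minimal (N : gmod k d) n (a : 'I_n -> int) (f : {linear N -> free a}) :
  (forall x q, cst (f x q : B) = 0) -> minimal_map f.
Proof.
move=> h x; exists n, (fun q => f x q : B), (fun q => gbasis k d_gt0 a q); split=> [q|].
  exact: h.
exact: gfree_expand.
Qed.

(** Injectivity and exactness are the basis property of G, on homogeneous
    elements. *)
Lemma resolution_of_basis d0 d1 d2 l n0 n1 r (f1 : {linear free (fun _ : 'I_n1 => d1) -> free (fun _ : 'I_n0 => d0)})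
    (G : 'M[{poly k}]_(r, n1)) :
  (l < d)%N -> d1 < d2 -> degree0 f1 ->
  adapted_basis (fun=> d1 * d%:Z) (dmx f1) (fun=> d2 * d%:Z - l%:Z) G ->
  exists f2 : {linear gsum (gver k d_gt0 l) (fun _ : 'I_r => - d2) -> free (fun _ : 'I_n1 => d1)},
    [/\ degree0 f2, injective f2, exact_at f2 f1 & minimal_map f2].
Proof.
move=> ld h12 df1 [h1 h2 h3 h4].
have [p|s|f2 [df2 f2E f2c]] := @form_map_exists k d d_gt0 l r d2 n1 (fun=> d1) G.
- nia.
- exact: h1.
have f1f2 x : f1 (f2 x) = 0.
  have [s [c [us hc ->]]] := homog_decomp x.
  rewrite !linear_sum big1 // => j _; apply: (dvec_inj (df1 _ _ (df2 _ _ (hc j)))).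
  by rewrite dvec_map f2E -mulmxA h2 mulmx0.
have f20 x : f2 x = 0 -> x = 0.
  have [s [c [us hc ->]]] := homog_decomp x => fx.
  have hk := homog_kernel df2 us hc fx; rewrite big_seq big1 // => j js.
  apply: (evec_inj (hc j)); apply: h4; rewrite -f2E hk //; exact: dvec0.
exists f2; split=> //.
- move=> x y fxy; apply/eqP; rewrite -subr_eq0; apply/eqP; apply: f20.
  transitivity (f2 x - f2 y); first exact: raddfB.
  by apply/eqP; rewrite subr_eq0; apply/eqP.
- apply: graded_exact => // j v hv fv.
  have [||w hw wE] := h3 (j * d%:Z) (dvec v).
  + by move=> p; apply: dvec_box hv p.
  + by rewrite -dvec_map fv dvec0.
  have [x hx xE] := evec_lift d_gt0 ld hw.
  exists x; apply/eqP; rewrite -subr_eq0; apply/eqP.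
  apply: (@dvec_inj _ _ d_gt0 _ _ j); first by apply: ghomogB => //; apply: df2.
  by rewrite -scaleN1r dvecD dvecZ rmorphN1 scaleN1r f2E xE wE subrr.
- exact: cst_minimal.
Qed.

(** Take the cokernel of the matrix from Euclid's algorithm.  Its syzygies have
    degree at least q, so each e s is at least d2 * d - l; the balance equations
    say that there are p of them, with the sum p * (d2 * d - l), so all are
    equal. *)
Lemma pure_module_exists (d0 d1 d2 : int) (l : nat) : d0 < d1 -> d1 < d2 -> (l < d)%N ->
  exists M : gmod k d, [/\ fin_gen M, finite_length M, nonzero_module M
    & has_pure_res d_gt0 M d0 d1 d2 l].
Proof.
move=> h01 h12 ld.
have [p pE] : exists p : nat, p%:Z = (d1 - d0) * d%:Z.
  by exists (absz ((d1 - d0) * d%:Z)%R); rewrite gez0_abs //; nia.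
have [q qE] : exists q : nat, q%:Z = d2 * d%:Z - l%:Z - d1 * d%:Z.
  by exists (absz (d2 * d%:Z - l%:Z - d1 * d%:Z)%R); rewrite gez0_abs //; nia.
have q0 : (0 < q)%N by rewrite -ltz_nat qE; nia.
have p0 : (0 < p)%N by rewrite -ltz_nat pE; nia.
have [A pm] := pure_matrix_exists k p q.
pose D : 'M[{poly k}]_(p + q, q) := \matrix_(j, i) A j i.
have DA j i : D j i = A j i by rewrite mxE.
pose a := (fun _ : 'I_q => d0); pose b := (fun _ : 'I_(p + q) => d1).
have [f1 [df1 f1D]] : exists f1 : {linear free b -> free a}, degree0 f1 /\ dmx f1 = D.
  apply: dmx_lift => j i; rewrite !mxE -mulrBl -pE; have [h1 _ _] := pm.
  by apply: h1.
have [M [f0 [df0 sf0 ex1]]] := cokernel_exists df1.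
have dinj v : box (fun=> q%:Z - 1) v -> v *m D = 0 -> v = 0 by exact: pure_matrix_inj pm DA v.
have gen (y : M) : exists c : 'I_q -> B, y = \sum_i c i *: f0 (gbasis k d_gt0 a i).
  by have [v <-] := sf0 y; exists (fun i => v i : B); apply: gfree_mapE.
have fl : finite_length M.
  apply: (@bounded_finite_length k d d_gt0 M q a (fun i => f0 (gbasis k d_gt0 a i)) (absz d0 + (p + q))%N) => //.
    by move=> i; apply: df0; apply: gbasis_homog.
  move=> j hj y hy; have [v fv] := sf0 y; have [v' hv' <-] := homog_preimage df0 hy fv.
  have hj' : (p + q)%N%:Z - 1 <= j%:Z * d%:Z - d0 * d%:Z.
    have : (p + q)%N%:Z <= j%:Z - d0 by lia.
    nia.
  have [w hw wD] := pure_matrix_surj q0 pm DA hj' (dvec_box hv').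
  have [u hu uE] : exists2 u : free b, ghomog j%:Z u & dvec u = w.
    apply: dvec_lift => i; have := hw i; congr (dle _ _); rewrite /b pE; ring.
  apply/ex1; exists u; apply/eqP; rewrite -subr_eq0; apply/eqP.
  apply: (@dvec_inj _ _ d_gt0 _ _ j%:Z); first by apply: ghomogB => //; apply: df1.
  by rewrite -scaleN1r dvecD dvecZ rmorphN1 scaleN1r dvec_map f1D uE wD subrr.
have nz : nonzero_module M.
  pose e0 := gbasis k d_gt0 a (Ordinal q0); exists (f0 e0) => /ex1 [y fy].
  have he0 : ghomog d0 e0 by apply: gbasis_homog.
  have [y' hy' fy'] := homog_preimage df1 he0 fy.
  have y0 : y' = 0.
    apply: (dvec_inj hy'); apply: box_neg (dvec_box hy') => i; rewrite /b; nia.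
  have : e0 (Ordinal q0) = 0 :> B by rewrite -fy' y0 raddf0 ffunE.
  by rewrite gbasisE eqxx => /eqP; rewrite oner_eq0.
have [r [e [G ad]]] := adapted_basis_exists (fun i => b i * d%:Z) (dmx f1).
have e_ge s : d2 * d%:Z - l%:Z <= e s.
  have [g1 g2 _ g4] := ad; rewrite leNgt; apply/negP => lt.
  have row0 : row s G = 0.
    apply: dinj; first by move=> i; apply: dle_le (g1 s i); rewrite /b; lia.
    by rewrite -f1D -row_mul g2 row0.
  have := g4 (delta_mx 0 s); rewrite -rowE row0 => /(_ erefl) /rowP /(_ s) /eqP.
  by rewrite !mxE !eqxx oner_eq0.
have fin := presentation_surj df0 df1 ex1 fl.
have [bal1 bal2] := balance (dmx_box df1) ad d_gt0 fin.
have rp : r = p by lia.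
have natE (z : int) (n : nat) : z *+ n = n%:Z * z by rewrite -mulr_natl natz.
have sum0 : \sum_s (e s - (d2 * d%:Z - l%:Z)) = 0.
  have eE : d2 * d%:Z - l%:Z = q%:Z + d1 * d%:Z by rewrite qE subrK.
  have pE' : p%:Z = d1 * d%:Z - d0 * d%:Z by rewrite pE mulrBl.
  have pq : p%:Z * q%:Z = (d1 * d%:Z - d0 * d%:Z) * q%:Z by rewrite pE'.
  have rp' : r%:Z = p%:Z by rewrite rp.
  rewrite sumrB; move: bal2; rewrite /a /b !sumr_const !card_ord !natE eE rp' PoszD.
  move: pq; move: (\sum_i e i) (d0 * d%:Z) (d1 * d%:Z) (p%:Z) (q%:Z) => S X Y P Q pq h; nia.
have eE s : e s = d2 * d%:Z - l%:Z.
  apply/eqP; rewrite -subr_eq0; move/eqP: sum0; rewrite psumr_eq0 => [|i _]; last by rewrite subr_ge0.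
  by move/allP/(_ s); rewrite mem_index_enum => /(_ isT).
have ad' := adapted_ext eE ad.
have [f2 [df2 f2I ex2 m2]] := resolution_of_basis ld h12 df1 ad'.
exists M; split=> //.
  by exists q, (fun i => f0 (gbasis k d_gt0 a i)).
exists q, (p + q)%N, r, f2, f1, f0; split=> //; split=> //.
apply: cst_minimal => x i; rewrite (gfree_mapE f1) gfree_sum cst_sum big1 // => j _.
rewrite gfreeZ cstM; have := cmx_degree (p := j) (q := i) df1; rewrite mxE => -> //.
  by rewrite mulr0.
by rewrite /b /a gt_eqF.
Qed.
End PureModule.

(** * Extremal rays *)

Section Extremal.
Variables (k : fieldType) (d : nat).
Hypothesis d_gt0 : (0 < d)%N.

Lemma pure_tab_gt0 (d0 d1 d2 : int) (l : nat) : d0 < d1 -> d1 < d2 -> (l < d)%N ->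
  [/\ 0 < pure_tab d d0 d1 d2 l 0 d0, 0 < pure_tab d d0 d1 d2 l 1 d1
    & 0 < pure_tab d d0 d1 d2 l 2 d2].
Proof.
move=> h01 h12 ld; rewrite /= !eqxx addr0 eqxx.
by split; [rewrite ltr0z; nia|rewrite ltr0z; nia|apply: mulr_gt0; [rewrite ltr0z; nia|rewrite ltr0n]].
Qed.

Lemma pure_tab_ge0 (d0 d1 d2 : int) (l : nat) i j : d0 < d1 -> d1 < d2 -> (l < d)%N ->
  0 <= pure_tab d d0 d1 d2 l i j.
Proof.
move=> h01 h12 ld; case: i => [|[|i]] /=; case: eqP => // _; try by rewrite ler0z; nia.
by apply: mulr_ge0; [rewrite ler0z; nia|rewrite ler0n].
Qed.

Lemma pure_table_ge0 t i j : pure_table d t -> 0 <= t i j.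
Proof.
move=> [d0 [d1 [d2 [l [h01 h12 hl ->]]]]]; apply: pure_tab_ge0 => //.
by case: hl => ->; lia.
Qed.

Lemma cone_form_ge0 (f : table -> rat) t :
  (forall n (c : 'I_n -> rat) (b : 'I_n -> table) u, (forall i j, u i j = \sum_s c s * b s i j) -> f u = \sum_s c s * f (b s)) ->
  (forall u, pure_table d u -> 0 <= f u) -> cone_gen (pure_table d) t -> 0 <= f t.
Proof.
move=> fL f0 [n [c [b [c0 bX tE]]]]; rewrite (fL _ _ _ _ tE); apply: sumr_ge0 => s _.
by apply: mulr_ge0 => //; apply: f0.
Qed.

Lemma cone_entry_ge0 t i j : cone_gen (pure_table d) t -> 0 <= t i j.
Proof.
apply: (@cone_form_ge0 (fun u => u i j)) => [n c b u ->//|u]; exact: pure_table_ge0.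
Qed.

(** This form vanishes on M^(d-1), for which the number of first syzygies is
    d - 1 times the number of generators; the M^(l) with smaller l have fewer. *)
Definition linear_strand (e : int) (t : table) : rat := d.-1%:R * t 2 e - t 3 (e + 1).

Lemma linear_strand_pure e d0 d1 d2 l : (l < d)%N ->
  linear_strand e (pure_tab d d0 d1 d2 l) =
  if d2 == e then ((d1 - d0) * d%:Z)%:~R * (d.-1 - l)%:R else 0.
Proof.
move=> ld; rewrite /linear_strand /= addr0 (inj_eq (addIr 1)).
case: eqP => _; last by rewrite mulr0 subrr.
rewrite mulrCA -mulrBr; congr (_ * _); rewrite prednK // -natrM -natrB; last by nia.
by congr (_%:R); nia.
Qed.

Lemma linear_strand_ge0 e t : cone_gen (pure_table d) t -> 0 <= linear_strand e t.
Proof.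
apply: cone_form_ge0 => [n c b u uE|u [d0 [d1 [d2 [l [h01 h12 hl uE]]]]]].
  rewrite /linear_strand !uE mulr_sumr -sumrB; apply: eq_bigr => s _; ring.
have ld : (l < d)%N by case: hl => ->; lia.
rewrite [X in 0 <= X](_ : _ = linear_strand e (pure_tab d d0 d1 d2 l)).
  rewrite linear_strand_pure //; case: eqP => // _.
  by apply: mulr_ge0; [rewrite ler0z; nia|rewrite ler0n].
by rewrite /linear_strand !uE.
Qed.

(** Entries of cone members are nonnegative, so P vanishes where the given pure
    table does; this determines d0, d1, d2 and excludes l' = d - 1 when l = 0.
    If l = d - 1, the linear strand form excludes l' = 0. *)
Lemma pure_summand (d0 d1 d2 : int) (l : nat) (a c : rat) P w : d0 < d1 -> d1 < d2 -> l = 0%N \/ l = d.-1 ->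
  0 < c -> pure_table d P -> cone_gen (pure_table d) w ->
  (forall i j, c * P i j + w i j = a * pure_tab d d0 d1 d2 l i j) ->
  forall i j, P i j = pure_tab d d0 d1 d2 l i j.
Proof.
move=> h01 h12 hl c0 [d0' [d1' [d2' [l' [h01' h12' hl' PE]]]]] hw sumE.
have ld' : (l' < d)%N by case: hl' => ->; lia.
have ld : (l < d)%N by case: hl => ->; lia.
have supp i j : 0 < pure_tab d d0' d1' d2' l' i j -> pure_tab d d0 d1 d2 l i j != 0.
  move=> pos; apply/eqP => z; have := sumE i j; rewrite z mulr0 PE => /eqP.
  rewrite gt_eqF //; apply: ltr_pwDl; last exact: cone_entry_ge0.
  exact: mulr_gt0.
have [p0 p1 p2] := pure_tab_gt0 h01' h12' ld'.
have e0 : d0' = d0 by move: (supp _ _ p0) => /=; case: (d0' =P d0) => [->|_]; rewrite ?eqxx.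
have e1 : d1' = d1 by move: (supp _ _ p1) => /=; case: (d1' =P d1) => [->|_]; rewrite ?eqxx.
have e2 : d2' = d2 by move: (supp _ _ p2) => /=; rewrite addr0; case: (d2 =P d2') => [->|_]; rewrite ?eqxx.
move: PE supp; rewrite {}e0 {}e1 {}e2 => PE supp {p0 p1 p2 h01' h12'}.
have strandE : c * linear_strand d2 (pure_tab d d0 d1 d2 l') + linear_strand d2 w
    = a * linear_strand d2 (pure_tab d d0 d1 d2 l).
  rewrite /linear_strand.
  transitivity (d.-1%:R * (c * P 2 d2 + w 2 d2) - (c * P 3 (d2 + 1) + w 3 (d2 + 1))).
    rewrite !PE; ring.
  rewrite !sumE; ring.
suff lE : l = l' by rewrite lE.
have supp3 := supp 3 (d2 + 1); have w0 := linear_strand_ge0 d2 hw.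
case: (posnP d.-1) => [dz|dpos]; first by lia.
case: hl => lE.
  apply/eqP; apply: contraT => ll.
  have : pure_tab d d0 d1 d2 l 3 (d2 + 1) != 0.
    apply: supp3; rewrite /= eqxx; apply: mulr_gt0; first by rewrite ltr0z; nia.
    by rewrite ltr0n muln_gt0; lia.
  by rewrite /= eqxx lE mul0n mulr0 eqxx.
have z : (d.-1 - l)%N = 0%N by rewrite lE subnn.
move: strandE; rewrite !linear_strand_pure // eqxx z !mulr0 => strandE.
apply/eqP; apply: contraT => ll; exfalso.
have : 0 < c * (((d1 - d0) * d%:Z)%:~R * (d.-1 - l')%:R).
  by rewrite pmulr_rgt0 // mulr_gt0 // ?ltr0z ?ltr0n; [nia|lia].
by lra.
Qed.

Lemma pure_extremal (d0 d1 d2 : int) (l : nat) (a : rat) t u : d0 < d1 -> d1 < d2 -> l = 0%N \/ l = d.-1 ->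
  cone_gen (pure_table d) t -> cone_gen (pure_table d) u ->
  (forall i j, t i j + u i j = a * pure_tab d d0 d1 d2 l i j) ->
  ray (pure_tab d d0 d1 d2 l) t.
Proof.
move=> h01 h12 hl [n [c [b [c0 bX tE]]]] hu sumE.
have bE s : c s != 0 -> forall i j, b s i j = pure_tab d d0 d1 d2 l i j.
  move=> cs; (* the combination without its s-th term *)
  pose c' s' := if s' == s then 0 else c s'.
  pose w i j := (\sum_s' c' s' * b s' i j) + u i j.
  apply: (@pure_summand d0 d1 d2 l a (c s) (b s) w) => //.
  - by rewrite lt0r cs c0.
  - apply: cone_add => //; apply: cone_sum => [s'|s' _]; first by rewrite /c'; case: ifP.
    exact: cone_in.
  - move=> i j; rewrite -sumE tE /w addrA (bigD1 s) //=; congr (_ + _); rewrite [in RHS](bigD1 s) //=.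
    rewrite /c' eqxx mul0r add0r; congr (_ + _); apply: eq_bigr => s' /negPf -> //.
exists (\sum_s c s); split=> [|i j]; first exact: sumr_ge0.
rewrite tE mulr_suml; apply: eq_bigr => s _.
by case: (eqVneq (c s) 0) => [->|/bE ->]; rewrite ?mul0r.
Qed.

Lemma betti_cone_pure t :
  betti_cone d_gt0 (@finite_length k d) t <-> cone_gen (pure_table d) t.
Proof.
split; apply: cone_sub => u.
  move=> [M [fg fl [F uE]]].
  by apply: cone_ext (betti_decomposition F fg fl) => i j; rewrite uE.
move=> [d0 [d1 [d2 [l [h01 h12 hl uE]]]]].
have ld : (l < d)%N by case: hl => ->; lia.
have [M [fg fl nz pr]] := pure_module_exists k d_gt0 h01 h12 ld.
have [c c0 [[F _] FE]] := pure_res_betti h01 h12 ld fl nz pr.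
apply: (@cone_ext _ (fun i j => c^-1 * (tor_dim F i j)%:R)).
  by move=> i j; rewrite FE mulKf ?uE // gt_eqF.
apply: cone_scale; first by rewrite invr_ge0 ltW.
by apply: cone_in; exists M; split=> //; exists F.
Qed.

Lemma ray_scale (v w : table) c t : 0 < c -> (forall i j, w i j = c * v i j) ->
  ray w t <-> ray v t.
Proof.
move=> c0 wE; split=> [[a [a0 tE]]|[a [a0 tE]]].
  by exists (a * c); split=> [|i j]; [rewrite mulr_ge0 // ltW|rewrite tE wE mulrA].
exists (a / c); split=> [|i j]; first by rewrite divr_ge0 // ltW.
by rewrite wE mulrA divfK ?tE // gt_eqF.
Qed.

(** A nonzero cone member has a nonzero pure summand; on an extremal ray this
    summand spans the ray. *)
Lemma extremal_ray_pure (R : table -> Prop) :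
  extremal_ray (cone_gen (pure_table d)) R <->
  exists (d0 d1 d2 : int) (l : nat), [/\ d0 < d1, d1 < d2, l = 0%N \/ l = d.-1
    & forall t, R t <-> ray (pure_tab d d0 d1 d2 l) t].
Proof.
split=> [[[v [[n [c [b [c0 bX vE]]]] [i0 [j0 v0]] RE]] ext]|[d0 [d1 [d2 [l [h01 h12 hl RE]]]]]]; last first.
  have ld : (l < d)%N by case: hl => ->; lia.
  have [p0 _ _] := pure_tab_gt0 h01 h12 ld.
  split.
    exists (pure_tab d d0 d1 d2 l); split=> //.
      by apply: cone_in; exists d0, d1, d2, l.
    by exists 0%N, d0; apply/eqP; rewrite gt_eqF.
  move=> t u ht hu /RE [a [a0 tuE]].
  split; apply/RE.
    exact: pure_extremal hl ht hu tuE.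
  by apply: (pure_extremal h01 h12 hl hu ht (a := a)) => i j; rewrite addrC.
have [s hs] : exists s, c s * b s i0 j0 != 0.
  apply: NNPP => h; apply: v0; rewrite vE big1 // => s _; apply/eqP.
  by apply: contraT => hs; case: h; exists s.
pose t i j := c s * b s i j.
pose c' s' := if s' == s then 0 else c s'.
pose u i j := \sum_s' c' s' * b s' i j.
have ht : cone_gen (pure_table d) t by apply: cone_scale => //; apply: cone_in.
have hu : cone_gen (pure_table d) u.
  by apply: cone_sum => [s'|s' _]; [rewrite /c'; case: ifP|apply: cone_in].
have [|/RE [a [a0 tE]] _] := ext t u ht hu.
  apply/RE; exists 1; split=> // i j; rewrite mul1r vE (bigD1 s) //= /u (bigD1 s) //=.
  rewrite /c' eqxx mul0r add0r; congr (_ + _); apply: eq_bigr => s' /negPf -> //.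
have cs : 0 < c s.
  by rewrite lt0r c0 andbT; apply: contraNneq hs => ->; rewrite mul0r.
have a1 : 0 < a.
  by rewrite lt0r a0 andbT; apply: contraNneq hs => az; rewrite [_ * _]tE az mul0r.
have [d0 [d1 [d2 [l [h01 h12 hl bE]]]]] := bX s.
exists d0, d1, d2, l; split=> // x.
apply: (iff_trans (RE x)); apply: (iff_trans (iff_sym (ray_scale x a1 tE))).
by apply: ray_scale cs _ => i j; rewrite /t bE.
Qed.
End Extremal.

Theorem theorem4p1 (k : fieldType) (d : nat) (d_gt0 : (0 < d)%N)
    (R : table -> Prop) :
  extremal_ray (betti_cone d_gt0 (@finite_length k d)) R <->
  exists (M : gmod k d) (b : table) (d0 d1 d2 : int) (l : nat),
    [/\ [/\ d0 < d1, d1 < d2 & l = 0%N \/ l = d.-1],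
        [/\ fin_gen M, finite_length M & nonzero_module M],
        has_pure_res d_gt0 M d0 d1 d2 l,
        is_betti d_gt0 M b
      & forall t, R t <-> ray b t].
Proof.
have coneE := @betti_cone_pure k d d_gt0.
have extE : extremal_ray (betti_cone d_gt0 (@finite_length k d)) R <->
    extremal_ray (cone_gen (pure_table d)) R.
  split=> [[[v [hv v0 RE]] ext]|[[v [hv v0 RE]] ext]]; (split;
    [by exists v; split=> //; apply/coneE|by move=> t u /coneE ht /coneE hu; apply: ext]).
apply: (iff_trans extE); apply: (iff_trans (extremal_ray_pure d_gt0 R)); split.
  move=> [d0 [d1 [d2 [l [h01 h12 hl RE]]]]].
  have ld : (l < d)%N by case: hl => ->; lia.
  have [M [fg fl nz pr]] := pure_module_exists k d_gt0 h01 h12 ld.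
  have [c c0 [[F _] FE]] := pure_res_betti h01 h12 ld fl nz pr.
  exists M, (fun i j => (tor_dim F i j)%:R), d0, d1, d2, l; split=> //; first by exists F.
  by move=> t; apply: (iff_trans (RE t)); apply: iff_sym; apply: ray_scale c0 _.
move=> [M [b [d0 [d1 [d2 [l [[h01 h12 hl] [fg fl nz] pr [F bE] RE]]]]]]].
have ld : (l < d)%N by case: hl => ->; lia.
have [c c0 [_ FE]] := pure_res_betti h01 h12 ld fl nz pr.
exists d0, d1, d2, l; split=> // t; apply: (iff_trans (RE t)).
by apply: ray_scale c0 _ => i j; rewrite bE.
Qed.
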